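(* Let $l>0$, $\Omega=(0,\pi)\times(-l,l)$, $\sigma\in(0,1)$, $0<\alpha<1<\beta$, and let $\psi_-,\psi_+\in C^0(\overline\Omega)$ with $\psi_-\le0\le\psi_+$, $\psi_-\not\equiv0$, $\psi_+\not\equiv0$. Let $D\subset\Omega$ be any open set and $p\in(1,+\infty]$. Then: (a) for the energy $\mathbb{E}_1$, the supremum of $\mathcal{A}^\infty_{f,D}$ over $f\in\mathcal{F}:=\{f\in(C^0(\overline\Omega))': \|f\|_{(C^0(\overline\Omega))'}\le1\}$ is attained; (b) for each of the energies $\mathbb{E}_1$ and $\mathbb{E}_2$, the supremum of $\mathcal{A}^\infty_{f,D}$ over $f\in\mathcal{F}:=\{f\in L^p(\Omega):\|f\|_{L^p(\Omega)}\le1\}$ is attained. Moreover, in each of these cases, if $-\psi_-\equiv\psi_+$ and $f$ is a maximizer, then $-f$ is also a maximizer.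
   Context: $H^2_*(\Omega):=\{v\in H^2(\Omega): v=0\text{ on }\{0,\pi\}\times(-l,l)\}$, identified with continuous functions on $\overline\Omega$. For an open $E\subset\Omega$ set $(u,v)_E:=\int_E\big(\Delta u\,\Delta v+(1-\sigma)(2u_{xy}v_{xy}-u_{xx}v_{yy}-u_{yy}v_{xx})\big)\,dx\,dy$, and $(u,v)_{H^2_*(\Omega)}:=(u,v)_\Omega$ (a scalar product on $H^2_*(\Omega)$ with norm equivalent to the $H^2$ norm). $(C^0(\overline\Omega))'$ is the dual of $C^0(\overline\Omega)$ (finite Radon measures) with the dual norm and pairing $\langle f,u\rangle$; for $f\in L^1$, $\langle f,u\rangle=\int_\Omega fu$. Let $K:=\{v\in H^2_*(\Omega):\psi_-\le v\le\psi_+\text{ in }\overline\Omega\}$ and $D^c=\Omega\setminus D$. For energy $\mathbb{E}_1(u)=\int_\Omega(\beta\chi_D+\alpha\chi_{D^c})\big(\tfrac12(\Delta u)^2+(1-\sigma)(u_{xy}^2-u_{xx}u_{yy})\big)-\langle f,u\rangle$, $u_{f,D}$ denotes its unique minimizer over $K$, i.e. the unique $u\in K$ with $\alpha(u,\varphi-u)_{H^2_*(\Omega)}+(\beta-\alpha)(u,\varphi-u)_D\ge\langle f,\varphi-u\rangle$ for all $\varphi\in K$. For energy $\mathbb{E}_2(u)=\int_\Omega\big(\tfrac12(\Delta u)^2+(1-\sigma)(u_{xy}^2-u_{xx}u_{yy})-(\beta\chi_D+\alpha\chi_{D^c})fu\big)$ (for $f\in L^p$), $u_{f,D}$ denotes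 the unique $u\in K$ with $(u,\varphi-u)_{H^2_*(\Omega)}\ge\int_\Omega(\beta\chi_D+\alpha\chi_{D^c})f(\varphi-u)$ for all $\varphi\in K$. In each case $\mathcal{A}^\infty_{f,D}:=\max_{(x,y)\in\overline\Omega}|u_{f,D}(x,y)|$. *)

(* Defs.v *)
From HB Require Import structures.
From mathcomp Require Import all_boot all_order all_algebra.
From mathcomp Require Import all_classical all_reals all_analysis.
Set Implicit Arguments. Unset Strict Implicit. Unset Printing Implicit Defensive.
Import Order.TTheory GRing.Theory Num.Theory.
Import numFieldNormedType.Exports.
Local Open Scope classical_set_scope.
Local Open Scope ring_scope.

Section Defs.
Variable R : realType.
Local Notation P := (R * R)%type.

Definition leb2 := ((@lebesgue_measure R) \x (@lebesgue_measure R))%E.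

Definition Omega (l : R) : set P :=
  [set z | 0 < z.1 < pi /\ - l < z.2 < l].
Definition clOmega (l : R) : set P :=
  [set z | 0 <= z.1 <= pi /\ - l <= z.2 <= l].

Definition e1 : P := (1, 0).
Definition e2 : P := (0, 1).

Fixpoint iter_derive (vs : seq P) (f : P -> R) : P -> R :=
  match vs with
  | [::] => f
  | v :: vs' => fun x => 'D_v (iter_derive vs' f) x
  end.

Definition test_fun (E : set P) (phi : P -> R) :=
  (forall (vs : seq P) (x : P), differentiable (iter_derive vs phi) x) /\
  exists K : set P, [/\ compact K, K `<=` E & forall z, ~ K z -> phi z = 0].

Definition L2on (E : set P) (g : P -> R) :=
  measurable_fun E g /\ (\int[leb2]_(z in E) ((g z) ^+ 2)%:E < +oo)%E.

Definition weak_deriv (E : set P) (vs : seq P) (u g : P -> R) :=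
  forall phi, test_fun E phi ->
    Rintegral leb2 E (fun z => u z * iter_derive vs phi z) =
    (-1) ^+ size vs * Rintegral leb2 E (fun z => g z * phi z).

Definition H2 (E : set P) (u ux uy uxx uxy uyy : P -> R) :=
  [/\ L2on E u, L2on E ux, L2on E uy, L2on E uxx & L2on E uxy] /\ L2on E uyy /\
  [/\ weak_deriv E [:: e1] u ux, weak_deriv E [:: e2] u uy,
      weak_deriv E [:: e1; e1] u uxx, weak_deriv E [:: e1; e2] u uxy
    & weak_deriv E [:: e2; e2] u uyy].

(* u in H^2_*(Omega), u being its continuous representative on the closure,
   with second weak derivatives uxx, uxy, uyy *)
Definition H2star (l : R) (u uxx uxy uyy : P -> R) :=
  (exists ux uy, H2 (Omega l) u ux uy uxx uxy uyy) /\
  {within clOmega l, continuous u} /\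
  (forall y, - l < y < l -> u (0, y) = 0 /\ u (pi, y) = 0).

Definition bform (sigma : R) (E : set P) (uxx uxy uyy vxx vxy vyy : P -> R) :=
  Rintegral leb2 E (fun z =>
    (uxx z + uyy z) * (vxx z + vyy z)
    + (1 - sigma) * (2 * uxy z * vxy z - uxx z * vyy z - uyy z * vxx z)).

Definition inK (l : R) (psim psip : P -> R) (v : P -> R) :=
  (exists vxx vxy vyy, H2star l v vxx vxy vyy) /\
  (forall z, clOmega l z -> psim z <= v z <= psip z).

(* u = u_{f,D} for the energy E_1, with <f, .> given by [pair] *)
Definition Sol1 (l sigma alpha beta : R) (psim psip : P -> R) (D : set P)
    (pair : (P -> R) -> R) (u : P -> R) :=
  inK l psim psip u /\
  forall uxx uxy uyy, H2star l u uxx uxy uyy ->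
  forall phi pxx pxy pyy, inK l psim psip phi -> H2star l phi pxx pxy pyy ->
    pair (fun z => phi z - u z) <=
      alpha * bform sigma (Omega l) uxx uxy uyy
                (pxx \- uxx) (pxy \- uxy) (pyy \- uyy)
      + (beta - alpha) * bform sigma D uxx uxy uyy
                (pxx \- uxx) (pxy \- uxy) (pyy \- uyy).

Definition Sol2 (l sigma alpha beta : R) (psim psip : P -> R) (D : set P)
    (f : P -> R) (u : P -> R) :=
  inK l psim psip u /\
  forall uxx uxy uyy, H2star l u uxx uxy uyy ->
  forall phi pxx pxy pyy, inK l psim psip phi -> H2star l phi pxx pxy pyy ->
    Rintegral leb2 (Omega l)
      (fun z => (beta * \1_D z + alpha * \1_(~` D) z) * f z * (phi z - u z))
    <= bform sigma (Omega l) uxx uxy uyy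
                (pxx \- uxx) (pxy \- uxy) (pyy \- uyy).

Definition Ainf (l : R) (u : P -> R) : R := sup [set `|u z| | z in clOmega l].

Definition supnorm (l : R) (g : P -> R) : R := sup [set `|g z| | z in clOmega l].

(* F for part (a): the closed unit ball of the dual of C^0(closure Omega);
   an element is a functional acting on functions continuous on the closure,
   linear there and depending only on values on the closure. *)
Definition dualC0_ball (l : R) (f : (P -> R) -> R) :=
  [/\ (forall (a : R) (g h : P -> R), {within clOmega l, continuous g} ->
         {within clOmega l, continuous h} ->
         f (fun z => a * g z + h z) = a * f g + f h),
      (forall g h : P -> R, {within clOmega l, continuous g} ->
         {within clOmega l, continuous h} ->
         (forall z, clOmega l z -> g z = h z) -> f g = f h)
    & (forall g : P -> R, {within clOmega l, continuous g} -> `|f g| <= supnorm l g)].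

Definition Lp_ball (l : R) (p : \bar R) (f : P -> R) :=
  measurable_fun (Omega l) f /\
  ('N[leb2]_p[EFin \o (f \_ (Omega l))] <= 1)%E.

(* f0 maximizes f |-> A^infty_{f,D} over F, where Sol f u means u = u_{f,D} *)
Definition is_maximizer (X : Type) (F : set X) (Sol : X -> (P -> R) -> Prop)
    (l : R) (f0 : X) :=
  F f0 /\ exists u0, Sol f0 u0 /\
    forall f u, F f -> Sol f u -> Ainf l u <= Ainf l u0.

End Defs.

(* Main.v *)
(** Test the variational inequality with [phi = 0]: the plate form dominates
    [1 - sigma] times the sum of the squared second derivatives, so all solutions
    have second derivatives bounded in [L^2].  The bound on [u_xy] controls the
    mixed difference of [u] over a rectangle by the square root of its area.  With
    [u(0, y) = 0] this gives a modulus of continuity in [y], and with the bound on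
    [u_x] also one in [x]; the solutions are therefore equicontinuous up to the
    boundary.  Along a maximizing sequence all limits are taken along one
    ultrafilter: pointwise, hence uniformly, for the solutions; weakly for their
    derivatives and for the data in [L^p]; pointwise for functionals.  A weak limit
    is the Radon-Nikodym derivative of the limit of the charges
    [A |-> int_A f_i].  Positivity of the form [a] gives
    [a(u_i, phi - u_i) <= a(u_i, phi - 2 u) + a(u, u)], whose right-hand side
    is linear in [u_i], and this carries the variational inequality to the limit. *)

Require Import Defs.
From HB Require Import structures.
From mathcomp Require Import all_boot all_order all_algebra.
From mathcomp Require Import all_classical all_reals all_analysis.
From mathcomp Require Import measurable_realfun ess_sup_inf ring lra.
Import Order.TTheory GRing.Theory Num.Theory.
Import numFieldNormedType.Exports.
Local Open Scope classical_set_scope.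
Local Open Scope ring_scope.
Set Implicit Arguments. Unset Strict Implicit. Unset Printing Implicit Defensive.

(** * Smooth functions of one variable *)

(** The energy bounds second derivatives only, while [H2star] also asks the limit for first weak
    derivatives in L^2. The obstacles bound [u] uniformly, and a horizontal primitive of a test
    function carries the bounds of [u], [u_xx], [u_xy] over to [u_x] and [u_y]. The part of the test
    function without compactly supported primitive is absorbed by a bump in [x]: an interior one for
    [u_x], where integration by parts leads back to the bounded [u], and one close to the side x = 0
    for [u_y], where [u] is small. In these estimates weak derivatives are tested only with products
    a(x) b(y); a Dynkin class argument shows that sums of such products approximate every indicator.
    The two energies become one obstacle problem for the form A a_Omega + B a_D with an abstract
    pairing, and the supremum runs over all pairs of a datum and a solution for it. *)

Section Smooth.
Variable R : realType.
Implicit Types f g : R -> R.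

(* [C^infinity], coinductively: [f] lies in a set of functions closed under taking
   derivatives. *)
Definition smooth f := exists2 S : set (R -> R), S f &
  forall g, S g -> exists2 g', S g' & forall x : R, is_derive x 1 g (g' x).

Lemma smooth_ex_derive f : smooth f ->
  exists2 f', smooth f' & forall x : R, is_derive x 1 f (f' x).
Proof.
move=> [S Sf HS]; have [f' Sf' H] := HS _ Sf.
by exists f' => //; exists S.
Qed.

Lemma smooth_coind (S : set (R -> R)) :
  (forall g, S g -> exists2 g', S g' & forall x : R, is_derive x 1 g (g' x)) ->
  S `<=` smooth.
Proof. by move=> HS f Sf; exists S. Qed.

Lemma smoothP f : smooth f ->
  smooth (derive1 f) /\ forall x : R, is_derive x 1 f ((derive1 f) x).
Proof.
move=> /smooth_ex_derive[f' sf' H].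
suff -> : (derive1 f) = f' by [].
by apply/funext => x; rewrite derive1E; apply: derive_val.
Qed.

Lemma smooth_derive f : smooth f -> smooth (derive1 f).
Proof. by move=> /smoothP[]. Qed.

Lemma smooth_is_derive f (x : R) : smooth f -> is_derive x 1 f ((derive1 f) x).
Proof. by move=> /smoothP[_]; apply. Qed.

Lemma smooth_antiderivative f g : smooth g ->
  (forall x : R, is_derive x 1 f (g x)) -> smooth f.
Proof.
move=> sg H; exists [set h | h = f \/ smooth h]; first by left.
move=> h [->|sh]; first by exists g => //; right.
by have [h' sh' H'] := smooth_ex_derive sh; exists h' => //; right.
Qed.

Lemma smooth_cst (c : R) : smooth (fun=> c).
Proof.
exists [set h | exists c, h = fun=> c]; first by exists c.
move=> _ [d ->]; exists (fun=> 0); first by exists 0.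
by move=> x; apply: is_derive_cst.
Qed.

Lemma smoothD f g : smooth f -> smooth g -> smooth (fun x => f x + g x).
Proof.
move=> sf sg.
pose S := [set h : R -> R | exists f g, [/\ smooth f, smooth g & h = fun x => f x + g x]].
suff : S `<=` smooth by apply; exists f, g.
apply: smooth_coind => _ [{sf}f [{sg}g [sf sg ->]]].
have [[sf' df] [sg' dg]] := (smoothP sf, smoothP sg).
exists (fun x => (derive1 f) x + (derive1 g) x); first by exists (derive1 f), (derive1 g).
by move=> x; apply: is_deriveD.
Qed.

(** By the Leibniz rule products alone are not stable under differentiation; their finite sums are,
    and form the set required by [smooth_coind]. *)
Inductive prod_span : (R -> R) -> Prop :=
| prod_span_mul f g : smooth f -> smooth g -> prod_span (fun x => f x * g x)
| prod_span_add f g : prod_span f -> prod_span g -> prod_span (fun x => f x + g x).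

Lemma smoothM f g : smooth f -> smooth g -> smooth (fun x => f x * g x).
Proof.
move=> sf sg; suff : prod_span `<=` smooth by apply; apply: prod_span_mul.
apply: smooth_coind => h; elim => {f g sf sg h} [f g sf sg|f g _ [f' sf' df] _ [g' sg' dg]].
  have [[sf' df] [sg' dg]] := (smoothP sf, smoothP sg).
  exists (fun x => f x * (derive1 g) x + g x * (derive1 f) x).
    by apply: prod_span_add; apply: prod_span_mul.
  by move=> x; apply: is_deriveM.
exists (fun x => f' x + g' x); first exact: prod_span_add.
by move=> x; apply: is_deriveD.
Qed.

Lemma smoothZ (c : R) f : smooth f -> smooth (fun x => c * f x).
Proof. by move=> sf; apply: smoothM => //; exact: smooth_cst. Qed.

Lemma is_derive_affine (k m x : R) : is_derive x 1 (fun x => k * x + m) k.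
Proof.
have H1 : is_derive x 1 (fun x : R => k * x) (k *: 1).
  by apply: is_deriveZ.
rewrite -[k in is_derive _ _ _ k](addr0 k) -[k in k + 0]mulr1.
exact: is_deriveD.
Qed.

Lemma smooth_affine (k m : R) f : smooth f -> smooth (fun x => f (k * x + m)).
Proof.
move=> sf.
(* The factor [c] collects the powers of [k] that the chain rule produces. *)
pose S := [set h : R -> R | exists c f, smooth f /\ h = fun x => c * f (k * x + m)].
suff : S `<=` smooth.
  apply; exists 1, f; split => //; apply/funext => x; by rewrite mul1r.
apply: smooth_coind => _ [c [{sf}f [sf ->]]].
have [sf' df] := smoothP sf.
exists (fun x => (c * k) * (derive1 f) (k * x + m)); first by exists (c * k), (derive1 f).
move=> x; rewrite -mulrA.
have := @is_derive1_comp _ f (fun x => k * x + m) x _ _ (df (k * x + m)) (is_derive_affine k m x).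
move=> H; have : is_derive x 1 (c *: (f \o (fun x => k * x + m))) (c *: (derive1 f (k * x + m) * k)).
  exact: is_deriveZ.
by rewrite mulrC.
Qed.

Lemma smooth_continuous f : smooth f -> continuous f.
Proof.
move=> /smoothP[_ H] x; apply/differentiable_continuous/derivable1_diffP.
by have [] := H x.
Qed.

(** The functions p(1/x) exp(-1/x), extended by 0 to x <= 0. Differentiation replaces p by X^2 (p -
    p'), so the family is closed under derivatives, and p = 1 gives the classical flat function. *)
Definition flatp (p : {poly R}) (x : R) : R :=
  if 0 < x then p.[x^-1] * expR (- x^-1) else 0.

(** The exponential dominates each term of its series, so t^n exp(-t) is at most n!; this is summed
    over the coefficients of [p]. *)
Lemma poly_expRN_bounded (p : {poly R}) :
  exists C : R, forall t : R, 0 < t -> `|p.[t] * expR (- t)| <= C.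
Proof.
have H n (t : R) : 0 < t -> `|t ^+ n * expR (- t)| <= n`!%:R.
  move=> t0; rewrite ger0_norm; last by rewrite mulr_ge0 ?expR_ge0 ?exprn_ge0 ?ltW.
  rewrite expRN ler_pdivrMr ?expR_gt0//.
  case: n => [|n].
    by rewrite expr0 fact0 mul1r -expR0 ler_expR ltW.
  have f0 : 0 < n.+1`!%:R :> R by rewrite ltr0n fact_gt0.
  apply: le_trans (ler_wpM2l (ltW f0) (expR_ge1Dxn n (ltW t0))).
  rewrite mulrDr mulr1 mulrC mulrVK ?unitfE ?gt_eqF// lerDr ltW//.
exists (\sum_(i < size p) `|p`_i| * i`!%:R) => t t0.
rewrite horner_coef mulr_suml; apply: le_trans (ler_norm_sum _ _ _) _.
apply: ler_sum => i _; rewrite -mulrA normrM ler_wpM2l//; exact: H.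
Qed.

Lemma is_derive_flatp (p : {poly R}) (x : R) :
  is_derive x 1 (flatp p) (flatp ('X^2 * (p - p^`())) x).
Proof.
have [x0|x0|->] := ltgtP x 0.
- rewrite {2}/flatp ltNge (ltW x0) /=.
  have D0 : is_derive x 1 (fun=> 0 : R) (0 : R) by apply: is_derive_cst.
  apply: near_eq_is_derive D0.
  near=> y; rewrite /flatp ltNge ltW//.
  by near: y; apply: lt_nbhsl.
- rewrite {2}/flatp x0.
  apply: (@near_eq_is_derive R R R (fun y => p.[y^-1] * expR (- y^-1))).
    near=> y; rewrite /flatp.
    suff -> : 0 < y by [].
    by near: y; apply: lt_nbhsr.
  have xN0 : x != 0 by rewrite gt_eqF.
  have dV : is_derive x 1 (fun y : R => y^-1) (- x ^- 2).
    have := @is_deriveV R id x 1 1 xN0 (is_derive_id _ _).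
    by rewrite /GRing.scale/= mulr1.
  have dp : is_derive x 1 (fun y => p.[y^-1]) (p^`().[x^-1] * (- x ^- 2)).
    exact: (@is_derive1_comp R (horner p) (fun y => y^-1) x _ _ (is_derive_poly p x^-1) dV).
  have de : is_derive x 1 (fun y => expR (- y^-1)) (expR (- x^-1) * (x ^- 2)).
    have dN : is_derive x 1 (fun y : R => - y^-1) (x ^- 2).
      by rewrite -[x ^- 2]opprK; apply: is_deriveN.
    exact: (@is_derive1_comp R expR (fun y => - y^-1) x _ _ (is_derive_expR _) dN).
  have := is_deriveM dp de; congr is_derive.
  rewrite hornerM hornerXn hornerD hornerN exprVn /GRing.scale/=; ring.
- rewrite {2}/flatp ltxx.
  (* With t = 1/h the difference quotient at 0 is h times t^2 p(t) exp(-t), and this polynomial is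
     bounded against the exponential. *)
  have [C HC] := poly_expRN_bounded ('X^2 * p).
  have key (h : R) : `|h^-1 * flatp p h| <= `|C| * `|h|.
    rewrite /flatp; case: ifPn => h0; last by rewrite mulr0 normr0 mulr_ge0.
    have hi : 0 < h^-1 by rewrite invr_gt0.
    have := HC _ hi; rewrite hornerM hornerXn => H.
    rewrite -ler_pdivrMr ?normr_gt0 ?gt_eqF//.
    apply: le_trans (ler_norm C); apply: le_trans H.
    rewrite -normfV -normrM le_eqVlt; apply/orP; left; apply/eqP; congr (`|_|).
    ring.
  have cv : (h^-1 *: (flatp p (h *: 1 + 0) - flatp p 0)) @[h --> (0:R)^'] --> (0 : R).
    apply/norm_cvg0P.
    apply: (@squeeze_cvgr _ _ _ _ (fun=> 0) (fun h => `|C| * `|h|)).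
    - near=> h; rewrite normr_ge0/= addr0 [h *: 1]mulr1 {2}/flatp ltxx subr0.
      exact: key.
    - exact: cvg_cst.
    - have H : (`|C| * `|h|) @[h --> (0:R)^'] --> `|C| * `|0 : R|.
        apply: cvgM; first exact: cvg_cst.
        apply: cvg_norm; apply: cvg_within.
      by move: H; rewrite [`|0|]normr0 mulr0.
  apply: DeriveDef; first by apply/cvg_ex; exists 0.
  exact: cvg_lim.
Unshelve. all: end_near. Qed.

Definition flat : R -> R := flatp 1.

Lemma flatE (x : R) : flat x = if 0 < x then expR (- x^-1) else 0.
Proof. by rewrite /flat /flatp hornerC mul1r. Qed.

Lemma flat_smooth : smooth flat.
Proof.
suff : [set g | exists p, g = flatp p] `<=` smooth by apply; exists 1.
apply: smooth_coind => _ [p ->]; exists (flatp ('X^2 * (p - p^`()))).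
  by eexists.
exact: is_derive_flatp.
Qed.

Lemma flat_ge0 x : 0 <= flat x.
Proof. by rewrite flatE; case: ifP => // _; exact: expR_ge0. Qed.

Lemma flat_le1 x : flat x <= 1.
Proof.
rewrite flatE; case: ifP => // x0.
by rewrite -expR0 ler_expR oppr_le0 invr_ge0 ltW.
Qed.

Lemma flat0 x : x <= 0 -> flat x = 0.
Proof. by move=> x0; rewrite flatE ltNge x0. Qed.

Lemma flat_gt0 x : 0 < x -> 0 < flat x.
Proof. by move=> x0; rewrite flatE x0 expR_gt0. Qed.

End Smooth.

(** * Tensor products of one-variable test functions *)

Section TestFun.
Variable R : realType.
Implicit Types (a b f g : R -> R).

(** Smooth functions with compact support in the open interval from [s] to [t]. The case d < c is
    allowed and means that [f] vanishes identically. *)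
Definition test1 (s t : R) f := smooth f /\
  exists c d, [/\ s < c, d < t & forall x, ~ (c <= x <= d) -> f x = 0].

Lemma test1_smooth s t f : test1 s t f -> smooth f.
Proof. by case. Qed.

Lemma test1D s t f g : test1 s t f -> test1 s t g ->
  test1 s t (fun x => f x + g x).
Proof.
move=> [sf [c [d [sc dt f0]]]] [sg [c' [d' [sc' dt' g0]]]].
split; first exact: smoothD.
exists (Num.min c c'), (Num.max d d'); split.
- by rewrite lt_min sc.
- by rewrite gt_max dt.
- move=> x; rewrite ge_min le_max => H.
  rewrite f0 ?g0 ?addr0// => /andP[H1 H2]; apply: H.
    by rewrite H1 H2 !orbT.
  by rewrite H1 H2.
Qed.

Lemma test1M s t f g : smooth f -> test1 s t g -> test1 s t (fun x => f x * g x).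
Proof.
move=> sf [sg [c [d [sc dt g0]]]]; split; first exact: smoothM.
by exists c, d; split => // x /g0 ->; rewrite mulr0.
Qed.

Lemma test1Z s t (k : R) g : test1 s t g -> test1 s t (fun x => k * g x).
Proof. exact/test1M/smooth_cst. Qed.

Lemma test1N s t g : test1 s t g -> test1 s t (fun x => - g x).
Proof.
by move=> /(test1Z (-1)); congr test1; apply/funext => x; rewrite mulN1r.
Qed.

Lemma test1_derive s t f : test1 s t f -> test1 s t (derive1 f).
Proof.
move=> [sf [c [d [sc dt f0]]]]; split; first exact: smooth_derive.
exists c, d; split => // x xcd.
rewrite derive1E.
suff H : \near x, (fun=> 0 : R) x = f x.
  by rewrite -(@near_eq_derive _ R R _ _ x 1 H) derive_cst.
have [xc|cx] := ltP x c.
  near=> y; rewrite f0// => /andP[cy _].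
  have : y < c by near: y; exact: lt_nbhsl.
  by rewrite ltNge cy.
have [dx|xd] := ltP d x; last by exfalso; apply: xcd; rewrite cx.
near=> y; rewrite f0// => /andP[_ yd].
have : d < y by near: y; exact: lt_nbhsr.
by rewrite ltNge yd.
Unshelve. all: end_near. Qed.

Definition tens a b (z : R * R) : R := a z.1 * b z.2.

Lemma is_diff_fst (z : R * R) : is_diff z (fst : R * R -> R) fst.
Proof.
have c : continuous (fst : R * R -> R) by move=> x; exact: cvg_fst.
split; first exact: linear_differentiable.
exact: diff_lin.
Qed.

Lemma is_diff_snd (z : R * R) : is_diff z (snd : R * R -> R) snd.
Proof.
have c : continuous (snd : R * R -> R) by move=> x; exact: cvg_snd.
split; first exact: linear_differentiable.
exact: diff_lin.
Qed.

Lemma smooth_is_diff a (x : R) : smooth a -> is_diff x a (fun h => h * derive1 a x).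
Proof.
move=> sa; have [H _] := smooth_is_derive x sa.
have D : differentiable a x by exact/derivable1_diffP.
by split => //; rewrite diff1E.
Qed.

Lemma tens_is_diff a b (z : R * R) : smooth a -> smooth b ->
  is_diff z (tens a b) (fun v => v.1 * tens (derive1 a) b z + v.2 * tens a (derive1 b) z).
Proof.
move=> sa sb.
have Ha := is_diff_comp (is_diff_fst z) (smooth_is_diff z.1 sa).
have Hb := is_diff_comp (is_diff_snd z) (smooth_is_diff z.2 sb).
apply: is_diff_eq (is_diffM Ha Hb) _.
apply/funext => v; rewrite /tens /=.
rewrite -[LHS]/(a z.1 * (v.2 * derive1 b z.2) + b z.2 * (v.1 * derive1 a z.1)).
ring.
Qed.

(** A derivative of a tensor product along an oblique vector is a sum of two tensor products.
    [test_fun] speaks of iterated derivatives along arbitrary vectors, hence the span. *)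
Inductive tens_span : (R * R -> R) -> Prop :=
| tens_span_tens a b : smooth a -> smooth b -> tens_span (tens a b)
| tens_span_add (f g : R * R -> R) : tens_span f -> tens_span g ->
    tens_span (fun z => f z + g z).

Lemma tens_span_diff (f : R * R -> R) : tens_span f -> forall z, differentiable f z.
Proof.
elim => {f} [a b sa sb|f g _ Hf _ Hg] z.
  by have [] := tens_is_diff z sa sb.
exact: differentiableD.
Qed.

Lemma tens_span_derive (f : R * R -> R) (v : R * R) : tens_span f -> tens_span ('D_v f).
Proof.
elim => {f} [a b sa sb|f g sf Hf sg Hg].
  rewrite (_ : 'D_v _ = fun z => tens (fun x => v.1 * derive1 a x) b z +
     tens a (fun x => v.2 * derive1 b x) z).
    by apply: tens_span_add; apply: tens_span_tens => //; apply: smoothZ;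
      exact: smooth_derive.
  apply/funext => z; have [D E] := tens_is_diff z sa sb.
  rewrite deriveE// E /tens; ring.
rewrite (_ : 'D_v _ = fun z => 'D_v f z + 'D_v g z); first exact: tens_span_add.
by apply/funext => z; apply: deriveD; apply: diff_derivable; exact: tens_span_diff.
Qed.

Lemma tens_iter_derive vs a b : smooth a -> smooth b ->
  tens_span (iter_derive vs (tens a b)).
Proof.
move=> sa sb; elim: vs => [|v vs IH] /=; first exact: tens_span_tens.
exact: tens_span_derive.
Qed.

Lemma iter_derive1 a b : smooth a -> smooth b ->
  iter_derive [:: e1 R] (tens a b) = tens (derive1 a) b.
Proof.
move=> sa sb; apply/funext => z /=; have [D E] := tens_is_diff z sa sb.
by rewrite deriveE// E /= mul1r mul0r addr0.
Qed.

Lemma iter_derive2 a b : smooth a -> smooth b ->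
  iter_derive [:: e2 R] (tens a b) = tens a (derive1 b).
Proof.
move=> sa sb; apply/funext => z /=; have [D E] := tens_is_diff z sa sb.
by rewrite deriveE// E /= mul1r mul0r add0r.
Qed.

Lemma iter_derive12 a b : smooth a -> smooth b ->
  iter_derive [:: e1 R; e2 R] (tens a b) = tens (derive1 a) (derive1 b).
Proof.
move=> sa sb.
rewrite -[LHS]/('D_(e1 R) (iter_derive [:: e2 R] (tens a b))) iter_derive2//.
exact/iter_derive1/smooth_derive.
Qed.

Lemma iter_derive11 a b : smooth a -> smooth b ->
  iter_derive [:: e1 R; e1 R] (tens a b) = tens (derive1 (derive1 a)) b.
Proof.
move=> sa sb.
rewrite -[LHS]/('D_(e1 R) (iter_derive [:: e1 R] (tens a b))) iter_derive1//.
by apply: iter_derive1 => //; exact/smooth_derive.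
Qed.

Lemma test_fun_tens (l : R) a b : test1 0 pi a -> test1 (- l) l b ->
  test_fun (Omega l) (tens a b).
Proof.
move=> [sa [c [d [sc dt a0]]]] [sb [c' [d' [sc' dt' b0]]]]; split.
  by move=> vs x; apply: tens_span_diff; exact: tens_iter_derive.
exists (`[c, d] `*` `[c', d'])%classic; split.
- by apply: compact_setX; exact: segment_compact.
- move=> z [] /=; rewrite !in_itv/= => /andP[H1 H2] /andP[H3 H4].
  split; apply/andP; split; lra.
- move=> z zK; rewrite /tens.
  have [H|H] := pselect (c <= z.1 <= d); last by rewrite a0// mul0r.
  have [H'|H'] := pselect (c' <= z.2 <= d'); last by rewrite b0// mulr0.
  by exfalso; apply: zK; split; rewrite /= in_itv.
Qed.

End TestFun.

(** * Primitives, bumps and plateaus *)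

Section Primitive.
Variable R : realType.
Implicit Types (a b f g : R -> R) (s t x : R).
Local Notation leb := (@lebesgue_measure R).

Definition prim s f x : R := Rintegral leb `[s, x] f.

Lemma continuous_integrable s x f : continuous f ->
  leb.-integrable `[s, x] (EFin \o f).
Proof.
move=> cf; apply: continuous_compact_integrable; first exact: segment_compact.
exact: continuous_subspaceT.
Qed.

Lemma primD s f g x : continuous f -> continuous g ->
  prim s (fun y => f y + g y) x = prim s f x + prim s g x.
Proof. by move=> cf cg; apply: RintegralD => //; exact: continuous_integrable. Qed.

Lemma primZ s (k : R) f x : continuous f ->
  prim s (fun y => k * f y) x = k * prim s f x.
Proof. by move=> cf; apply: RintegralZl => //; exact: continuous_integrable. Qed.

Lemma prim_ge0 s f x : (forall y, 0 <= f y) -> 0 <= prim s f x.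
Proof. by move=> f0; apply: Rintegral_ge0. Qed.

Lemma prim_eq0 s f x : (forall y, y <= x -> f y = 0) -> prim s f x = 0.
Proof.
move=> f0; rewrite /prim (@eq_Rintegral _ _ _ _ _ (fun=> 0)); last first.
  by move=> y; rewrite inE/= in_itv/= => /andP[_ /f0].
by rewrite Rintegral_cst// mul0r.
Qed.

Lemma primB s f x y : s <= x -> x <= y -> continuous f ->
  prim s f y - prim s f x = Rintegral leb `]x, y] f.
Proof.
move=> sx xy cf; apply: Rintegral_itvB; rewrite ?bnd_simp//.
exact: continuous_integrable.
Qed.

Lemma prim_le_prim s f x y : s <= x -> x <= y -> continuous f -> (forall y, 0 <= f y) ->
  prim s f x <= prim s f y.
Proof.
move=> sx xy cf f0; rewrite -subr_ge0 primB//; exact: Rintegral_ge0.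
Qed.

Lemma prim_const s f x y : s <= x -> x <= y -> continuous f ->
  (forall z, x < z -> f z = 0) -> prim s f y = prim s f x.
Proof.
move=> sx xy cf f0; apply/eqP; rewrite -subr_eq0 primB//; apply/eqP.
rewrite (@eq_Rintegral _ _ _ _ _ (fun=> 0)); last first.
  by move=> z; rewrite inE/= in_itv/= => /andP[/f0].
by rewrite Rintegral_cst// mul0r.
Qed.

Lemma normr_prim_le s f x y : x <= y -> continuous f ->
  `|prim s f x| <= prim s (fun z => `|f z|) y.
Proof.
move=> xy cf.
have cnf : continuous (fun z => `|f z|) by move=> z; apply: cvg_norm; exact: cf.
have := @le_normr_Rintegral _ _ _ leb _ _ (measurable_itv `[s, x]) (continuous_integrable s x cf).
move=> /le_trans; apply.
have [sx|xs] := leP s x; first exact: prim_le_prim.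
have E : `[s, x]%classic = set0 :> set R.
  by apply: set_itv_ge; rewrite bnd_simp -ltNge.
by rewrite E Rintegral_set0; apply: prim_ge0.
Qed.

(** The fundamental theorem of calculus covers the points to the right of [s]; to the left of the
    support of [f], which starts after [s], the primitive is locally zero. *)
Lemma prim_is_derive s t f x : test1 s t f -> is_derive x 1 (prim s f) (f x).
Proof.
move=> [sf [c [d [sc dt f0]]]].
have cf := smooth_continuous sf.
have [xc|cx] := ltP x c.
  have -> : f x = 0 by apply: f0; rewrite leNgt xc.
  have D0 : is_derive x 1 (fun=> 0 : R) (0 : R) by exact: is_derive_cst.
  apply: near_eq_is_derive D0; near=> y; rewrite prim_eq0// => z zy.
  apply: f0; rewrite leNgt (le_lt_trans zy)//.
  by near: y; exact: lt_nbhsl.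
have sx : s < x by exact: lt_le_trans cx.
have x1 : x < x + 1 by rewrite ltrDl.
have [D E] : derivable (prim s f) x 1 /\ derive1 (prim s f) x = f x.
  apply: (@continuous_FTC1 R f (BLeft s) x _ x1 (continuous_integrable _ _ cf)); last exact: cf.
  by rewrite /= lte_fin.
by rewrite -E derive1E; apply: DeriveDef.
Unshelve. all: end_near. Qed.

Lemma prim_smooth s t f : test1 s t f -> smooth (prim s f).
Proof.
move=> tf; apply: (smooth_antiderivative (test1_smooth tf)) => x.
exact: prim_is_derive tf.
Qed.

Lemma prim_derive1 s t f : test1 s t f -> derive1 (prim s f) = f.
Proof.
move=> tf; apply/funext => x; rewrite derive1E.
by have [_ ->] := prim_is_derive x tf.
Qed.

(** Past the support of [f] the primitive is constant, hence equal to its value at [t], which is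
    zero: only functions of zero mean have a compactly supported primitive. *)
Lemma prim_test1 s t f : test1 s t f -> prim s f t = 0 -> test1 s t (prim s f).
Proof.
move=> tf m0; split; first exact: prim_smooth tf.
have [sf [c [d [sc dt f0]]]] := tf.
have cf := smooth_continuous sf.
have sm : s < Num.max c d by rewrite lt_max sc.
have [st|ts] := ltP s t; last first.
  exists c, d; split => // x _; apply: prim_eq0 => y yx; apply: f0 => /andP[cy yd].
  lra.
(* [d] may lie below [s]; the midpoint keeps the right end above [s], as [prim_const] requires. *)
exists c, (Num.max ((s + t)/2) d); split => //; first by rewrite gt_max dt andbT; lra.
move=> x H.
have [xc|cx] := ltP x c.
  apply: prim_eq0 => y yx; apply: f0; rewrite leNgt (le_lt_trans yx)//.
have : Num.max ((s + t)/2) d < x.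
  by rewrite ltNge; apply/negP => xd; apply: H; rewrite cx.
rewrite gt_max => /andP[stx dx].
have f0' z : Num.max ((s + t)/2) d < z -> f z = 0.
  rewrite gt_max => /andP[_ dz]; apply: f0 => /andP[_]; lra.
have sm' : s <= Num.max ((s + t) / 2) d by rewrite le_max; apply/orP; left; lra.
rewrite -m0 (@prim_const s f (Num.max ((s + t)/2) d) x)//; last first.
  by rewrite ge_max !ltW.
rewrite (@prim_const s f (Num.max ((s + t)/2) d) t)//.
by rewrite ge_max (ltW dt) andbT; lra.
Qed.

Definition bump0 (c d x : R) : R := flat (x - c) * flat (d - x).

Lemma bump0_smooth c d : smooth (bump0 c d).
Proof.
have H k m : smooth (fun x : R => flat (k * x + m)).
  exact/smooth_affine/flat_smooth.
rewrite (_ : bump0 c d = fun x => flat (1 * x - c) * flat (-1 * x + d)).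
  by apply: smoothM; exact: H.
by apply/funext => x; rewrite /bump0 mul1r mulN1r addrC [- x + d]addrC.
Qed.

Lemma bump0_ge0 c d x : 0 <= bump0 c d x.
Proof. by rewrite mulr_ge0 ?flat_ge0. Qed.

Lemma bump0_gt0 c d x : c < x < d -> 0 < bump0 c d x.
Proof. by move=> /andP[cx xd]; rewrite mulr_gt0 ?flat_gt0// subr_gt0. Qed.

Lemma bump0_out c d x : ~ (c < x < d) -> bump0 c d x = 0.
Proof.
move=> H; rewrite /bump0; have [xc|cx] := leP x c.
  by rewrite flat0 ?mul0r// subr_le0.
rewrite [X in _ * X]flat0 ?mulr0// subr_le0 leNgt; apply/negP => xd.
by apply: H; rewrite cx.
Qed.

Lemma bump0_test1 s t c d : s < c -> d < t -> test1 s t (bump0 c d).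
Proof.
move=> sc dt; split; first exact: bump0_smooth.
exists c, d; split => // x H; apply: bump0_out => /andP[cx xd].
by apply: H; rewrite !ltW.
Qed.

(** If the mass were zero, the primitive, being monotone, would vanish on the whole interval, and so
    would its derivative at the midpoint of [c] and [d], where the bump is positive. *)
Lemma bump0_mass s t c d : s < c -> c < d -> d < t -> 0 < prim s (bump0 c d) t.
Proof.
move=> sc cd dt.
have T := bump0_test1 sc dt.
have cf := smooth_continuous (bump0_smooth c d).
rewrite lt_neqAle prim_ge0 ?andbT; last exact: bump0_ge0.
apply/eqP => /esym m0.
have P0 x : s <= x -> x <= t -> prim s (bump0 c d) x = 0.
  move=> sx xt; apply/eqP; rewrite eq_le prim_ge0 ?andbT; last exact: bump0_ge0.
  rewrite -m0; apply: prim_le_prim => //; exact: bump0_ge0.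
pose x := (c + d) / 2.
have : 0 < bump0 c d x by apply: bump0_gt0; rewrite /x; apply/andP; split; lra.
have [_ <-] := prim_is_derive x T.
suff H : \near x, (fun=> 0 : R) x = prim s (bump0 c d) x.
  by rewrite -(@near_eq_derive _ R R _ _ x 1 H) derive_cst ltxx.
near=> y; rewrite P0//.
  apply: ltW; near: y; apply: lt_nbhsr; rewrite /x; lra.
apply: ltW; near: y; apply: lt_nbhsl; rewrite /x; lra.
Unshelve. all: end_near. Qed.

Lemma bump_exists s t c d : s < c -> c < d -> d < t ->
  exists f, [/\ test1 s t f, forall x, 0 <= f x,
    forall x, ~ (c < x < d) -> f x = 0 & prim s f t = 1].
Proof.
move=> sc cd dt; have m0 := bump0_mass sc cd dt.
have T := bump0_test1 sc dt.
exists (fun x => (prim s (bump0 c d) t)^-1 * bump0 c d x); split.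
- exact: test1Z.
- by move=> x; rewrite mulr_ge0 ?bump0_ge0// invr_ge0 ltW.
- by move=> x /bump0_out ->; rewrite mulr0.
- rewrite primZ ?mulVf ?gt_eqF//.
  exact/smooth_continuous/bump0_smooth.
Qed.

(* Smoothed indicator of [[x1, x2]], with mass-one bumps of width [e] as
   derivative. *)
Lemma plateau_exists (s t x1 x2 e : R) : s < x1 -> 0 < e -> x1 + e < x2 ->
  x2 + e < t ->
  exists a r1 r2 : R -> R, [/\ test1 s t a,
    forall x, derive1 a x = r1 x - r2 x,
    forall x, 0 <= a x <= 1,
    forall x, ~ (x1 < x < x2 + e) -> a x = 0 &
    [/\ test1 s t r1 /\ test1 s t r2,
     (forall x, 0 <= r1 x) /\ (forall x, ~ (x1 < x < x1 + e) -> r1 x = 0),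
     (forall x, 0 <= r2 x) /\ (forall x, ~ (x2 < x < x2 + e) -> r2 x = 0) &
     prim s r1 t = 1 /\ prim s r2 t = 1]].
Proof.
move=> sx1 e0 x12 x2t.
have [|||r1 [t1 r10 r1s m1]] := @bump_exists s t x1 (x1 + e); [lra|lra|lra|].
have [|||r2 [t2 r20 r2s m2]] := @bump_exists s t x2 (x2 + e); [lra|lra|lra|].
have c1 := smooth_continuous (test1_smooth t1).
have c2 := smooth_continuous (test1_smooth t2).
have tD : test1 s t (fun x => r1 x + -1 * r2 x).
  by apply: test1D => //; exact: test1Z.
have cN : continuous (fun x => -1 * r2 x).
  by apply: smooth_continuous; apply: smoothZ; exact: test1_smooth t2.
pose a := prim s (fun x => r1 x + -1 * r2 x).
have aE x : a x = prim s r1 x - prim s r2 x.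
  by rewrite /a primD// primZ// mulN1r.
have ta : test1 s t a by apply: prim_test1 => //; rewrite -/(a t) aE m1 m2 subrr.
have P0 (r : R -> R) (y1 y2 x : R) : (forall x, ~ (y1 < x < y2) -> r x = 0) -> x <= y1 -> prim s r x = 0.
  move=> rs xy; apply: prim_eq0 => z zx; apply: rs => /andP[yz _].
  by have := lt_le_trans yz (le_trans zx xy); rewrite ltxx.
have P1 (r : R -> R) (y1 y2 x : R) : continuous r -> (forall x, ~ (y1 < x < y2) -> r x = 0) ->
    s <= y2 -> y2 <= t -> prim s r t = 1 -> y2 <= x -> prim s r x = 1.
  move=> cr rs sy yt m xy; rewrite -m.
  have H z : y2 < z -> r z = 0.
    by move=> yz; apply: rs => /andP[_ /lt_trans/(_ yz)]; rewrite ltxx.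
  by rewrite (@prim_const s r y2 x)// (@prim_const s r y2 t).
have P01 (r : R -> R) (x : R) : continuous r -> (forall x : R, 0 <= r x) -> prim s r t = 1 ->
   x <= t -> 0 <= prim s r x <= 1.
  move=> cr r0 m xt; rewrite prim_ge0//= -m.
  have [sx|xs] := leP s x; first exact: prim_le_prim.
  have E : `[s, x]%classic = set0 :> set R.
    by apply: set_itv_ge; rewrite bnd_simp -ltNge.
  by rewrite {1}/prim E Rintegral_set0; apply: prim_ge0.
exists a, r1, r2; split => //.
- by move=> x; rewrite (prim_derive1 tD) mulN1r.
- move=> x; rewrite aE; have [xx2|x2x] := leP x x2.
    rewrite (P0 r2 _ _ _ r2s)// subr0; apply: P01 => //; lra.
  rewrite (P1 r1 _ _ _ c1 r1s)//; [|lra..].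
  have [xt|tx] := leP x t.
    have /andP[H1 H2] := P01 r2 x c2 r20 m2 xt.
    by apply/andP; split; lra.
  rewrite (P1 r2 _ _ _ c2 r2s)//; [|lra..].
  by rewrite subrr lexx ler01.
- move=> x H; rewrite aE; have [xx1|x1x] := leP x x1.
    rewrite (P0 r1 _ _ _ r1s)// (P0 r2 _ _ _ r2s)// ?subrr//; lra.
  have x2x : x2 + e <= x by rewrite leNgt; apply/negP => xx2; apply: H; rewrite x1x.
  rewrite (P1 r1 _ _ _ c1 r1s)//; [|lra..].
  rewrite (P1 r2 _ _ _ c2 r2s)//; [|lra..].
  by rewrite subrr.
Qed.

(* Smooth approximations, from below, of the indicator of [`]x1, x2[]; the
   shift by 1 keeps the support away from the end points. *)
Definition ind_approx (x1 x2 : R) (n : nat) x : R :=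
  flat (n%:R * (x - x1) - 1) * flat (n%:R * (x2 - x) - 1).

Lemma ind_approx_test1 x1 x2 n : test1 x1 x2 (ind_approx x1 x2 n).
Proof.
have sm k m : smooth (fun x : R => flat (k * x + m)).
  exact/smooth_affine/flat_smooth.
split.
  rewrite (_ : ind_approx _ _ _ = fun x => flat (n%:R * x - (n%:R * x1 + 1)) *
     flat (- n%:R * x + (n%:R * x2 - 1))).
    by apply: smoothM; exact: sm.
  by apply/funext => x; rewrite /ind_approx; congr (flat _ * flat _); ring.
case: n => [|n].
  (* For n = 0 both factors are [flat (-1)], which is 0, so any admissible end points serve. *)
  exists (x1 + 1), (x2 - 1); split; [lra|lra|move=> x _].
  by rewrite /ind_approx flat0 ?mul0r//; lra.
rewrite /ind_approx; have : 0 < n.+1%:R :> R by rewrite ltr0n.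
move: (n.+1%:R : R) => k k0.
have ki : 0 < k^-1 by rewrite invr_gt0.
exists (x1 + k^-1), (x2 - k^-1); split; [by rewrite ltrDl|by rewrite gtrBl|move=> x H].
have [x1x|xx1] := ltP (x1 + k^-1) x; last first.
  rewrite flat0 ?mul0r// subr_le0 -ler_pdivlMl// mulr1; lra.
rewrite [X in _ * X]flat0 ?mulr0// subr_le0 -ler_pdivlMl// mulr1.
have : x2 - k^-1 < x.
  by rewrite ltNge; apply/negP => xx2; apply: H; rewrite ltW.
lra.
Qed.

Lemma ind_approx_ge0 x1 x2 n x : 0 <= ind_approx x1 x2 n x.
Proof. by rewrite mulr_ge0 ?flat_ge0. Qed.

Lemma ind_approx_le1 x1 x2 n x : ind_approx x1 x2 n x <= 1.
Proof. by rewrite mulr_ile1 ?flat_ge0 ?flat_le1. Qed.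

Lemma flat_cvg1 (k m : R) : 0 < k -> flat (n%:R * k + m) @[n --> \oo] --> (1 : R).
Proof.
move=> k0.
have H : (n%:R * k + m) @[n --> \oo] --> +oo.
  apply/cvgryPge => A; near=> n.
  rewrite -lerBlDr -ler_pdivrMr//.
  by near: n; apply: cvgry_ge; exact: cvgr_idn.
have HV : (n%:R * k + m)^-1 @[n --> \oo] --> (0 : R).
  apply/(gtr0_cvgV0 _).2 => //.
  by near=> n; near: n; exact: cvgry_gt.
have HE : expR (- (n%:R * k + m)^-1) @[n --> \oo] --> (1 : R).
  rewrite -[X in _ --> X](@expR0 R) -oppr0.
  apply: continuous_cvg; first exact: continuous_expR.
  exact: cvgN.
apply: cvg_trans HE; apply: near_eq_cvg; near=> n.
rewrite flatE ifT//; near: n; exact: cvgry_gt.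
Unshelve. all: end_near. Qed.

Lemma ind_approx_cvg x1 x2 x :
  ind_approx x1 x2 n x @[n --> \oo] --> (\1_(`]x1, x2[%classic : set R) x : R).
Proof.
rewrite indicE.
have [xx1|x1x] := leP x x1.
  rewrite memNset/=; last by rewrite in_itv/= ltNge xx1.
  rewrite (_ : (fun n => _) = fun=> 0); first exact: cvg_cst.
  apply/funext => n; rewrite /ind_approx flat0 ?mul0r//.
  have : n%:R * (x - x1) <= 0 by rewrite mulr_ge0_le0 ?subr_le0.
  lra.
have [x2x|xx2] := leP x2 x.
  rewrite memNset/=; last by rewrite in_itv/= [x < x2]ltNge x2x andbF.
  rewrite (_ : (fun n => _) = fun=> 0); first exact: cvg_cst.
  apply/funext => n; rewrite /ind_approx [X in _ * X]flat0 ?mulr0//.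
  have : n%:R * (x2 - x) <= 0 by rewrite mulr_ge0_le0 ?subr_le0.
  lra.
rewrite mem_set/= ?in_itv/= ?x1x//.
rewrite -[X in _ --> X](mulr1 (1:R)); apply: cvgM; apply: flat_cvg1; lra.
Qed.

End Primitive.

(** * Integrable and square integrable functions *)

Section Integrals.
Context d (T : measurableType d) (R : realType) (mu : {measure set T -> \bar R}).
Variables (E : set T) (mE : measurable E).
Implicit Types f g h : T -> R.

Definition int1 f := mu.-integrable E (EFin \o f).
Definition intR f : R := Rintegral mu E f.
(** The body of [L2on] over an arbitrary measure; for the plane the two are convertible. *)
Definition sql2 f := measurable_fun E f /\ (\int[mu]_(z in E) ((f z) ^+ 2)%:E < +oo)%E.

Lemma int1_meas f : int1 f -> measurable_fun E f.
Proof. by move=> /integrableP[/measurable_EFinP]. Qed.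

Lemma int1_le f g : measurable_fun E f -> int1 g ->
  (forall z, E z -> `|f z| <= g z) -> int1 f.
Proof.
move=> mf ig fg; apply: le_integrable ig => //; first exact/measurable_EFinP.
move=> z Ez /=; rewrite lee_fin; apply: le_trans (fg _ Ez) _; exact: ler_norm.
Qed.

Lemma int1D f g : int1 f -> int1 g -> int1 (fun z => f z + g z).
Proof. by move=> i1 i2; exact: (integrableD mE i1 i2). Qed.

Lemma int1Z (k : R) f : int1 f -> int1 (fun z => k * f z).
Proof. by move=> i1; exact: (integrableZl mE k i1). Qed.

Lemma int1N f : int1 f -> int1 (fun z => - f z).
Proof. by move=> i1; exact: (integrableN i1). Qed.

Lemma int1B f g : int1 f -> int1 g -> int1 (fun z => f z - g z).
Proof. by move=> i1 i2; apply: int1D => //; exact: int1N. Qed.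

Lemma int1_norm f : int1 f -> int1 (fun z => `|f z|).
Proof. by move=> i1; exact: (integrable_norm i1). Qed.

Lemma int1Mb f g (M : R) : int1 f -> measurable_fun E g ->
  (forall z, E z -> `|g z| <= M) -> int1 (fun z => f z * g z).
Proof.
move=> i1 mg gM.
apply: (@int1_le _ (fun z => `|M| * `|f z|)).
- by apply: measurable_funM => //; exact: int1_meas.
- by apply: int1Z; exact: int1_norm.
- move=> z Ez; rewrite normrM mulrC ler_wpM2r//.
  by apply: le_trans (gM _ Ez) _; exact: ler_norm.
Qed.

Lemma int1_bounded f (M : R) : (mu E < +oo)%E -> measurable_fun E f ->
  (forall z, E z -> `|f z| <= M) -> int1 f.
Proof.
move=> fE mf fM; apply: measurable_bounded_integrable => //.
exists M; split; first exact: num_real.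
by move=> x Mx z Ez; apply: le_trans (fM _ Ez) (ltW Mx).
Qed.

Lemma eq_int1 f g : (forall z, E z -> f z = g z) -> int1 f -> int1 g.
Proof.
move=> fg; apply: eq_integrable => // z /set_mem Ez /=; by rewrite fg.
Qed.

Lemma eq_intR f g : (forall z, E z -> f z = g z) -> intR f = intR g.
Proof. by move=> fg; apply: eq_Rintegral => z /set_mem; exact: fg. Qed.

Lemma intRD f g : int1 f -> int1 g -> intR (fun z => f z + g z) = intR f + intR g.
Proof. exact: RintegralD. Qed.

Lemma intRB f g : int1 f -> int1 g -> intR (fun z => f z - g z) = intR f - intR g.
Proof. exact: RintegralB. Qed.

Lemma intRZ (k : R) f : int1 f -> intR (fun z => k * f z) = k * intR f.
Proof. by move=> i1; apply: RintegralZl. Qed.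

Lemma intRN f : int1 f -> intR (fun z => - f z) = - intR f.
Proof.
move=> i1; rewrite -[RHS]mulN1r -intRZ//.
by apply: eq_intR => z _; rewrite mulN1r.
Qed.

Lemma intR0 : intR (fun=> 0) = 0.
Proof. by rewrite /intR Rintegral_cst// mul0r. Qed.

Lemma intR_ge0 f : (forall z, E z -> 0 <= f z) -> 0 <= intR f.
Proof. exact: Rintegral_ge0. Qed.

Lemma le_intR f g : int1 f -> int1 g -> (forall z, E z -> f z <= g z) ->
  intR f <= intR g.
Proof. exact: le_Rintegral. Qed.

Lemma norm_intR f : int1 f -> `|intR f| <= intR (fun z => `|f z|).
Proof. exact: le_normr_Rintegral. Qed.

Lemma norm_intR_le f g : int1 f -> int1 g -> (forall z, E z -> `|f z| <= g z) ->
  `|intR f| <= intR g.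
Proof.
move=> i1 i2 fg; apply: le_trans (norm_intR i1) _; apply: le_intR => //.
exact: int1_norm.
Qed.

Lemma EFin_intR f : int1 f -> (intR f)%:E = (\int[mu]_(z in E) (f z)%:E)%E.
Proof. by move=> i1; rewrite /intR /Rintegral fineK//; exact: integrable_fin_num. Qed.

Lemma sql2_int1 f : sql2 f -> int1 (fun z => f z ^+ 2).
Proof.
move=> [mf fi]; apply/integrableP; split.
  by apply/measurable_EFinP; exact: measurable_funX.
apply: le_lt_trans fi; rewrite le_eqVlt; apply/orP; left; apply/eqP.
by apply: eq_integral => z _ /=; rewrite ger0_norm ?sqr_ge0.
Qed.

Lemma int1_sql2 f : measurable_fun E f -> int1 (fun z => f z ^+ 2) -> sql2 f.
Proof.
move=> mf i2; split => //.
by rewrite -EFin_intR// ltry.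
Qed.

Lemma sql2M_int1 f g : sql2 f -> sql2 g -> int1 (fun z => f z * g z).
Proof.
move=> f2 g2; apply: (@int1_le _ (fun z => f z ^+ 2 + g z ^+ 2)).
- by apply: measurable_funM; [case: f2|case: g2].
- by apply: int1D; exact: sql2_int1.
- move=> z _; rewrite ler_norml; nra.
Qed.

Lemma sql2D f g : sql2 f -> sql2 g -> sql2 (fun z => f z + g z).
Proof.
move=> f2 g2; apply: int1_sql2.
  by apply: measurable_funD; [case: f2|case: g2].
apply: (@eq_int1 (fun z => (f z ^+ 2 + g z ^+ 2) + 2 * (f z * g z))).
  by move=> z _; ring.
apply: int1D; last by apply: int1Z; exact: sql2M_int1.
by apply: int1D; exact: sql2_int1.
Qed.

Lemma sql2Z (k : R) f : sql2 f -> sql2 (fun z => k * f z).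
Proof.
move=> f2; apply: int1_sql2.
  by apply: measurable_funM => //; case: f2.
apply: (@eq_int1 (fun z => k ^+ 2 * f z ^+ 2)); first by move=> z _; ring.
by apply: int1Z; exact: sql2_int1.
Qed.

Lemma sql2N f : sql2 f -> sql2 (fun z => - f z).
Proof.
move=> /(sql2Z (-1)); congr sql2; apply/funext => z; exact: mulN1r.
Qed.

Lemma sql2_norm f : sql2 f -> sql2 (fun z => `|f z|).
Proof.
move=> [mf f2]; split; first exact: measurableT_comp.
apply: le_lt_trans f2; rewrite le_eqVlt; apply/orP; left; apply/eqP.
by apply: eq_integral => z _; rewrite real_normK ?num_real.
Qed.

Lemma sql2_bounded f (M : R) : (mu E < +oo)%E -> measurable_fun E f ->
  (forall z, E z -> `|f z| <= M) -> sql2 f.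
Proof.
move=> fE mf fM; apply: int1_sql2 => //.
apply: (@int1_bounded _ (M ^+ 2)) => //; first exact: measurable_funX.
move=> z Ez; rewrite normrX lerXn2r ?nnegrE ?fM//.
exact: le_trans (fM _ Ez).
Qed.

Lemma sql2_int1' f : (mu E < +oo)%E -> sql2 f -> int1 f.
Proof.
move=> fE f2; apply: (@int1_le _ (fun z => f z ^+ 2 + 1)).
- by case: f2.
- apply: int1D; first exact: sql2_int1.
  by apply: (@int1_bounded _ 1) => // z _; rewrite normr1.
- move=> z _; rewrite ler_norml; nra.
Qed.

Lemma sql2Mb f g (M : R) : sql2 f -> measurable_fun E g ->
  (forall z, E z -> `|g z| <= M) -> sql2 (fun z => f z * g z).
Proof.
move=> f2 mg gM; apply: int1_sql2.
  by apply: measurable_funM => //; case: f2.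
apply: (@eq_int1 (fun z => f z ^+ 2 * g z ^+ 2)).
  by move=> z _; rewrite exprMn.
apply: (@int1Mb _ _ (M ^+ 2)); [exact: sql2_int1|exact: measurable_funX|].
move=> z Ez; rewrite normrX lerXn2r ?nnegrE ?gM//.
exact: le_trans (gM _ Ez).
Qed.

Lemma ae_eq_intR f g : measurable_fun E f -> measurable_fun E g ->
  {ae mu, forall z, E z -> f z = g z} -> intR f = intR g.
Proof.
move=> mf mg H; congr fine; apply: ae_eq_integral => //.
- exact/measurable_EFinP.
- exact/measurable_EFinP.
- by apply: filterS H => z H /H ->.
Qed.

Lemma ae_le_le_intR f g : int1 f -> int1 g ->
  {ae mu, forall z, E z -> f z <= g z} -> intR f <= intR g.
Proof.
move=> i1 i2 H; rewrite -subr_ge0 -intRB//.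
have md : measurable_fun E (fun z => g z - f z) := int1_meas (int1B i2 i1).
have : {ae mu, forall z, E z -> g z - f z = `|g z - f z|}.
  by apply: filterS H => z H Ez; rewrite ger0_norm// subr_ge0 H.
move=> /ae_eq_intR -> //; first exact: intR_ge0.
exact: measurableT_comp.
Qed.

Lemma ge0_intR_eq0 f : int1 f -> (forall z, E z -> 0 <= f z) -> intR f <= 0 ->
  {ae mu, forall z, E z -> f z = 0}.
Proof.
move=> i1 f0 If.
have I0 : intR f = 0 by apply/eqP; rewrite eq_le If intR_ge0.
have : (\int[mu]_(z in E) `|(EFin \o f) z|)%E = 0%E.
  rewrite (eq_integral (fun z => (f z)%:E)); last first.
    by move=> z /set_mem Ez /=; rewrite ger0_norm// f0.
  by rewrite -EFin_intR// I0.
move=> /(ae_eq_integral_abs _ mE) H.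
have /H : measurable_fun E (EFin \o f) by case/integrableP: i1.
by apply: filterS => z + Ez => /(_ Ez) [].
Qed.

Lemma int1_indic f (A : set T) : measurable A -> int1 f ->
  int1 (fun z => f z * \1_A z).
Proof.
move=> mA i1; apply: (@int1Mb _ _ 1) => //.
move=> z _; rewrite indicE; by case: (_ \in _); rewrite ?normr1 ?normr0.
Qed.

(** The hypothesis is applied to the set A where f > g. There (f - g) 1_A is non-negative with
    non-positive integral, so it vanishes almost everywhere and A is a null set. *)
Lemma ae_le_intR f g : int1 f -> int1 g ->
  (forall A, measurable A -> intR (fun z => f z * \1_A z) <= intR (fun z => g z * \1_A z)) ->
  {ae mu, forall z, E z -> f z <= g z}.
Proof.
move=> i1 i2 H.
pose A := E `&` [set z | 0 < f z - g z].
have mA : measurable A.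
  have mfg : measurable_fun E (fun z => f z - g z) by apply: int1_meas; exact: int1B.
  rewrite /A (_ : [set z | _] = (fun z => f z - g z) @^-1` `]0, +oo[%classic).
    by apply: mfg.
  by apply/seteqP; split => z /=; rewrite in_itv/= andbT.
have ifg : int1 (fun z => f z * \1_A z - g z * \1_A z).
  by apply: int1B; exact: int1_indic.
have fgE z : f z * \1_A z - g z * \1_A z = (f z - g z) * \1_A z by ring.
have := ge0_intR_eq0 ifg; case.
- move=> z Ez; rewrite fgE indicE; case: (boolP (_ \in _)) => [|_]; last by rewrite mulr0.
  by move=> /set_mem[_] /= /ltW H1; rewrite mulr1.
- by rewrite intRB ?subr_le0 ?H//; exact: int1_indic.
- move=> N [mN N0 HN]; exists N; split => //.
  move=> z /= /not_implyP[Ez] /negP; rewrite -ltNge => fg; apply: HN => /= /(_ Ez).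
  rewrite fgE indicE mem_set ?mulr1; last by split => //=; rewrite subr_gt0.
  by apply/eqP; rewrite gt_eqF// subr_gt0.
Qed.

(** Dominated convergence, reduced to the existence of one index with a small integral, which is
    what the approximation arguments consume. *)
Lemma dominated_small (f : nat -> T -> R) k (e : R) : int1 k -> 0 < e ->
  (forall n, measurable_fun E (f n)) ->
  (forall n z, E z -> `|f n z| <= k z) ->
  (forall z, E z -> f n z @[n --> \oo] --> (0 : R)) ->
  exists n, intR (f n) <= e.
Proof.
move=> ik e0 mf fk f0.
have [|||||_ _ /=] := @dominated_convergence _ _ _ mu _ mE (fun n => EFin \o f n)
  (fun=> 0%E) (EFin \o k).
- by move=> n; exact/measurable_EFinP.
- exact: measurable_cst.
- by apply: aeW => z Ez; apply: cvg_EFin; [exact: nearW|exact: f0].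
- exact: ik.
- by apply: aeW => z n Ez /=; rewrite lee_fin fk.
rewrite integral0 => H.
have i1 n : int1 (f n) by apply: int1_le (mf n) ik _ => z; exact: fk.
have {}H : intR (f n) @[n --> \oo] --> (0 : R) by exact: (fine_cvg H).
have /cvgrPdist_le/(_ _ e0) := H.
move=> [N _ /(_ N (leqnn N))] /=; rewrite sub0r normrN => HN.
by exists N; apply: le_trans HN; exact: ler_norm.
Qed.

End Integrals.

(** * Lebesgue measure in the plane *)

Section Plane.
Variable R : realType.
Local Notation leb := (@lebesgue_measure R).
Local Notation P2 := (measurableTypeR R * measurableTypeR R)%type.

(** [leb2] packaged as a measure on the product measurable type; integrals against the two are
    convertible. *)
Definition mu2 : {measure set P2 -> \bar R} := (leb \x leb)%E.

Lemma intR_leb2 (E : set (R * R)) f : Rintegral (@leb2 R) E f = intR mu2 E f.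
Proof. by []. Qed.

Definition box (x1 x2 y1 y2 : R) : set P2 := (`]x1, x2[ `*` `]y1, y2[)%classic.

Lemma boxE x1 x2 y1 y2 (z : P2) :
  box x1 x2 y1 y2 z <-> (x1 < z.1 < x2) /\ (y1 < z.2 < y2).
Proof. by rewrite /box /setX /= !in_itv. Qed.

Definition boxes : set (set P2) := [set A | exists x1 x2 y1 y2, A = box x1 x2 y1 y2].

Lemma box_measurable x1 x2 y1 y2 : measurable (box x1 x2 y1 y2).
Proof. by apply: measurableX; exact: measurable_itv. Qed.

Lemma boxes_setI : setI_closed boxes.
Proof.
move=> _ _ [x1 [x2 [y1 [y2 ->]]]] [x1' [x2' [y1' [y2' ->]]]].
exists (Num.max x1 x1'), (Num.min x2 x2'), (Num.max y1 y1'), (Num.min y2 y2').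
apply/seteqP; split => z.
  move=> [/boxE[/andP[a1 a2] /andP[a3 a4]] /boxE[/andP[b1 b2] /andP[b3 b4]]].
  by apply/boxE; rewrite !gt_max !lt_min a1 a2 a3 a4 b1 b2 b3 b4.
move/boxE; rewrite !gt_max !lt_min => -[/andP[/andP[a1 b1] /andP[a2 b2]] /andP[/andP[a3 b3] /andP[a4 b4]]].
by split; apply/boxE; rewrite ?a1 ?a2 ?a3 ?a4 ?b1 ?b2 ?b3 ?b4.
Qed.

(** In the sigma-algebra generated by the boxes both coordinate projections are measurable, because
    a half-plane is a countable union of boxes. As boxes are stable under intersection, Dynkin
    induction from boxes becomes available. *)
Lemma measurable_boxes : measurable = <<s boxes>> :> set (set P2).
Proof.
apply/seteqP; split; last first.
  apply: smallest_sub; first exact: sigma_algebra_measurable.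
  by move=> _ [x1 [x2 [y1 [y2 ->]]]]; exact: box_measurable.
pose S := g_sigma_algebraType boxes.
have big (r : R) : exists n : nat, r < n%:R.
  exists (Num.truncn r).+1; exact: truncnS_gt.
have mboxes x1 x2 y1 y2 : measurable (box x1 x2 y1 y2 : set S).
  by apply: sub_sigma_algebra; exists x1, x2, y1, y2.
have m1 : measurable_fun setT ((fun z => z.1) : S -> R).
  apply: (measurability _ (RGenOInfty.measurableE R)) => _ [_ [a ->] <-].
  rewrite setTI (_ : _ @^-1` _ = \bigcup_n (box a (n%:R) (- n%:R) n%:R)).
    exact: bigcup_measurable.
  apply/seteqP; split => z /=.
    rewrite in_itv/= andbT => az.
    have [n hn] := big (`|z.1| + `|z.2|).
    exists n => //; apply/boxE; rewrite az/=.
    have := ler_norm z.1; have := ler_norm z.2; have := normr_ge0 z.1.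
    have := lerNnormlW (lexx `|z.2|); have := normr_ge0 z.2; split; [|apply/andP; split]; lra.
  by move=> [n _ /boxE[/andP[az _] _]]; rewrite in_itv/= az.
have m2 : measurable_fun setT ((fun z => z.2) : S -> R).
  apply: (measurability _ (RGenOInfty.measurableE R)) => _ [_ [a ->] <-].
  rewrite setTI (_ : _ @^-1` _ = \bigcup_n (box (- n%:R) n%:R a n%:R)).
    exact: bigcup_measurable.
  apply/seteqP; split => z /=.
    rewrite in_itv/= andbT => az.
    have [n hn] := big (`|z.1| + `|z.2|).
    exists n => //; apply/boxE; rewrite az/=.
    have := ler_norm z.1; have := ler_norm z.2; have := normr_ge0 z.1.
    have := lerNnormlW (lexx `|z.1|); have := normr_ge0 z.2; split; [apply/andP; split|]; lra.
  by move=> [n _ /boxE[_ /andP[az _]]]; rewrite in_itv/= az.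
rewrite measurable_prod_measurableType.
apply: smallest_sub; first exact: smallest_sigma_algebra.
move=> _ [A mA [B mB <-]].
have -> : A `*` B = (setT `&` (fun z : S => z.1) @^-1` A) `&`
   (setT `&` (fun z : S => z.2) @^-1` B).
  by rewrite !setTI; apply/seteqP; split.
have : measurable ((setT `&` (fun z : S => z.1) @^-1` A) `&`
   (setT `&` (fun z : S => z.2) @^-1` B) : set S).
  by apply: measurableI; [exact: m1|exact: m2].
by [].
Qed.

(** An open set is the union of the boxes with rational corners that it contains, and there are
    countably many of these. *)
Lemma open_measurable2 (A : set (R * R)) : open A -> measurable (A : set P2).
Proof.
move=> oA.
pose Q := (rat * rat * (rat * rat))%type.
pose bq (q : Q) : set P2 := box (ratr q.1.1) (ratr q.1.2) (ratr q.2.1) (ratr q.2.2).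
pose F (q : Q) : set P2 := if `[< bq q `<=` A >] then bq q else set0.
rewrite (_ : A = \bigcup_q F q).
  apply: countable_bigcupT_measurable; first exact: countableP.
  by move=> q; rewrite /F; case: asboolP => _; [exact: box_measurable|exact: measurable0].
apply/seteqP; split => z; last first.
  by move=> [q _]; rewrite /F; case: asboolP => // qA; exact: qA.
move=> Az; have /= [[U V] /= [/nbhs_ballP[e e0 eU] /nbhs_ballP[e' e0' eV]] UVA] : nbhs z A.
  exact: open_nbhs_nbhs.
rewrite /= in e0 e0'.
have [|q1 Hq1] := @rat_in_itvoo R (z.1 - e) z.1; first lra.
have [|q2 Hq2] := @rat_in_itvoo R z.1 (z.1 + e); first lra.
have [|q3 Hq3] := @rat_in_itvoo R (z.2 - e') z.2; first lra.
have [|q4 Hq4] := @rat_in_itvoo R z.2 (z.2 + e'); first lra.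
move: Hq1 Hq2 Hq3 Hq4; rewrite !in_itv/= => /andP[? ?] /andP[? ?] /andP[? ?] /andP[? ?].
exists ((q1, q2), (q3, q4)) => //; rewrite /F; case: asboolP => [_|].
  by apply/boxE; split; apply/andP; split.
case=> w /boxE/= [/andP[? ?] /andP[? ?]]; apply: UVA; split.
  by apply: eU; rewrite /ball/= ltr_norml; apply/andP; split; lra.
by apply: eV; rewrite /ball/= ltr_norml; apply/andP; split; lra.
Qed.

Lemma within_continuousP2 (A : set (R * R)) (u : R * R -> R) :
  {within A, continuous u} <-> forall z, A z -> forall e, 0 < e ->
    exists2 d, 0 < d & forall w, A w -> `|z.1 - w.1| < d -> `|z.2 - w.2| < d ->
      `|u z - u w| < e.
Proof.
split.
  move=> /subspace_continuousP H z Az e e0.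
  have /cvgrPdist_lt/(_ _ e0) := H z Az.
  move=> [[U V] /= [/nbhs_ballP[d1 d10 dU] /nbhs_ballP[d2 d20 dV]] UVA].
  exists (Num.min d1 d2); first by rewrite lt_min d10.
  move=> w Aw; rewrite !lt_min => /andP[h1 _] /andP[_ h2].
  by apply: UVA => //; split; [exact: dU|exact: dV].
move=> H; apply/subspace_continuousP => z Az; apply/cvgrPdist_lt => e e0.
have [d d0 Hd] := H z Az e e0.
exists (ball z.1 d, ball z.2 d); first by split; exact: nbhsx_ballx.
by move=> w [/= h1 h2] Aw; apply: Hd.
Qed.

Lemma within_continuous_measurable (E : set (R * R)) (u : R * R -> R) : open E ->
  {within E, continuous u} -> measurable_fun (E : set P2) u.
Proof.
move=> oE cu; apply: (measurability _ (RGenOpens.measurableE R)) => _ [_ [a [b ->]] <-].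
apply: open_measurable2.
rewrite openE => z [Ez /= Hz].
have : nbhs (u z) `]a, b[%classic.
  by apply: open_nbhs_nbhs; split => //; exact: itv_open.
move=> /nbhs_ballP[e e0 He].
have /within_continuousP2/(_ z Ez e e0) [d d0 Hd] := cu.
have : nbhs z E by exact: open_nbhs_nbhs.
move=> [[U V] /= [/nbhs_ballP[d1 d10 dU] /nbhs_ballP[d2 d20 dV]] UVA].
exists (ball z.1 (Num.min d d1), ball z.2 (Num.min d d2)).
  by split; apply: nbhsx_ballx; rewrite lt_min d0.
move=> w [/= ]; rewrite /ball/= !lt_min => /andP[h1 h2] /andP[h3 h4].
have Ew : E w by apply: UVA; split; [exact: dU|exact: dV].
by split => //; apply: He; exact: Hd.
Qed.

Variable l : R.
Local Notation Om := (Omega l).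
Local Notation pi := (@pi R).

Lemma OmegaE : Om = box 0 pi (- l) l.
Proof. by apply/seteqP; split => z /boxE. Qed.

Lemma Omega_measurable : measurable (Om : set P2).
Proof. rewrite OmegaE; exact: box_measurable. Qed.
Hint Resolve Omega_measurable : core.

Lemma Omega_open : open Om.
Proof.
have -> : Om = ((fun z : R * R => z.1) @^-1` `]0, pi[%classic) `&`
    ((fun z : R * R => z.2) @^-1` `]- l, l[%classic).
  by apply/seteqP; split => z; rewrite /Omega /= !in_itv.
apply: openI; apply: open_comp; try exact: itv_open.
  by move=> z _; exact: cvg_fst.
by move=> z _; exact: cvg_snd.
Qed.

Lemma mu2_box x1 x2 y1 y2 : x1 <= x2 -> y1 <= y2 ->
  mu2 (box x1 x2 y1 y2) = ((x2 - x1) * (y2 - y1))%:E.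
Proof.
move=> hx hy.
transitivity (leb `]x1, x2[%classic * leb `]y1, y2[%classic)%E.
  by apply: product_measure1E; exact: measurable_itv.
by rewrite !lebesgue_measure_itv/= !lte_fin; do 2 (case: ltP => ?);
  rewrite -?EFinB -?EFinM ?mul0e ?mule0//; congr (_%:E); nra.
Qed.

Lemma mu2_Omega : 0 <= l -> mu2 Om = (pi * (2 * l))%:E.
Proof.
move=> l0; rewrite OmegaE mu2_box ?pi_ge0//; last lra.
by congr (_%:E); ring.
Qed.

Lemma mu2_Omega_fin : (mu2 Om < +oo)%E.
Proof.
have [l0|l0] := leP 0 l; first by rewrite mu2_Omega ?ltry.
rewrite OmegaE /box (_ : `]- l, l[%classic = set0 :> set R).
  by rewrite setX0 measure0.
apply/seteqP; split => // y /=; rewrite in_itv/= => /andP[]; lra.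
Qed.

(** Finite sums of compactly supported products on [Omega]; scalars are absorbed by the factors.
    Properties linear in the test function are proved by induction on it. *)
Inductive test_span : (R * R -> R) -> Prop :=
| test_span0 : test_span (fun=> 0)
| test_span_tens a b : test1 0 pi a -> test1 (- l) l b -> test_span (tens a b)
| test_span_add (f g : R * R -> R) : test_span f -> test_span g ->
    test_span (fun z => f z + g z).

Lemma test_spanN f : test_span f -> test_span (fun z => - f z).
Proof.
elim => {f} [|a b ta tb|f g _ If _ Ig].
- by rewrite oppr0; exact: test_span0.
- rewrite (_ : (fun z => _) = tens (fun x => - a x) b).
    by apply: test_span_tens => //; exact: test1N.
  by apply/funext => z; rewrite /tens mulNr.
- rewrite (_ : (fun z => _) = (fun z => - f z + - g z)); first exact: test_span_add.
  by apply/funext => z; rewrite opprD.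
Qed.

Lemma test1_sub (s t s' t' : R) f : s <= s' -> t' <= t -> test1 s' t' f -> test1 s t f.
Proof.
move=> ss tt [sf [c [d [sc dt f0]]]]; split => //.
by exists c, d; split => //; lra.
Qed.

Lemma test1_bounded (s t : R) f : test1 s t f -> exists M, forall x, `|f x| <= M.
Proof.
move=> [sf [c [d [sc dt f0]]]].
have cf := smooth_continuous sf.
have : compact (f @` `[c, d]%classic).
  by apply: continuous_compact; [exact: continuous_subspaceT|exact: segment_compact].
move=> /compact_bounded[M [_ HM]]; exists (`|M| + 1) => x.
have MM : M < `|M| + 1 by apply: le_lt_trans (ler_norm M) _; rewrite ltrDl.
have [xcd|xcd] := pselect (c <= x <= d); last by rewrite f0 ?normr0 ?addr_ge0.
by apply: (HM _ MM); exists x => //=; rewrite in_itv.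
Qed.

Lemma measurable_tens (a b : R -> R) (E : set P2) : continuous a -> continuous b ->
  measurable_fun E (tens a b).
Proof.
move=> ca cb; apply: (@measurable_funS _ _ _ _ setT) => //.
apply: measurable_funM.
  apply: (@measurableT_comp _ _ _ _ _ _ a _ (fun z : P2 => z.1)).
    exact: continuous_measurable_fun.
  exact: measurable_fst.
apply: (@measurableT_comp _ _ _ _ _ _ b _ (fun z : P2 => z.2)).
  exact: continuous_measurable_fun.
exact: measurable_snd.
Qed.

Lemma test_span_measurable f (E : set P2) : test_span f -> measurable_fun E f.
Proof.
elim => {f} [|a b ta tb|f g _ If _ Ig].
- exact: measurable_cst.
- by apply: measurable_tens; apply: smooth_continuous;
    [exact: test1_smooth ta|exact: test1_smooth tb].
- exact: measurable_funD.
Qed.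

Lemma test_span_bounded f : test_span f -> exists M, forall z, `|f z| <= M.
Proof.
elim => {f} [|a b ta tb|f g _ [M HM] _ [M' HM']].
- by exists 0 => z; rewrite normr0.
- have [M HM] := test1_bounded ta; have [M' HM'] := test1_bounded tb.
  by exists (M * M') => z; rewrite normrM ler_pM.
- by exists (M + M') => z; apply: le_trans (ler_normD _ _) _; exact: lerD.
Qed.

End Plane.

(** * Density of tensor test functions in a weighted L^1 space *)

Section Density.
Variables (R : realType) (l : R).
Local Notation P2 := (measurableTypeR R * measurableTypeR R)%type.
Local Notation Om := (Omega l : set P2).
Local Notation pi := (@pi R).
Local Notation mu := (@mu2 R).
Local Notation int := (int1 mu Om).
Local Notation I := (intR mu Om).
Let mO := Omega_measurable l.

Variable k : R * R -> R.
Hypotheses (ik : int k) (k0 : forall z, 0 <= k z).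

Definition approximable (A : set P2) := forall e, 0 < e ->
  exists2 f, test_span l f & I (fun z => `|\1_A z - f z| * k z) <= e.

Lemma indic_measurable (A E : set P2) : measurable A -> measurable_fun E (\1_A : P2 -> R).
Proof. by move=> mA; exact: measurable_indic. Qed.

Lemma int_diff (f g : R * R -> R) (M : R) :
  measurable_fun Om f -> measurable_fun Om g ->
  (forall z, Om z -> `|f z| <= M) -> (forall z, Om z -> `|g z| <= M) ->
  int (fun z => `|f z - g z| * k z).
Proof.
move=> mf mg fM gM.
apply: (@eq_int1 _ _ _ _ _ mO (fun z => k z * `|f z - g z|)).
  by move=> z _; rewrite mulrC.
apply: (@int1Mb _ _ _ _ _ mO _ _ (M + M)) => //.
  by apply: measurableT_comp => //; exact: measurable_funB.
move=> z Oz; rewrite normr_id; apply: le_trans (ler_normB _ _) _.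
by apply: lerD; [exact: fM|exact: gM].
Qed.

Lemma int_indic_span A f : measurable A -> test_span l f ->
  int (fun z => `|\1_A z - f z| * k z).
Proof.
move=> mA tf; have [M HM] := test_span_bounded tf.
apply: (@int_diff _ _ (1 + M)).
- exact: indic_measurable.
- exact: test_span_measurable tf.
- move=> z _; have := HM z; rewrite indicE; case: (_ \in _) => /=; rewrite ?normr1 ?normr0 => H;
    have := normr_ge0 (f z); lra.
- move=> z _; have := HM z; lra.
Qed.

Lemma int_indic_indic A B : measurable A -> measurable B ->
  int (fun z => `|\1_A z - \1_B z| * k z).
Proof.
move=> mA mB; apply: (@int_diff _ _ 1); try exact: indic_measurable;
  move=> z _; rewrite indicE; case: (_ \in _) => /=; rewrite ?normr1 ?normr0//.
Qed.

Lemma approximable_eq A B : (forall z, Om z -> A z <-> B z) -> approximable A -> approximable B.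
Proof.
move=> AB HA e e0; have [f tf Hf] := HA e e0; exists f => //.
rewrite (eq_intR _ (g := fun z => `|\1_A z - f z| * k z))// => z Oz.
rewrite !indicE; congr (`|_%:R - _| * _); congr (nat_of_bool _).
apply/idP/idP => /set_mem H; apply/mem_set; exact/AB.
Qed.

Lemma approximable_box x1 x2 y1 y2 : approximable (box x1 x2 y1 y2).
Proof.
move=> e e0.
(* The box is cut down to [Omega], outside which nothing is integrated, so that the smoothed
   indicators become test functions of [Omega]. *)
pose x1' := Num.max 0 x1; pose x2' := Num.min pi x2.
pose y1' := Num.max (- l) y1; pose y2' := Num.min l y2.
pose psi n := tens (ind_approx x1' x2' n) (ind_approx y1' y2' n).
have tpsi n : test_span l (psi n).
  apply: test_span_tens.
    by apply: test1_sub (ind_approx_test1 x1' x2' n); rewrite ?le_max ?ge_min lexx.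
  by apply: test1_sub (ind_approx_test1 y1' y2' n); rewrite ?le_max ?ge_min lexx.
have psi01 n z : 0 <= psi n z <= 1.
  by apply/andP; split; [apply: mulr_ge0|apply: mulr_ile1]; rewrite ?ind_approx_ge0 ?ind_approx_le1.
have [|||n Hn] := @dominated_small _ _ _ mu Om mO
    (fun n z => `|\1_(box x1 x2 y1 y2) z - psi n z| * k z) k e ik e0.
- by move=> n; apply: int1_meas; apply: int_indic_span => //; exact: box_measurable.
- move=> n z _; rewrite normrM normr_id (ger0_norm (k0 z)) ler_piMl//.
  have /andP[h1 h2] := psi01 n z.
  rewrite indicE; case: (_ \in _) => /=; rewrite ler_norml; apply/andP; split; lra.
- move=> z [/andP[z1 z2] /andP[z3 z4]].
  have -> : \1_(box x1 x2 y1 y2) z = (\1_(`]x1', x2'[%classic : set R) z.1 *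
     \1_(`]y1', y2'[%classic : set R) z.2 :> R).
    rewrite !indicE -natrM mulnb; congr (nat_of_bool _)%:R.
    apply/idP/idP.
      move=> /set_mem/boxE[/andP[a1 a2] /andP[a3 a4]]; apply/andP.
      by split; apply/mem_set; rewrite /= in_itv/= gt_max lt_min ?z1 ?z2 ?z3 ?z4 ?a1 ?a2 ?a3 ?a4.
    move=> /andP[/set_mem + /set_mem]; rewrite /= !in_itv/= !gt_max !lt_min.
    move=> /andP[/andP[_ a1] /andP[_ a2]] /andP[/andP[_ a3] /andP[_ a4]].
    by apply/mem_set/boxE; rewrite a1 a2 a3 a4.
  move cE : (\1_(`]x1', x2'[%classic : set R) z.1 * \1_(`]y1', y2'[%classic : set R) z.2 : R) => c.
  have H : psi n z @[n --> \oo] --> c.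
    by rewrite /psi /tens -cE; apply: cvgM; exact: ind_approx_cvg.
  have H1 : `|c - psi n z| * k z @[n --> \oo] --> `|c - c| * k z.
    apply: cvgM; last exact: cvg_cst.
    by apply: cvg_norm; apply: cvgB => //; exact: cvg_cst.
  by move: H1; rewrite subrr normr0 mul0r.
by exists (psi n).
Qed.

Lemma approximableT : approximable setT.
Proof.
apply: approximable_eq (@approximable_box 0 pi (- l) l) => z.
by rewrite OmegaE => /= Oz; split.
Qed.

Lemma approximableC A : measurable A -> approximable A -> approximable (~` A).
Proof.
move=> mA HA e e0; have e2 : 0 < e / 2 by rewrite divr_gt0.
have [f tf Hf] := HA _ e2; have [g tg Hg] := approximableT e2.
exists (fun z => g z + - f z); first exact/test_span_add/test_spanN.
have -> : e = e / 2 + e / 2 by field.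
apply: le_trans (lerD Hg Hf).
rewrite -intRD//; try exact: int_indic_span.
apply: le_intR => //.
- by apply: int_indic_span; [exact: measurableC|exact/test_span_add/test_spanN].
- by apply: int1D => //; exact: int_indic_span.
- move=> z _; rewrite -mulrDl ler_wpM2r//.
  have -> : \1_(~` A) z - (g z + - f z) = (\1_setT z - g z) - (\1_A z - f z) :> R.
    rewrite !indicE in_setT in_setC; case: (z \in A) => /=; ring.
  exact: ler_normB.
Qed.

Lemma approximableU A B : measurable A -> measurable B -> A `&` B = set0 ->
  approximable A -> approximable B -> approximable (A `|` B).
Proof.
move=> mA mB AB0 HA HB e e0; have e2 : 0 < e / 2 by rewrite divr_gt0.
have [f tf Hf] := HA _ e2; have [g tg Hg] := HB _ e2.
exists (fun z => f z + g z); first exact/test_span_add.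
have -> : e = e / 2 + e / 2 by field.
apply: le_trans (lerD Hf Hg).
rewrite -intRD//; try exact: int_indic_span.
apply: le_intR => //.
- by apply: int_indic_span; [exact: measurableU|exact/test_span_add].
- by apply: int1D => //; exact: int_indic_span.
- move=> z _; rewrite -mulrDl ler_wpM2r//.
  have -> : \1_(A `|` B) z - (f z + g z) = (\1_A z - f z) + (\1_B z - g z) :> R.
    have : ~ (z \in A /\ z \in B).
      move=> [/set_mem zA /set_mem zB].
      by have : (A `&` B) z by []; rewrite AB0.
    rewrite !indicE in_setU; case: (z \in A); case: (z \in B) => //= H; try ring.
    by exfalso; exact: H.
  exact: ler_normD.
Qed.

Lemma approximable_bigcup (F : (set P2)^nat) : (forall n, measurable (F n)) ->
  trivIset setT F -> (forall n, approximable (F n)) -> approximable (\bigcup_n F n).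
Proof.
move=> mF tF HF e e0; have e2 : 0 < e / 2 by rewrite divr_gt0.
(* Finite unions are approximable by induction; the remainder of the union tends to zero in the
   weighted norm by dominated convergence. *)
pose G n := \bigcup_(i < n) F i.
have mG n : measurable (G n) by apply: bigcup_measurable.
have mU : measurable (\bigcup_n F n) by exact: bigcupT_measurable.
have HG n : approximable (G n).
  elim: n => [|n IH].
    apply: (@approximable_eq (~` setT)); last exact: approximableC approximableT.
    by move=> z _; split => //= -[].
  apply: (@approximable_eq (G n `|` F n)).
    move=> z _; split.
      by move=> [[i /= ni Fi]|Fn]; [exists i => //=; exact: ltnW|exists n => /=].
    move=> [i /=]; rewrite ltnS leq_eqVlt => /predU1P[->|ni] Fi; first by right.
    by left; exists i.
  apply: approximableU => //.
  apply/seteqP; split => // z [[i /= ni Fi] Fn].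
  have := @tF i n Logic.I Logic.I; rewrite -falseE; move: ni => /[swap] ->.
    by rewrite ltnn.
  by exists z.
have [|||n Hn] := @dominated_small _ _ _ mu Om mO
    (fun n z => `|\1_(\bigcup_n F n) z - \1_(G n) z| * k z) k _ ik e2.
- by move=> n; apply: int1_meas; exact: int_indic_indic.
- move=> n z _; rewrite normrM normr_id (ger0_norm (k0 z)) ler_piMl//.
  rewrite !indicE; do 2 (case: (_ \in _)) => /=; rewrite ler_norml; apply/andP; split; lra.
- move=> z _; apply/cvgrPdist_le => d d0.
  have [[i _ Fi]|Nz] := pselect ((\bigcup_n F n) z).
    exists i.+1 => // n /= ni.
    rewrite !indicE !mem_set; [|by exists i|by exists i].
    by rewrite subrr normr0 mul0r subr0 normr0 ltW.
  exists 0%N => // n /= _; rewrite !indicE !memNset//; last first.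
    by move=> [j _ Fj]; apply: Nz; exists j.
  by rewrite subrr normr0 mul0r subr0 normr0 ltW.
have [f tf Hf] := HG n _ e2; exists f => //.
have -> : e = e / 2 + e / 2 by field.
apply: le_trans (lerD Hn Hf).
rewrite -intRD//; [|exact: int_indic_indic|exact: int_indic_span].
apply: le_intR => //.
- exact: int_indic_span.
- by apply: int1D => //; [exact: int_indic_indic|exact: int_indic_span].
- move=> z _; rewrite -mulrDl ler_wpM2r//; exact: ler_distD.
Qed.

Lemma measurable_approximable A : measurable A -> approximable A.
Proof.
rewrite measurable_boxes => mA.
apply: (dynkin_induction (@measurable_boxes R) (@boxes_setI R)) mA.
- exact: approximableT.
- by move=> _ [x1 [x2 [y1 [y2 ->]]]]; exact: approximable_box.
- by move=> S mS; exact: approximableC.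
- exact: approximable_bigcup.
Qed.

End Density.

(** * Integrals over horizontal lines *)

Section Slices.
Variables (R : realType) (l : R).
Local Notation P2 := (measurableTypeR R * measurableTypeR R)%type.
Local Notation Om := (Omega l : set P2).
Local Notation pi := (@pi R).
Local Notation leb := (@lebesgue_measure R).
Local Notation mu := (@mu2 R).
Local Notation int := (int1 mu Om).
Local Notation I := (intR mu Om).
Let mO := Omega_measurable l.
Implicit Types F G : R * R -> R.

Definition ext F : P2 -> \bar R := (EFin \o F) \_ Om.

Definition slice F (y : R) : \bar R := (\int[leb]_x ext F (x, y))%E.

Definition mslice F (z : R * R) : R := fine (slice F z.2).

Lemma ext_ge0 F z : (forall z, 0 <= F z) -> (0 <= ext F z)%E.
Proof. by move=> F0; rewrite /ext /patch; case: ifP => //; rewrite lee_fin. Qed.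

Lemma ext_measurable F : measurable_fun Om F -> measurable_fun setT (ext F).
Proof.
move=> mF; have H : measurable_fun Om (EFin \o F) by apply/measurable_EFinP.
exact: (measurable_restrictT _ mO).1 H.
Qed.

Lemma slice_ge0 F y : (forall z, 0 <= F z) -> (0 <= slice F y)%E.
Proof. by move=> F0; apply: integral_ge0 => x _; exact: ext_ge0. Qed.

Lemma mslice_ge0 F z : (forall z, 0 <= F z) -> 0 <= mslice F z.
Proof. by move=> F0; apply: fine_ge0; exact: slice_ge0. Qed.

Lemma slice_measurable F : measurable_fun Om F -> (forall z, 0 <= F z) ->
  measurable_fun setT (slice F).
Proof.
move=> mF F0; apply: (measurable_fun_fubini_tonelli_G (m1 := leb) (ext F)).
  exact: ext_measurable.
by move=> z; exact: ext_ge0.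
Qed.

Lemma mslice_measurable F (E : set P2) : measurable_fun Om F -> (forall z, 0 <= F z) ->
  measurable_fun E (mslice F).
Proof.
move=> mF F0; apply: (@measurable_funS _ _ _ _ setT) => //.
apply: (@measurableT_comp _ _ _ _ _ _ fine _ (fun z : P2 => slice F z.2)).
  exact: fine_measurable.
apply: (@measurableT_comp _ _ _ _ _ _ (slice F) _ (fun z : P2 => z.2)).
  exact: slice_measurable.
exact: measurable_snd.
Qed.

Lemma integral_slice F : measurable_fun Om F -> (forall z, 0 <= F z) ->
  (\int[mu]_(z in Om) (F z)%:E = \int[leb]_y slice F y)%E.
Proof.
move=> mF F0; rewrite integral_mkcond.
apply: (fubini_tonelli2 (m1 := leb) (m2 := leb) (ext F)).
  exact: ext_measurable.
by move=> z; exact: ext_ge0.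
Qed.

Lemma slice_fin F : int F -> (forall z, 0 <= F z) ->
  {ae (leb : {measure set (measurableTypeR R) -> \bar R}),
     forall y, slice F y \is a fin_num}.
Proof.
move=> iF F0; have mF := int1_meas iF.
have H : leb.-integrable setT (slice F).
  apply/integrableP; split; first exact: slice_measurable.
  have -> : (\int[leb]_x `|slice F x| = \int[leb]_x slice F x)%E.
    by apply: eq_integral => y _; rewrite gee0_abs//; exact: slice_ge0.
  by rewrite -integral_slice// -EFin_intR// ltry.
have := integrable_ae measurableT H; apply: filterS => y; exact.
Qed.

Lemma ext_section F (y : R) (mF : measurable_fun Om F) :
  measurable_fun (setT : set (measurableTypeR R)) (fun x => ext F (x, y)).
Proof.
apply: (@measurableT_comp _ _ _ _ _ _ (ext F) _ (fun x : measurableTypeR R => (x, y))).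
  exact: ext_measurable.
exact: measurable_pair2.
Qed.

Lemma slice_mul F (G : R -> R) y : measurable_fun Om F -> (forall z, 0 <= F z) -> (0 <= G y) ->
  slice (fun z => F z * G z.2) y = (slice F y * (G y)%:E)%E.
Proof.
move=> mF F0 G0; rewrite /slice -ge0_integralZr//.
- apply: eq_integral => x _; rewrite /ext /patch; case: ifP => _ //=.
  by rewrite mul0e.
- exact: ext_section.
- by move=> x _; exact: ext_ge0.
Qed.

Lemma integral_mul_mslice F G : int F -> int G ->
  (forall z, 0 <= F z) -> (forall z, 0 <= G z) ->
  (\int[mu]_(z in Om) (F z * mslice G z)%:E =
   \int[leb]_y (slice F y * slice G y))%E.
Proof.
move=> iF iG F0 G0; have mF := int1_meas iF; have mG := int1_meas iG.
rewrite (integral_slice (F := fun z => F z * mslice G z)).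
- apply: ae_eq_integral => //.
  + apply: slice_measurable.
      by apply: measurable_funM => //; exact: mslice_measurable.
    by move=> z; rewrite mulr_ge0// mslice_ge0.
  + by apply: emeasurable_funM; exact: slice_measurable.
  + have [N [mN N0 HN]] := slice_fin iG G0.
    exists N; split => // y /= Hy; apply: HN => /= fy; apply: Hy => _.
    rewrite (@slice_mul F (fun y => fine (slice G y)))//.
      by rewrite fineK.
    by rewrite fine_ge0// slice_ge0.
- by apply: measurable_funM => //; exact: mslice_measurable.
- by move=> z; rewrite mulr_ge0// mslice_ge0.
Qed.

(** Horizontal integration is a symmetric operator: by Tonelli both sides are the integral over [y]
    of the product of the two slices. *)
Lemma mslice_sym F G : int F -> int G ->
  (forall z, 0 <= F z) -> (forall z, 0 <= G z) ->
  I (fun z => F z * mslice G z) = I (fun z => G z * mslice F z).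
Proof.
move=> iF iG F0 G0; have E1 := integral_mul_mslice iF iG F0 G0.
have E2 := integral_mul_mslice iG iF G0 F0.
apply: (congr1 fine); apply: (etrans E1); apply: (etrans _ (esym E2)).
by apply: eq_integral => y _; rewrite muleC.
Qed.

Lemma slice_in F y : - l < y < l ->
  slice F y = (\int[leb]_(x in `]0%R, pi[) (F (x, y))%:E)%E.
Proof.
move=> yl; rewrite [RHS]integral_mkcond; apply: eq_integral => x _.
rewrite /ext /patch; congr (if _ then _ else _).
by apply/idP/idP => /set_mem; rewrite /Omega/= ?in_itv/= => H; apply/mem_set => /=;
  [case: H|rewrite /Omega/=].
Qed.

Lemma slice_out F y : ~ (- l < y < l) -> slice F y = 0%E.
Proof.
move=> yl; rewrite /slice integral0_eq// => x _; rewrite /ext /patch memNset//.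
by case.
Qed.

(** Cauchy-Schwarz on a segment of length pi, obtained from F <= F^2 / (2 t) + t / 2. When the slice
    of [F] is infinite, [fine] makes the left side 0. *)
Lemma sqr_slice_le F y : measurable_fun Om F -> (forall z, 0 <= F z) ->
  (((fine (slice F y)) ^+ 2)%:E <= pi%:E * slice (fun z => F z ^+ 2)%R y)%E.
Proof.
move=> mF F0.
have F20 z : 0 <= F z ^+ 2 by exact: sqr_ge0.
have mF2 : measurable_fun Om (fun z => F z ^+ 2) by exact: measurable_funX.
have p0 := @pi_gt0 R.
set G := slice F y; set Q := slice _ y.
have Q0 : (0 <= Q)%E by exact: slice_ge0.
have G0 : (0 <= G)%E by exact: slice_ge0.
case: (boolP (G \is a fin_num)) => [|/negPf fG]; last first.
  have -> : fine G = 0.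
    by move: fG G0; rewrite fin_numE; case: G => //= r; rewrite !eqxx ?andbF.
  by rewrite expr0n/= mule_ge0// lee_fin ltW.
move=> /fineK Gf; set g := fine G.
have g0 : 0 <= g by exact: fine_ge0.
move: g0; rewrite le_eqVlt => /predU1P[<-|g0].
  by rewrite expr0n/= mule_ge0// lee_fin ltW.
have [yl|yl] := pselect (- l < y < l); last first.
  by move: g0; rewrite /g /G slice_out//= ltxx.
case: (boolP (Q \is a fin_num)) => [/fineK Qf|]; last first.
  move=> fQ; have -> : Q = +oo%E.
    by move: fQ Q0; rewrite fin_numE; case: Q => //= r; rewrite !eqxx ?andbF.
  by rewrite gt0_muley ?leey// lte_fin.
rewrite -Qf -EFinM lee_fin; set q := fine Q.
(* The mean of [F] on the line is the optimal parameter in this inequality. *)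
pose t := g / pi.
have t0 : 0 < t by rewrite divr_gt0.
have : (G <= (2 * t)^-1%:E * Q + (t * pi / 2)%:E)%E.
  have -> : (t * pi / 2)%:E = (\int[leb]_(x in `]0%R, pi[) (t / 2)%:E)%E.
    rewrite integral_cst//= lebesgue_measure_itv/= lte_fin p0 -EFinB -EFinM.
    by congr (_%:E); ring.
  have mx (H : R * R -> R) : measurable_fun Om H ->
      measurable_fun (`]0, pi[%classic : set (measurableTypeR R)) (fun x => (H (x, y))%:E).
    move=> mH; have := @ext_section H y mH.
    move=> /(@measurable_funS _ _ _ _ setT (`]0, pi[%classic) _ measurableT (@subsetT _ _)).
    apply: eq_measurable_fun => x /set_mem; rewrite /= in_itv/= => xp.
    by rewrite /ext /patch mem_set.
  rewrite /G /Q !slice_in// -ge0_integralZl//; last 3 first.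
  - exact: (mx (fun z => F z ^+ 2)).
  - by move=> x _; rewrite lee_fin.
  - by rewrite lee_fin invr_ge0 mulr_ge0// ltW.
  rewrite -ge0_integralD//; last 3 first.
  - by move=> x _; rewrite -EFinM lee_fin mulr_ge0// invr_ge0 mulr_ge0// ltW.
  - by apply: measurable_funeM; exact: (mx (fun z => F z ^+ 2)).
  - by move=> x _; rewrite lee_fin divr_ge0// ltW.
  apply: ge0_le_integral => //.
  - by move=> x _; rewrite lee_fin.
  - exact: mx.
  - apply: emeasurable_funD => //.
    by apply: measurable_funeM; exact: (mx (fun z => F z ^+ 2)).
  - move=> x _; rewrite -EFinM -EFinD lee_fin.
    rewrite -subr_ge0.
    have -> : (2 * t)^-1 * F (x, y) ^+ 2 + t / 2 - F (x, y) =
       (2 * t)^-1 * (F (x, y) - t) ^+ 2.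
      by field; rewrite gt_eqF.
    by rewrite mulr_ge0 ?sqr_ge0// invr_ge0 mulr_ge0// ltW.
rewrite -Gf -Qf -EFinM -EFinD lee_fin -/g -/q => H.
have tp : t * pi = g by rewrite /t divfK// gt_eqF.
have H2 : g / 2 <= (2 * t)^-1 * q by move: H; rewrite tp; lra.
have : (2 * t) * (g / 2) <= q.
  have tt : 0 < 2 * t by rewrite mulr_gt0.
  by rewrite -(ler_pdivlMl _ _ tt).
rewrite /t => H3.
have : (pi * (2 * (g / pi) * (g / 2))) <= pi * q by rewrite ler_pM2l.
suff -> : pi * (2 * (g / pi) * (g / 2)) = g ^+ 2 by [].
have pn : pi != 0 by rewrite gt_eqF.
by clearbody g; move: (pi) pn => p pn; field.
Qed.

(** One factor pi comes from Cauchy-Schwarz on each line, the other from the length of the line,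
    along which [mslice F] is constant. *)
Lemma mslice_sql2 F : sql2 mu Om F -> (forall z, 0 <= F z) ->
  sql2 mu Om (mslice F) /\
  I (fun z => mslice F z ^+ 2) <= pi ^+ 2 * I (fun z => F z ^+ 2).
Proof.
move=> F2 F0; have mF : measurable_fun Om F by case: F2.
have p0 := @pi_gt0 R.
have F20 z : 0 <= F z ^+ 2 by exact: sqr_ge0.
have mF2 : measurable_fun Om (fun z => F z ^+ 2) by exact: measurable_funX.
have mN : measurable_fun Om (mslice F) by exact: mslice_measurable.
have iF2 := sql2_int1 F2.
have key : (\int[mu]_(z in Om) ((mslice F z ^+ 2)%R)%:E <=
    (pi ^+ 2 * I (fun z => F z ^+ 2))%R%:E)%E.
  rewrite EFinM EFin_intR// (integral_slice mF2)//.
  rewrite -ge0_integralZl//; last 3 first.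
  - exact: slice_measurable.
  - by move=> y _; exact: slice_ge0.
  - by rewrite lee_fin sqr_ge0.
  rewrite (integral_slice (F := fun z => mslice F z ^+ 2)); last 2 first.
  - exact: measurable_funX.
  - by move=> z; exact: sqr_ge0.
  apply: ge0_le_integral => //.
  - by move=> y _; apply: slice_ge0 => z; exact: sqr_ge0.
  - by apply: slice_measurable => [|z]; [exact: measurable_funX|exact: sqr_ge0].
  - by apply: measurable_funeM; exact: slice_measurable.
  - move=> y _; have [yl|yl] := pselect (- l < y < l); last first.
      by rewrite !slice_out// mule0.
    rewrite slice_in//= (eq_integral (fun=> ((fine (slice F y)) ^+ 2)%:E))//.
    rewrite integral_cst//= lebesgue_measure_itv/= lte_fin p0 -EFinB subr0.
    have -> : (pi ^+ 2)%:E = (pi%:E * pi%:E)%E by rewrite -EFinM -expr2.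
    rewrite -muleA [X in (X <= _)%E]muleC; apply: lee_wpmul2l; first by rewrite lee_fin ltW.
    exact: sqr_slice_le.
have N2 : sql2 mu Om (mslice F).
  by split => //; apply: le_lt_trans key _; rewrite ltry.
by split => //; rewrite -lee_fin EFin_intR//; exact: sql2_int1.
Qed.

Lemma mslice_prim (f : R * R -> R) z : Om z -> continuous (fun x => f (x, z.2)) ->
  mslice (fun z => `|f z|) z = prim 0 (fun x => `|f (x, z.2)|) pi.
Proof.
move=> [_ z2] cf; rewrite /mslice slice_in//.
have cn : continuous (fun x => `|f (x, z.2)|).
  by move=> x; apply: cvg_norm; exact: cf.
have ic := continuous_integrable 0 pi cn.
have -> : fine (\int[leb]_(x in `]0%R, pi[) (`|f (x, z.2)|)%:E)%E =
    Rintegral leb `]0, pi[ (fun x => `|f (x, z.2)|) by [].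
rewrite Rintegral_itv_bndo_bndc; last first.
  apply: integrableS ic => // x /=; rewrite !in_itv/= => /andP[h1 h2].
  by rewrite !ltW.
rewrite Rintegral_itv_obnd_cbnd//.
apply: integrableS ic => // x /=; rewrite !in_itv/= => /andP[h1 h2].
by rewrite ltW.
Qed.

End Slices.

(** * Weak derivatives and the fundamental lemma *)

Section SliceBound.
Variables (R : realType) (l : R).
Local Notation P2 := (measurableTypeR R * measurableTypeR R)%type.
Local Notation Om := (Omega l : set P2).
Local Notation pi := (@pi R).
Local Notation mu := (@mu2 R).
Local Notation int := (int1 mu Om).
Local Notation I := (intR mu Om).
Let mO := Omega_measurable l.
Implicit Types v g N : R * R -> R.

Lemma int_mul_span v f : int v -> test_span l f -> int (fun z => v z * f z).
Proof.
move=> iv tf; have [M HM] := test_span_bounded tf.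
by apply: (@int1Mb _ _ _ _ _ mO _ _ M) => //; exact: test_span_measurable tf.
Qed.

Lemma norm_span_int f : test_span l f -> int (fun z => `|f z|).
Proof.
move=> tf; have [M HM] := test_span_bounded tf.
apply: (@int1_bounded _ _ _ _ _ mO _ M).
- exact: mu2_Omega_fin.
- by apply: measurableT_comp => //; exact: test_span_measurable tf.
- by move=> z _; rewrite normr_id.
Qed.

(** The indicator of a measurable set is approximated by [f] in L^1 with weight |v| + N. This single
    error controls the replacement of the indicator on both sides, and the inequality between
    integrals over all measurable sets gives the one almost everywhere. *)
Lemma ae_le_of_span v N : int v -> int N -> (forall z, 0 <= N z) ->
  (forall f, test_span l f -> I (fun z => v z * f z) <= I (fun z => N z * `|f z|)) ->
  {ae mu, forall z, Om z -> v z <= N z}.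
Proof.
move=> iv iN N0 H; apply: ae_le_intR => // A mA.
have ik : int (fun z => `|v z| + N z) by apply: int1D => //; exact: int1_norm.
have k0 z : 0 <= `|v z| + N z by rewrite addr_ge0.
apply/ler_addgt0Pl => e e0.
have [f tf Hf] := measurable_approximable ik k0 mA e0.
have ivf := int_mul_span iv tf.
have iNf : int (fun z => N z * `|f z|).
  have [M HM] := test_span_bounded tf.
  apply: (@int1Mb _ _ _ _ _ mO _ _ M) => //.
    by apply: measurableT_comp => //; exact: test_span_measurable tf.
  by move=> z _; rewrite normr_id.
have ivA := int1_indic mO mA iv.
have iNA := int1_indic mO mA iN.
have iAf : int (fun z => `|\1_A z - f z| * (`|v z| + N z)).
  exact: int_indic_span.
apply: le_trans (lerD Hf (lexx _)).
rewrite -intRD//.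
have -> : I (fun z => v z * \1_A z) =
    I (fun z => v z * \1_A z - v z * f z) + I (fun z => v z * f z).
  by rewrite intRB// subrK.
apply: le_trans (lerD (lexx _) (H _ tf)) _.
rewrite -intRD//; last exact: int1B.
apply: le_intR => //.
- by apply: int1D => //; exact: int1B.
- exact: int1D.
- move=> z _; rewrite mulrDr -mulrBr.
  have h1 : v z * (\1_A z - f z) <= `|\1_A z - f z| * `|v z|.
    by rewrite mulrC -normrM; apply: le_trans (ler_norm _) _; rewrite mulrC.
  have h2 : N z * `|f z| <= `|\1_A z - f z| * N z + N z * \1_A z.
    rewrite [`|_| * _]mulrC -mulrDr ler_wpM2l//.
    have A0 : 0 <= (\1_A z : R) by rewrite indicE ler0n.
    rewrite -{1}[f z](subrK (\1_A z)) -{4}(ger0_norm A0) distrC; exact: ler_normD.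
  lra.
Qed.

Lemma ae_norm_le_of_span v N : int v -> int N -> (forall z, 0 <= N z) ->
  (forall f, test_span l f -> `|I (fun z => v z * f z)| <= I (fun z => N z * `|f z|)) ->
  {ae mu, forall z, Om z -> `|v z| <= N z}.
Proof.
move=> iv iN N0 H.
have H1 : {ae mu, forall z, Om z -> v z <= N z}.
  by apply: ae_le_of_span => // f tf; exact: le_trans (ler_norm _) (H _ tf).
have H2 : {ae mu, forall z, Om z -> - v z <= N z}.
  apply: ae_le_of_span => //; first exact: int1N.
  move=> f tf; apply: le_trans (H _ tf).
  rewrite -normrN -(intRN mO); last exact: int_mul_span.
  rewrite (_ : (fun z => - v z * f z) = (fun z => - (v z * f z))) ?ler_norm//.
  by apply/funext => z; rewrite mulNr.
apply: filterS2 H1 H2 => z h1 h2 Oz.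
by rewrite ler_norml h1// andbT lerNl h2.
Qed.

(** The fundamental lemma of the calculus of variations for tensor tests: linearity extends the
    hypothesis to [test_span], and the preceding bound is used with N = 0. *)
Lemma ae_eq0_of_tens g : int g ->
  (forall a b, test1 0 pi a -> test1 (- l) l b -> I (fun z => g z * tens a b z) = 0) ->
  {ae mu, forall z, Om z -> g z = 0}.
Proof.
move=> ig H.
have i0 : int (fun=> 0).
  by apply: (@int1_bounded _ _ _ _ _ mO _ 0); [exact: mu2_Omega_fin| |move=> z _; rewrite normr0].
suff : {ae mu, forall z, Om z -> `|g z| <= 0}.
  by apply: filterS => z + Oz => /(_ Oz); rewrite normr_le0 => /eqP.
apply: ae_norm_le_of_span => // f tf.
rewrite (_ : I (fun z => 0 * _) = 0); last first.
  rewrite (_ : (fun z => 0 * _) = fun=> 0) ?intR0//.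
  by apply/funext => z; rewrite mul0r.
suff -> : I (fun z => g z * f z) = 0 by rewrite normr0.
elim: tf => {f} [|a b ta tb|f f' tf If tf' If'].
- rewrite (_ : (fun z => _) = fun=> 0) ?intR0//.
  by apply/funext => z; rewrite mulr0.
- exact: H.
- rewrite (_ : (fun z => _) = fun z => g z * f z + g z * f' z); last first.
    by apply/funext => z; rewrite mulrDr.
  by rewrite intRD ?If ?If' ?addr0//; exact: int_mul_span.
Qed.

Lemma continuous_section f (y : R) : test_span l f -> continuous (fun x => f (x, y)).
Proof.
elim => {f} [|a b ta tb|f g _ If _ Ig] x.
- exact: cvg_cst.
- exact: (smooth_continuous (smoothM (test1_smooth ta) (smooth_cst (b y)))).
- by apply: cvgD; [exact: If|exact: Ig].
Qed.

Definition xmass (f : R * R -> R) (y : R) := prim 0 (fun x => f (x, y)) pi.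

Lemma xmass_test1 f : test_span l f -> test1 (- l) l (xmass f).
Proof.
elim => {f} [|a b ta tb|f g tf If tg Ig].
- rewrite (_ : xmass _ = fun=> 0); last first.
    by apply/funext => y; rewrite /xmass; exact: prim_eq0.
  split; first exact: smooth_cst.
  by exists (- l + 1), (l - 1); split => //; lra.
- rewrite (_ : xmass _ = fun y => prim 0 a pi * b y); first exact: test1Z.
  apply/funext => y; rewrite /xmass /tens /= mulrC -primZ; last first.
    exact: (smooth_continuous (test1_smooth ta)).
  by congr prim; apply/funext => x; rewrite mulrC.
- rewrite (_ : xmass _ = fun y => xmass f y + xmass g y); first exact: test1D.
  by apply/funext => y; rewrite /xmass primD//; exact: continuous_section.
Qed.

(* [x]-primitive of [f - eta * (x-mass of f)], which is again compactly
   supported. *)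
Definition xprim (eta : R -> R) f (z : R * R) : R :=
  prim 0 (fun x => f (x, z.2)) z.1 - xmass f z.2 * prim 0 eta z.1.

Section WithDerivative.
Variables (v g : R * R -> R).
Hypotheses (iv : int v) (ig : int g).
Hypothesis vg : forall a b, test1 0 pi a -> test1 (- l) l b ->
  I (fun z => v z * tens (derive1 a) b z) = - I (fun z => g z * tens a b z).

(** The function [f] is the x-derivative of [xprim eta f] plus eta(x) times the x-mass of [f]; the
    weak derivative moves the first part onto [g]. Membership and identity are proved together by
    induction on the span. *)
Lemma xprim_span eta f : test1 0 pi eta -> prim 0 eta pi = 1 -> test_span l f ->
  test_span l (xprim eta f) /\
  I (fun z => v z * f z) =
    - I (fun z => g z * xprim eta f z) + I (fun z => v z * tens eta (xmass f) z).
Proof.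
move=> te m1; elim => {f} [|a b ta tb|f h tf [If Ef] th [Ih Eh]].
- have xm0 : xmass (fun=> 0) = fun=> 0.
    by apply/funext => y; rewrite /xmass; exact: prim_eq0.
  have xp0 : xprim eta (fun=> 0) = fun=> 0.
    by apply/funext => z; rewrite /xprim xm0 prim_eq0// mul0r subr0.
  rewrite xp0 xm0; split; first exact: test_span0.
  rewrite (_ : (fun z => v z * 0) = fun=> 0); last by apply/funext => z; rewrite mulr0.
  rewrite (_ : (fun z => g z * 0) = fun=> 0); last by apply/funext => z; rewrite mulr0.
  rewrite (_ : (fun z => v z * tens eta _ z) = fun=> 0).
    by rewrite intR0// oppr0 addr0.
  by apply/funext => z; rewrite /tens !mulr0.
- have ca := smooth_continuous (test1_smooth ta).
  have ce := smooth_continuous (test1_smooth te).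
  set m := prim 0 a pi.
  have xmE : xmass (tens a b) = fun y => m * b y.
    apply/funext => y; rewrite /xmass /tens /= mulrC -primZ//.
    by congr prim; apply/funext => x; rewrite mulrC.
  have tam : test1 0 pi (fun x => a x + (- m) * eta x).
    by apply: test1D => //; exact: test1Z.
  have cme : continuous (fun x => - m * eta x).
    by apply: smooth_continuous; apply: smoothZ; exact: test1_smooth te.
  pose A := prim 0 (fun x => a x + (- m) * eta x).
  have AE x : A x = prim 0 a x - m * prim 0 eta x.
    by rewrite /A primD// primZ// mulNr.
  have tA : test1 0 pi A.
    by apply: prim_test1 => //; rewrite -/(A pi) AE m1 mulr1 subrr.
  have xpE : xprim eta (tens a b) = tens A b.
    apply/funext => z; rewrite /xprim xmE /tens AE /=.
    have -> : prim 0 (fun x => a x * b z.2) z.1 = b z.2 * prim 0 a z.1.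
      by rewrite -primZ//; congr prim; apply/funext => x; rewrite mulrC.
    ring.
  have tm : test_span l (tens eta (fun y => m * b y)).
    by apply: test_span_tens => //; exact: test1Z.
  rewrite xpE xmE; split; first exact: test_span_tens.
  rewrite -vg// (prim_derive1 tam) -intRD//.
  + apply: eq_intR => z _; rewrite /tens; ring.
  + by apply: int_mul_span => //; exact: test_span_tens.
  + exact: int_mul_span.
- have xmD : xmass (fun z => f z + h z) = fun y => xmass f y + xmass h y.
    by apply/funext => y; rewrite /xmass primD//; exact: continuous_section.
  have xpD : xprim eta (fun z => f z + h z) = fun z => xprim eta f z + xprim eta h z.
    apply/funext => z; rewrite /xprim xmD primD; [ring|exact: continuous_section..].
  rewrite xpD xmD; split; first exact: test_span_add.
  have tspan k : test_span l k -> test_span l (tens eta (xmass k)).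
    by move=> tk; apply: test_span_tens => //; exact: xmass_test1.
  rewrite (_ : (fun z => v z * _) = fun z => v z * f z + v z * h z); last first.
    by apply/funext => z; rewrite mulrDr.
  rewrite (_ : (fun z => g z * _) = fun z => g z * xprim eta f z + g z * xprim eta h z); last first.
    by apply/funext => z; rewrite mulrDr.
  rewrite (_ : (fun z => v z * tens eta _ z) = fun z =>
    v z * tens eta (xmass f) z + v z * tens eta (xmass h) z); last first.
    by apply/funext => z; rewrite -mulrDr /tens -mulrDr.
  have E1 := intRD mO (int_mul_span iv tf) (int_mul_span iv th).
  have E2 := intRD mO (int_mul_span ig If) (int_mul_span ig Ih).
  have E3 := intRD mO (int_mul_span iv (tspan _ tf)) (int_mul_span iv (tspan _ th)).
  rewrite E1 E2 E3 Ef Eh opprD; exact: addrACA.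
Qed.

Lemma xprim_le eta f z : Om z -> test1 0 pi eta -> (forall x, 0 <= eta x) ->
  prim 0 eta pi = 1 -> test_span l f ->
  `|xprim eta f z| <= 2 * mslice l (fun z => `|f z|) z /\
  `|xmass f z.2| <= mslice l (fun z => `|f z|) z.
Proof.
move=> Oz te e0 m1 tf.
have cf := @continuous_section _ z.2 tf.
have ce := smooth_continuous (test1_smooth te).
rewrite (mslice_prim Oz cf).
have [[/andP[z10 z1p] _]] := Oz.
set n := prim 0 _ pi.
have h1 : `|xmass f z.2| <= n by exact: normr_prim_le.
have h2 : `|prim 0 (fun x => f (x, z.2)) z.1| <= n by apply: normr_prim_le => //; exact: ltW.
split => //.
have h3 : `|prim 0 eta z.1| <= 1.
  rewrite ger0_norm ?prim_ge0// -m1; apply: prim_le_prim => //; exact: ltW.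
apply: le_trans (ler_normB _ _) _; rewrite normrM.
have : `|xmass f z.2| * `|prim 0 eta z.1| <= n.
  by rewrite -[n]mulr1; apply: ler_pM.
lra.
Qed.

Variable C : R.
Hypotheses (C0 : 0 <= C) (g2 : sql2 mu Om g).
(** This takes the place of a boundary value of [v]. The bump may depend on [b] and [e]: for [u_x]
    it is one fixed interior bump, for [u_y] it concentrates at the side x = 0 and [C] is 0. *)
Hypothesis vC : forall b e, test1 (- l) l b -> 0 < e ->
  exists eta, [/\ test1 0 pi eta, forall x, 0 <= eta x, prim 0 eta pi = 1 &
   `|I (fun z => v z * tens eta b z)| <= C * I (fun z => `|b z.2|) + e].

(* Primitives of [f - eta (x-mass of f)] turn the weak derivative into a bound of [v] by
   the [x]-integral of [g], up to the contribution of [eta]. *)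
Lemma slice_bound : {ae mu, forall z, Om z ->
  `|v z| <= mslice l (fun z => 2 * `|g z| + C) z}.
Proof.
pose h z := 2 * `|g z| + C.
have h0 z : 0 <= h z by rewrite addr_ge0// mulr_ge0.
have fO := mu2_Omega_fin l.
have mg : measurable_fun Om g by case: g2.
have h2 : sql2 mu Om h.
  apply: (sql2D mO); last first.
    by apply: (sql2_bounded mO (M := `|C|)).
  by apply: (sql2Z mO); exact: sql2_norm.
have [N2 _] := mslice_sql2 h2 h0.
have ih := sql2_int1' mO fO h2.
have iN := sql2_int1' mO fO N2.
apply: ae_norm_le_of_span => //; first by move=> z; exact: mslice_ge0.
move=> f tf.
have i_f := norm_span_int tf.
have n0 z : 0 <= `|f z| by [].
have [M HM] := test_span_bounded tf.
have f2 : sql2 mu Om (fun z => `|f z|).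
  apply: (sql2_bounded mO (M := M)) => //; first by apply: int1_meas i_f.
  by move=> z _; rewrite normr_id.
have [n2 _] := mslice_sql2 f2 n0.
have i_n := sql2_int1' mO fO n2.
(* Symmetry of [mslice] moves the horizontal integral onto |f|, where it dominates the primitive and
   the mass of [f] by [xprim_le]. *)
have -> : I (fun z => mslice l h z * `|f z|) = I (fun z => h z * mslice l (fun z => `|f z|) z).
  rewrite (mslice_sym ih i_f h0 n0); apply: eq_intR => z _; exact: mulrC.
apply/ler_addgt0Pr => e e0.
have txm := xmass_test1 tf.
have [eta [te e00 m1 He]] := vC txm e0.
have [txp ->] := xprim_span te m1 tf.
apply: le_trans (ler_normD _ _) _; rewrite normrN.
have ixm : int (fun z => `|xmass f z.2|).
  have [M' HM'] := test1_bounded txm.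
  apply: (@int1_bounded _ _ _ _ _ mO _ M') => //; last by move=> z _; rewrite normr_id.
  apply: measurableT_comp => //.
  apply: (@measurable_funS _ _ _ _ setT) => //.
  apply: (@measurableT_comp _ _ _ _ _ _ (xmass f) _ (fun z : P2 => z.2)).
    by apply: continuous_measurable_fun; exact: (smooth_continuous (test1_smooth txm)).
  exact: measurable_snd.
have B1 : `|I (fun z => g z * xprim eta f z)| <=
    I (fun z => 2 * `|g z| * mslice l (fun z => `|f z|) z).
  apply: norm_intR_le => //.
  - exact: int_mul_span (sql2_int1' mO fO g2) txp.
  - apply: sql2M_int1 => //; apply: sql2Z => //; exact: sql2_norm.
  - move=> z Oz; rewrite normrM [2 * _]mulrC -mulrA ler_wpM2l//.
    by have [] := xprim_le Oz te e00 m1 tf.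
have B2 : C * I (fun z => `|xmass f z.2|) <= I (fun z => C * mslice l (fun z => `|f z|) z).
  rewrite intRZ// ler_wpM2l//; apply: le_intR => // z Oz.
  by have [] := xprim_le Oz te e00 m1 tf.
apply: le_trans (lerD B1 (le_trans He (lerD B2 (lexx _)))) _.
rewrite addrA lerD2r -intRD//.
- rewrite le_eqVlt; apply/orP; left; apply/eqP; apply: eq_intR => z _.
  by rewrite -mulrDl.
- apply: sql2M_int1 => //; apply: sql2Z => //; exact: sql2_norm.
- exact: int1Z.
Qed.

(** A Poincare inequality in the [x] direction: pi^2 is the constant of [mslice_sql2], and 8 and 2
    come from (2 |g| + C)^2 <= 8 g^2 + 2 C^2. *)
Lemma slice_bound_sq : sql2 mu Om v ->
  I (fun z => v z ^+ 2) <= pi ^+ 2 * (8 * I (fun z => g z ^+ 2) + 2 * I (fun=> C ^+ 2)).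
Proof.
move=> v2; have H := slice_bound.
set h := (fun z => 2 * `|g z| + C) in H.
have h0 z : 0 <= h z by rewrite addr_ge0// mulr_ge0.
have lC : sql2 mu Om (fun=> C).
  by apply: (sql2_bounded mO (M := `|C|)) => //; exact: mu2_Omega_fin.
have lh : sql2 mu Om h by apply: (sql2D mO) => //; apply: (sql2Z mO); exact: sql2_norm.
have [N2 HN] := mslice_sql2 lh h0.
have I1 : I (fun z => v z ^+ 2) <= I (fun z => mslice l h z ^+ 2).
  apply: (ae_le_le_intR mO); [exact: sql2_int1|exact: sql2_int1|].
  apply: filterS H => z H Oz; rewrite -[v z ^+ 2]real_normK ?num_real//.
  by rewrite lerXn2r ?nnegrE ?mslice_ge0// H.
apply: le_trans I1 (le_trans HN _); rewrite ler_wpM2l ?sqr_ge0//.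
have : I (fun z => h z ^+ 2) <= I (fun z => 8 * g z ^+ 2 + 2 * C ^+ 2).
  apply: le_intR => //.
  - exact: sql2_int1.
  - apply: int1D => //; first by apply: int1Z => //; exact: sql2_int1.
    by apply: int1Z => //; exact: sql2_int1.
  - move=> z _; rewrite /h -[g z ^+ 2]real_normK ?num_real//.
    have := sqr_ge0 (2 * `|g z| - C); lra.
move=> /le_trans; apply.
have i1 := sql2_int1 g2; have i2 := sql2_int1 lC.
by rewrite (intRD mO (int1Z mO 8 i1) (int1Z mO 2 i2)) (intRZ mO 8 i1) (intRZ mO 2 i2).
Qed.

End WithDerivative.
End SliceBound.

(** * Equicontinuity *)

Section Regular.
Variables (R : realType) (l : R).
Local Notation P2 := (measurableTypeR R * measurableTypeR R)%type.
Local Notation Om := (Omega l : set P2).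
Local Notation pi := (@pi R).
Local Notation leb := (@lebesgue_measure R).
Local Notation mu := (@mu2 R).
Local Notation int := (int1 mu Om).
Local Notation I := (intR mu Om).
Local Notation L2 := (sql2 mu Om).
Let mO := Omega_measurable l.
Let fO := mu2_Omega_fin l.
Hypothesis l0 : 0 < l.
Let p0 := @pi_gt0 R.

Lemma tens_int (a b : R -> R) : continuous a -> continuous b ->
  (exists A, forall x, `|a x| <= A) -> (exists B, forall x, `|b x| <= B) ->
  int (tens a b).
Proof.
move=> ca cb [A HA] [B HB]; apply: (int1_bounded mO (M := A * B)) => //.
  exact: measurable_tens.
by move=> z _; rewrite normrM ler_pM.
Qed.

Lemma test_int a b : test1 0 pi a -> test1 (- l) l b -> int (tens a b).
Proof.
move=> ta tb; apply: tens_int.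
- exact: smooth_continuous (test1_smooth ta).
- exact: smooth_continuous (test1_smooth tb).
- exact: test1_bounded ta.
- exact: test1_bounded tb.
Qed.

Lemma integral_prim s t (f : R -> R) : continuous f ->
  (\int[leb]_(x in `]s, t[) (f x)%:E)%E = (prim s f t)%:E.
Proof.
move=> cf; have ic := continuous_integrable s t cf.
rewrite integral_itv_bndo_bndc; last first.
  by apply: measurable_funTS; apply/measurable_EFinP; exact: continuous_measurable_fun.
rewrite integral_itv_obnd_cbnd; last first.
  by apply: measurable_funTS; apply/measurable_EFinP; exact: continuous_measurable_fun.
by rewrite /prim /Rintegral fineK//; exact: integrable_fin_num.
Qed.

Lemma intR_tens (a b : R -> R) : continuous a -> continuous b ->
  (forall x, 0 <= a x) -> (forall x, 0 <= b x) ->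
  I (tens a b) = prim 0 a pi * prim (- l) b l.
Proof.
move=> ca cb a0 b0.
have H : (\int[mu]_(z in Om) (tens a b z)%:E = (prim 0 a pi * prim (- l) b l)%:E)%E.
  rewrite (integral_slice (F := tens a b)); last 2 first.
  - exact: measurable_tens.
  - by move=> z; rewrite mulr_ge0.
  have -> : (\int[leb]_y slice l (tens a b) y =
      \int[leb]_(y in `](- l)%R, l[) (prim 0 a pi * b y)%:E)%E.
    rewrite [RHS]integral_mkcond; apply: eq_integral => y _; rewrite /patch.
    case: ifPn => [/set_mem|].
      rewrite /= in_itv/= => yl; rewrite slice_in//.
      rewrite mulrC -primZ// -integral_prim.
        by apply: eq_integral => x _; rewrite /tens /= mulrC.
      by move=> x; apply: cvgM; [exact: cvg_cst|exact: ca].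
    move=> /negP yl; rewrite slice_out// => yl'; apply: yl; apply/mem_set.
    by rewrite /= in_itv.
  rewrite (@integral_prim (- l) l (fun y => prim 0 a pi * b y)); last first.
    by move=> x; apply: cvgM; [exact: cvg_cst|exact: cb].
  by rewrite primZ.
by rewrite /intR /Rintegral H.
Qed.

(** What the estimates take from H^2_*: the weak derivatives tested with products, continuity up to
    the boundary, and the boundary condition on the side x = 0. *)
Definition regular (u ux uy uxx uxy : R * R -> R) :=
  [/\ L2 u, L2 ux, L2 uy, L2 uxx & L2 uxy] /\
  [/\ forall a b, test1 0 pi a -> test1 (- l) l b ->
        I (fun z => u z * tens (derive1 a) b z) = - I (fun z => ux z * tens a b z),
      forall a b, test1 0 pi a -> test1 (- l) l b ->
        I (fun z => u z * tens a (derive1 b) z) = - I (fun z => uy z * tens a b z),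
      forall a b, test1 0 pi a -> test1 (- l) l b ->
        I (fun z => u z * tens (derive1 (derive1 a)) b z) = I (fun z => uxx z * tens a b z) &
      forall a b, test1 0 pi a -> test1 (- l) l b ->
        I (fun z => u z * tens (derive1 a) (derive1 b) z) = I (fun z => uxy z * tens a b z)] /\
  {within clOmega l, continuous u} /\
  (forall y, - l < y < l -> u (0, y) = 0).

Lemma H2_regular u ux uy uxx uxy uyy :
  H2 (Omega l) u ux uy uxx uxy uyy ->
  {within clOmega l, continuous u} ->
  (forall y, - l < y < l -> u (0, y) = 0 /\ u (pi, y) = 0) ->
  regular u ux uy uxx uxy.
Proof.
move=> [[h1 h2 h3 h4 h5] [h6 [w1 w2 w3 w4 w5]]] cu bc.
split; first exact (And5 h1 h2 h3 h4 h5).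
split; last by split; [exact: cu|move=> y /bc[]].
split => a b ta tb; have tab := test_fun_tens ta tb;
  have sa := test1_smooth ta; have sb := test1_smooth tb.
- by have := w1 _ tab; rewrite iter_derive1// expr1 mulN1r.
- by have := w2 _ tab; rewrite iter_derive2// expr1 mulN1r.
- by have := w3 _ tab; rewrite iter_derive11// sqrrN expr1n mul1r.
- by have := w4 _ tab; rewrite iter_derive12// sqrrN expr1n mul1r.
Qed.

(** The derivative [ux] has weak x-derivative [uxx]. Against eta(x) b(y), with one fixed interior
    bump [eta], it equals minus [u] against eta'(x) b(y), which is at most |M| sup |eta'| times the
    L^1 norm of b(y) on [Omega]; hence a bound that depends only on [l], [M] and [K]. *)
Lemma ux_bound (M K : R) : exists B : R, forall u ux uy uxx uxy : R * R -> R,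
  regular u ux uy uxx uxy -> (forall z, Om z -> `|u z| <= M) ->
  I (fun z => uxx z ^+ 2) <= K -> I (fun z => ux z ^+ 2) <= B.
Proof.
have [s [t [h1 h2 h3]]] : exists s t : R, [/\ 0 < s, s < t & t < pi].
  by move: p0; move: (pi : R) => q q0; exists (q / 3), (q / 2); split; lra.
have [eta [te e0 _ m1]] := @bump_exists R 0 pi s t h1 h2 h3.
have [E HE] := test1_bounded (test1_derive te).
pose C := `|M| * `|E|.
pose A := I (fun=> C ^+ 2).
exists (pi ^+ 2 * (8 * K + 2 * A)) => u ux uy uxx uxy [[l2u l2ux l2uy l2uxx l2uxy] [[wx wy wxx wxy] _]] uM uK.
have iu := sql2_int1' mO fO l2u; have iux := sql2_int1' mO fO l2ux.
have iuxx := sql2_int1' mO fO l2uxx.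
have C0 : 0 <= C by rewrite mulr_ge0.
have vg a b : test1 0 pi a -> test1 (- l) l b ->
    I (fun z => ux z * tens (derive1 a) b z) = - I (fun z => uxx z * tens a b z).
  by move=> ta tb; rewrite -wxx// wx ?opprK//; exact: test1_derive.
have vC b e : test1 (- l) l b -> 0 < e ->
  exists eta, [/\ test1 0 pi eta, forall x, 0 <= eta x, prim 0 eta pi = 1 &
   `|I (fun z => ux z * tens eta b z)| <= C * I (fun z => `|b z.2|) + e].
  move=> tb e00; exists eta; split => //.
  rewrite -normrN -wx//; apply: le_trans (_ : _ <= C * I (fun z => `|b z.2|)) _; last by rewrite lerDl ltW.
  have ib : int (fun z => `|b z.2|).
    have := @tens_int (fun=> 1) b; rewrite /tens => H.
    apply: (@eq_int1 _ _ _ _ _ mO (fun z => `|1 * b z.2|)).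
      by move=> z _; rewrite mul1r.
    apply: int1_norm; apply: H.
    - by move=> x; exact: cvg_cst.
    - exact: smooth_continuous (test1_smooth tb).
    - by exists 1 => x; rewrite normr1.
    - exact: test1_bounded tb.
  rewrite -(intRZ mO)//; apply: norm_intR_le => //.
  - by apply: int_mul_span => //; apply: test_span_tens => //; exact: test1_derive.
  - exact: int1Z.
  - move=> z Oz; rewrite /tens !normrM mulrA ler_wpM2r// ler_pM//.
      by apply: le_trans (uM _ Oz) _; exact: ler_norm.
    by apply: le_trans (HE _) _; exact: ler_norm.
apply: le_trans (slice_bound_sq iux iuxx vg C0 l2uxx vC l2ux) _.
by rewrite ler_wpM2l ?sqr_ge0// lerD2r ler_wpM2l.
Qed.

(** Young's inequality on the box that supports the test function. The parameter [t] stays free: it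
    will be the square root of the area of a rectangle, or of its width. *)
Lemma tens_pairing_le (w : R * R -> R) (a b : R -> R) (x1 x2 y1 y2 A t : R) : L2 w ->
  test1 0 pi a -> test1 (- l) l b -> x1 <= x2 -> y1 <= y2 -> 0 < t ->
  (forall z, `|tens a b z| <= A) ->
  (forall x, ~ (x1 < x < x2) -> a x = 0) ->
  (forall y, ~ (y1 < y < y2) -> b y = 0) ->
  `|I (fun z => w z * tens a b z)| <=
    (t * I (fun z => w z ^+ 2) + A ^+ 2 * ((x2 - x1) * (y2 - y1)) / t) / 2.
Proof.
move=> lw ta tb x12 y12 t0 tA as_ bs_.
have iw := sql2_int1 lw.
pose Q := box x1 x2 y1 y2.
have mQ : measurable Q := box_measurable x1 x2 y1 y2.
have iQ : int (\1_Q).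
  apply: (int1_bounded mO (M := 1)) => //.
  by move=> z _; rewrite indicE; case: (_ \in _); rewrite ?normr1 ?normr0.
have IQ : I (\1_Q) <= (x2 - x1) * (y2 - y1).
  rewrite -lee_fin EFin_intR// -(mu2_box x12 y12).
  rewrite integral_indic//; apply: le_measure; rewrite ?inE//; last exact: measurableI.
have : `|I (fun z => w z * tens a b z)| <=
    I (fun z => (t / 2) * w z ^+ 2 + (A ^+ 2 / t / 2) * \1_Q z).
  apply: norm_intR_le => //.
  - exact: (int_mul_span (sql2_int1' mO fO lw) (test_span_tens ta tb)).
  - by apply: int1D => //; exact: int1Z.
  - move=> z _.
    have [Qz|Qz] := pselect (Q z); last first.
      have -> : tens a b z = 0.
        rewrite /tens; have [H|H] := pselect (x1 < z.1 < x2); last by rewrite as_// mul0r.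
        have [H'|H'] := pselect (y1 < z.2 < y2); last by rewrite bs_// mulr0.
        by exfalso; apply: Qz; apply/boxE.
      have T0 : 0 <= t / 2 by rewrite divr_ge0// ltW.
      have S0 : 0 <= A ^+ 2 / t / 2 by apply: divr_ge0 => //; rewrite divr_ge0 ?sqr_ge0// ltW.
      rewrite mulr0 normr0; apply: addr_ge0; apply: mulr_ge0 => //; first exact: sqr_ge0.
    rewrite indicE mem_set// mulr1 normrM.
    have A0 : 0 <= A by apply: le_trans (tA z).
    apply: le_trans (_ : `|w z| * A <= _); first by rewrite ler_wpM2l.
    rewrite -[w z ^+ 2]real_normK ?num_real//; set r := `|w z|.
    rewrite -subr_ge0.
    have -> : t / 2 * r ^+ 2 + A ^+ 2 / t / 2 - r * A = (t * r - A) ^+ 2 / (2 * t).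
      by field; rewrite gt_eqF.
    by rewrite divr_ge0 ?sqr_ge0// mulr_ge0// ltW.
move=> /le_trans; apply.
rewrite intRD//; [|exact: int1Z|exact: int1Z].
have S0 : 0 <= A ^+ 2 / t / 2 by apply: divr_ge0 => //; rewrite divr_ge0 ?sqr_ge0// ltW.
rewrite (intRZ mO (t / 2) iw) (intRZ mO _ iQ).
have := ler_wpM2l S0 IQ.
move: (intR mu _ _) (intR mu _ _) => X Y H.
have -> : (t * X + A ^+ 2 * ((x2 - x1) * (y2 - y1)) / t) / 2 =
    t / 2 * X + A ^+ 2 / t / 2 * ((x2 - x1) * (y2 - y1)) by ring.
by rewrite lerD2l.
Qed.

End Regular.

Lemma mixed_diff_arith (R : realType) (a11 a12 a21 a22 v11 v12 v21 v22 c e : R) :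
  `|a11 - v11| <= e / 8 -> `|a12 - v12| <= e / 8 -> `|a21 - v21| <= e / 8 ->
  `|a22 - v22| <= e / 8 -> `|a11 - a12 - (a21 - a22)| <= c + e / 2 ->
  `|v22 - v12 - (v21 - v11)| <= c + e.
Proof.
rewrite !ler_norml => /andP[? ?] /andP[? ?] /andP[? ?] /andP[? ?] /andP[? ?].
by apply/andP; split; lra.
Qed.

(** * Mixed differences over rectangles *)

Section MixedDifference.
Variables (R : realType) (l : R).
Local Notation P2 := (measurableTypeR R * measurableTypeR R)%type.
Local Notation Om := (Omega l : set P2).
Local Notation pi := (@pi R).
Local Notation mu := (@mu2 R).
Local Notation int := (int1 mu Om).
Local Notation I := (intR mu Om).
Let mO := Omega_measurable l.
Let fO := mu2_Omega_fin l.
Hypothesis l0 : 0 < l.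

Lemma lt_all (s : seq R) : all (fun d => 0 < d) s ->
  exists2 e : R, 0 < e & all (fun d => e < d) s.
Proof.
elim: s => [|x s IH] /=; first by exists 1.
move=> /andP[x0 /IH[e e0 es]]; exists (Num.min e (x / 2)).
  by rewrite lt_min e0 divr_gt0.
apply/andP; split; first by rewrite gt_min; apply/orP; right; lra.
by apply: sub_all es => d ed; rewrite gt_min ed.
Qed.

Lemma Omega_sub z : Om z -> clOmega l z.
Proof. by move=> [/andP[a b] /andP[c d]]; split; rewrite !ltW. Qed.

(** The product of two mass-one bumps has mass one, so the pairing is a weighted mean of [u] over
    the box that supports it. *)
Lemma tens_approx u r p c d x1 x2 y1 y2 : int u ->
  test1 0 pi r -> test1 (- l) l p ->
  (forall x, 0 <= r x) -> (forall y, 0 <= p y) ->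
  prim 0 r pi = 1 -> prim (- l) p l = 1 ->
  (forall x, ~ (x1 < x < x2) -> r x = 0) ->
  (forall y, ~ (y1 < y < y2) -> p y = 0) ->
  (forall z, Om z -> x1 < z.1 < x2 -> y1 < z.2 < y2 -> `|u z - c| <= d) ->
  `|I (fun z => u z * tens r p z) - c| <= d.
Proof.
move=> iu tr tp r0 p0' mr mp rs ps uc.
have it : int (tens r p) by exact: test_int.
have It : I (tens r p) = 1.
  rewrite intR_tens ?mr ?mp ?mulr1//; apply: smooth_continuous.
    exact: test1_smooth tr.
  exact: test1_smooth tp.
have iut : int (fun z => u z * tens r p z).
  by apply: int_mul_span => //; exact: test_span_tens.
have -> : c = I (fun z => c * tens r p z) by rewrite (intRZ mO c it) It mulr1.
rewrite -(intRB mO iut (int1Z mO c it)).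
have -> : d = I (fun z => d * tens r p z) by rewrite (intRZ mO d it) It mulr1.
apply: norm_intR_le => //.
- exact: (int1B mO iut (int1Z mO c it)).
- exact: int1Z.
- move=> z Oz; rewrite -mulrBl normrM.
  have t0 : 0 <= tens r p z by rewrite mulr_ge0.
  rewrite (ger0_norm t0).
  have [H|H] := pselect (x1 < z.1 < x2); last by rewrite /tens rs// mul0r !mulr0.
  have [H'|H'] := pselect (y1 < z.2 < y2); last by rewrite /tens ps// !mulr0.
  by rewrite ler_wpM2r// uc.
Qed.

(** The test function is a smoothed indicator a(x) b(y) of the rectangle. Its mixed derivative
    consists of four mass-one bumps at the corners, so testing [u] with it gives the mixed
    difference up to a small error, while testing [uxy] with a(x) b(y) is bounded by Young's
    inequality; with t^2 equal to the area this is t (K + 1) / 2. *)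
Lemma mixed_diff_lt u ux uy uxx uxy K x1 x2 y1 y2 t :
  regular l u ux uy uxx uxy -> I (fun z => uxy z ^+ 2) <= K ->
  0 < x1 -> x1 < x2 -> x2 < pi -> - l < y1 -> y1 < y2 -> y2 < l ->
  0 < t -> t ^+ 2 = (x2 - x1) * (y2 - y1) ->
  `|u (x2, y2) - u (x1, y2) - (u (x2, y1) - u (x1, y1))| <= t * ((K + 1) / 2).
Proof.
move=> Hr uK x10 x12 x2p y1l y12 y2l t0 tE.
have [c11 c12 c21 c22] : [/\ clOmega l (x1, y1), clOmega l (x1, y2),
    clOmega l (x2, y1) & clOmega l (x2, y2)].
  by split; apply: Omega_sub; split; apply/andP; split => //=; clear -x10 x12 x2p y1l y12 y2l; lra.
have q0 : 0 < x2 - x1 + (y2 - y1) + 1 by clear -x12 y12; lra.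
move: Hr => [[l2u l2ux l2uy l2uxx l2uxy] [[wx wy wxx wxy] [cu bc]]].
have iu := sql2_int1' mO fO l2u.
apply/ler_addgt0Pr => e e0; have e8 : 0 < e / 8 by rewrite divr_gt0.
have cw := (within_continuousP2 (clOmega l) u).1 cu.
have [d11 d11p H11] := cw (x1, y1) c11 _ e8.
have [d12 d12p H12] := cw (x1, y2) c12 _ e8.
have [d21 d21p H21] := cw (x2, y1) c21 _ e8.
have [d22 d22p H22] := cw (x2, y2) c22 _ e8.
(* The first four entries keep [u] within e / 8 of its corner values on the bumps, the lengths keep
   the plateaus inside [Omega], and the last entry, with h < 1, bounds by e t the area gained when
   the rectangle is widened by [h]. *)
have [|h h0] := @lt_all [:: d11; d12; d21; d22; x2 - x1; pi - x2; y2 - y1; l - y2; 1;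
   e * t / (x2 - x1 + (y2 - y1) + 1)].
  by rewrite /= d11p d12p d21p d22p !subr_gt0 x12 x2p y12 y2l ltr01 divr_gt0// mulr_gt0.
rewrite /= !andbT => /and5P[h11 h12 h21 h22 /and5P[hx hp hy hl /andP[h1 hq]]].
have [hx' hp' hy' hl'] : [/\ x1 + h < x2, x2 + h < pi, y1 + h < y2 & y2 + h < l].
  by clear -hx hp hy hl; split; lra.
have [a [r1 [r2 [ta da a01 as_ [[tr1 tr2] [r10 r1s] [r20 r2s] [mr1 mr2]]]]]] :=
  @plateau_exists R 0 pi x1 x2 h x10 h0 hx' hp'.
have [b [q1 [q2 [tb db b01 bs_ [[tq1 tq2] [q10 q1s] [q20 q2s] [mq1 mq2]]]]]] :=
  @plateau_exists R (- l) l y1 y2 h y1l h0 hy' hl'.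
have near xi yj r q d : (forall w, clOmega l w -> `|(xi, yj).1 - w.1| < d -> `|(xi, yj).2 - w.2| < d ->
      `|u (xi, yj) - u w| < e / 8) -> h < d ->
    test1 0 pi r -> test1 (- l) l q -> (forall x, 0 <= r x) -> (forall y, 0 <= q y) ->
    prim 0 r pi = 1 -> prim (- l) q l = 1 ->
    (forall x, ~ (xi < x < xi + h) -> r x = 0) ->
    (forall y, ~ (yj < y < yj + h) -> q y = 0) ->
    `|I (fun z => u z * tens r q z) - u (xi, yj)| <= e / 8.
  move=> H hd tr tq r0 q0' mr mq rs qs.
  apply: (@tens_approx _ _ _ _ _ xi (xi + h) yj (yj + h)) => // z Oz /andP[z1 z2] /andP[z3 z4].
  rewrite distrC ltW//; apply: H; first exact: Omega_sub.
    by clear -z1 z2 hd; rewrite /= ltr_norml; apply/andP; split; lra.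
  by clear -z3 z4 hd; rewrite /= ltr_norml; apply/andP; split; lra.
have N11 := near _ _ _ _ _ H11 h11 tr1 tq1 r10 q10 mr1 mq1 r1s q1s.
have N12 := near _ _ _ _ _ H12 h12 tr1 tq2 r10 q20 mr1 mq2 r1s q2s.
have N21 := near _ _ _ _ _ H21 h21 tr2 tq1 r20 q10 mr2 mq1 r2s q1s.
have N22 := near _ _ _ _ _ H22 h22 tr2 tq2 r20 q20 mr2 mq2 r2s q2s.
have i_ r q : test1 0 pi r -> test1 (- l) l q -> int (fun z => u z * tens r q z).
  by move=> tr tq; apply: int_mul_span => //; exact: test_span_tens.
have E : I (fun z => uxy z * tens a b z) =
    I (fun z => u z * tens r1 q1 z) - I (fun z => u z * tens r1 q2 z)
    - (I (fun z => u z * tens r2 q1 z) - I (fun z => u z * tens r2 q2 z)).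
  rewrite -wxy//.
  rewrite -(intRB mO (i_ _ _ tr1 tq1) (i_ _ _ tr1 tq2)).
  rewrite -(intRB mO (i_ _ _ tr2 tq1) (i_ _ _ tr2 tq2)).
  rewrite -intRB//; [|apply: int1B => //; exact: i_..].
  by apply: eq_intR => z _; rewrite /tens da db; ring.
have B : `|I (fun z => uxy z * tens a b z)| <= t * ((K + 1) / 2) + e / 2.
  have := @tens_pairing_le R l uxy a b x1 (x2 + h) y1 (y2 + h) 1 t l2uxy ta tb.
  move=> /(_ _ _ t0 _ as_ bs_) H.
  have {}H : `|I (fun z => uxy z * tens a b z)| <=
    (t * I (fun z => uxy z ^+ 2) + 1 ^+ 2 * ((x2 + h - x1) * (y2 + h - y1)) / t) / 2.
    apply: H; [by clear -x12 h0; lra|by clear -y12 h0; lra|move=> z].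
    have /andP[? ?] := a01 z.1; have /andP[? ?] := b01 z.2.
    by rewrite ger0_norm ?mulr_ge0 ?mulr_ile1.
  apply: le_trans H _; rewrite expr1n mul1r.
  have -> : (x2 + h - x1) * (y2 + h - y1) = t ^+ 2 + h * (x2 - x1 + (y2 - y1) + h).
    by rewrite tE; ring.
  have hh : h * (x2 - x1 + (y2 - y1) + h) <= e * t.
    have : h * (x2 - x1 + (y2 - y1) + 1) <= e * t by rewrite -ler_pdivlMr// ltW.
    by apply: le_trans; rewrite ler_wpM2l ?ltW//; clear -h1; lra.
  have : (t ^+ 2 + h * (x2 - x1 + (y2 - y1) + h)) / t <= t + e.
    by rewrite ler_pdivrMr// mulrDl -expr2 lerD2l.
  have : t * I (fun z => uxy z ^+ 2) <= t * K by rewrite ler_wpM2l// ltW.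
  by move: (t * I _) => X; clear; lra.
rewrite E in B; exact: mixed_diff_arith N11 N12 N21 N22 B.
Qed.

End MixedDifference.

(** * Moduli of continuity in [y] and in [x] *)

Section Equicontinuity.
Variables (R : realType) (l : R).
Local Notation P2 := (measurableTypeR R * measurableTypeR R)%type.
Local Notation Om := (Omega l : set P2).
Local Notation pi := (@pi R).
Local Notation mu := (@mu2 R).
Local Notation int := (int1 mu Om).
Local Notation I := (intR mu Om).
Let mO := Omega_measurable l.
Let fO := mu2_Omega_fin l.
Hypothesis l0 : 0 < l.

Lemma mixed_diff u ux uy uxx uxy (K x1 x2 y1 y2 : R) : 0 <= K ->
  regular l u ux uy uxx uxy -> I (fun z => uxy z ^+ 2) <= K ->
  0 < x1 < pi -> 0 < x2 < pi -> - l < y1 < l -> - l < y2 < l ->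
  `|u (x2, y2) - u (x1, y2) - (u (x2, y1) - u (x1, y1))| <=
    Num.sqrt `|x2 - x1| * Num.sqrt `|y2 - y1| * ((K + 1) / 2).
Proof.
move=> K0 Hr HK.
have K1 : 0 <= (K + 1) / 2 by rewrite divr_ge0// addr_ge0.
have pos : 0 <= Num.sqrt `|x2 - x1| * Num.sqrt `|y2 - y1| * ((K + 1) / 2).
  by apply: mulr_ge0 => //; apply: mulr_ge0; exact: sqrtr_ge0.
have lt x1' x2' y1' y2' : 0 < x1' -> x1' < x2' -> x2' < pi -> - l < y1' -> y1' < y2' -> y2' < l ->
  `|u (x2', y2') - u (x1', y2') - (u (x2', y1') - u (x1', y1'))| <=
    Num.sqrt `|x2' - x1'| * Num.sqrt `|y2' - y1'| * ((K + 1) / 2).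
  move=> h1 h2 h3 h4 h5 h6; apply: (mixed_diff_lt Hr HK) => //.
    by rewrite mulr_gt0// sqrtr_gt0 normr_gt0 subr_eq0 gt_eqF.
  by rewrite exprMn !sqr_sqrtr// !gtr0_norm// subr_gt0.
move=> /andP[a1 a2] /andP[b1 b2] /andP[c1 c2] /andP[d1 d2].
have [xx|xx|xx] := ltgtP x1 x2; last first.
- by rewrite [X in `|X|](_ : _ = 0) ?normr0// xx !subrr.
- have [yy|yy|yy] := ltgtP y1 y2; last first.
  + by rewrite [X in `|X|](_ : _ = 0) ?normr0// yy subrr.
  + have := lt x2 x1 y2 y1 b1 xx a2 d1 yy c2.
    rewrite [`|x1 - x2|]distrC [`|y1 - y2|]distrC; congr (`|_| <= _); ring.
  + have := lt x2 x1 y1 y2 b1 xx a2 c1 yy d2.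
    rewrite [`|x1 - x2|]distrC [X in _ -> `|X| <= _](_ : _ =
      - (u (x1, y2) - u (x2, y2) - (u (x1, y1) - u (x2, y1)))) ?normrN//; ring.
- have [yy|yy|yy] := ltgtP y1 y2; last first.
  + by rewrite [X in `|X|](_ : _ = 0) ?normr0// yy subrr.
  + have := lt x1 x2 y2 y1 a1 xx b2 d1 yy c2.
    rewrite [`|y1 - y2|]distrC [X in _ -> `|X| <= _](_ : _ =
      - (u (x2, y1) - u (x1, y1) - (u (x2, y2) - u (x1, y2)))) ?normrN//; ring.
  + exact: lt.
Qed.

(** [mixed_diff] concerns interior points, so the left side of the rectangle is put at a small h >
    0, where continuity and the boundary condition make both values of [u] less than e / 2. *)
Lemma y_modulus u ux uy uxx uxy (K x y1 y2 : R) : 0 <= K ->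
  regular l u ux uy uxx uxy -> I (fun z => uxy z ^+ 2) <= K ->
  0 < x < pi -> - l < y1 < l -> - l < y2 < l ->
  `|u (x, y2) - u (x, y1)| <= Num.sqrt pi * Num.sqrt `|y2 - y1| * ((K + 1) / 2).
Proof.
move=> K0 Hr HK /andP[x0 xp] Hy1 Hy2.
have [_ [_ [cu bc]]] := Hr.
apply/ler_addgt0Pr => e e0; have e2 : 0 < e / 2 by rewrite divr_gt0.
have cw := (within_continuousP2 (clOmega l) u).1 cu.
have cl0 y : - l < y < l -> clOmega l (0, y).
  by move=> /andP[h1 h2]; split => /=; rewrite ?lexx ?pi_ge0// !ltW.
have [d1 d10 H1] := cw _ (cl0 _ Hy1) _ e2.
have [d2 d20 H2] := cw _ (cl0 _ Hy2) _ e2.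
have [|h h0] := @lt_all R [:: d1; d2; x]; first by rewrite /= d10 d20 x0.
rewrite /= andbT => /and3P[hd1 hd2 hx].
have hp : 0 < h < pi by rewrite h0 (lt_trans hx).
have clh y : - l < y < l -> clOmega l (h, y).
  by move=> Hy; apply: Omega_sub.
have A1 : `|u (h, y1)| < e / 2.
  rewrite -normrN -sub0r -[X in `|X - _|](bc y1)//; apply: H1 => /=.
  - exact: clh.
  - by rewrite sub0r normrN gtr0_norm.
  - by rewrite subrr normr0.
have A2 : `|u (h, y2)| < e / 2.
  rewrite -normrN -sub0r -[X in `|X - _|](bc y2)//; apply: H2 => /=.
  - exact: clh.
  - by rewrite sub0r normrN gtr0_norm.
  - by rewrite subrr normr0.
have xx : 0 < x < pi by rewrite x0.
have := @mixed_diff u ux uy uxx uxy K h x y1 y2 K0 Hr HK hp xx Hy1 Hy2.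
have : Num.sqrt `|x - h| * Num.sqrt `|y2 - y1| * ((K + 1) / 2) <=
   Num.sqrt pi * Num.sqrt `|y2 - y1| * ((K + 1) / 2).
  rewrite -!mulrA ler_wpM2r//.
    by rewrite mulr_ge0 ?sqrtr_ge0// divr_ge0// addr_ge0.
  by rewrite ler_wsqrtr// ger0_norm; clear -hx xp h0; lra.
move: (_ * _ * ((K + 1) / 2)) (_ * _ * ((K + 1) / 2)) => X Y.
clear -A1 A2; move: A1 A2; rewrite !ltr_norml => /andP[? ?] /andP[? ?] ?.
by rewrite !ler_norml => /andP[? ?]; apply/andP; split; lra.
Qed.

(** The values at (x1, 0) and (x2, 0) are replaced by means of [u] over thin boxes 0 < y < r; the
    modulus in [y] makes this cheap. The difference of the means is [ux] tested against a plateau in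
    [x] times a bump in [y], of order the square root of x2 - x1. *)
Lemma x_modulus0 (M K e : R) : 0 <= K -> 0 < e -> exists2 d : R, 0 < d &
  forall u ux uy uxx uxy, regular l u ux uy uxx uxy ->
    (forall z, Om z -> `|u z| <= M) ->
    I (fun z => uxx z ^+ 2) <= K -> I (fun z => uxy z ^+ 2) <= K ->
    forall x1 x2, 0 < x1 -> x1 < x2 -> x2 < pi -> x2 - x1 < d ->
    `|u (x2, 0) - u (x1, 0)| <= e.
Proof.
move=> K0 e0.
have [Cx HCx] := @ux_bound R l M K.
pose S := Num.sqrt pi * ((K + 1) / 2).
have S0 : 0 <= S by rewrite mulr_ge0 ?sqrtr_ge0// divr_ge0// addr_ge0.
have e8 : 0 < e / 8 by rewrite divr_gt0.
(* The height [r] is fixed before [d], because the bound [B] of the bump in [y] depends on it. *)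
have [r [r0 rl HrS]] : exists r : R, [/\ 0 < r, r < l & S * Num.sqrt r <= e / 8].
  have S1 : 0 < S + 1 by rewrite ltr_wpDl.
  have [|h h0 /=] := @lt_all R [:: l; (e / 8 / (S + 1)) ^+ 2].
    by rewrite /= l0 exprn_gt0// divr_gt0.
  rewrite andbT => /andP[hl hh]; exists h; split => //.
  have : Num.sqrt h <= e / 8 / (S + 1).
    rewrite -[X in _ <= X]ger0_norm; last by apply: ltW; rewrite !divr_gt0.
    by rewrite -sqrtr_sqr ler_wsqrtr// ltW.
  rewrite ler_pdivlMr// => /(le_trans _); apply.
  by rewrite mulrC ler_wpM2l ?sqrtr_ge0// lerDl.
have l0' : - l < 0 by rewrite oppr_lt0.
have [b [tb b0 bs_ mb]] := @bump_exists R (- l) l 0 r l0' r0 rl.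
have [B HB] := test1_bounded tb.
have B0 : 0 <= B by apply: le_trans (HB 0).
(* With t the square root of x2 - x1, the pairing is at most t Q / 2: |Cx| bounds the integral of
   [ux] squared, and the factor 2 is due to the widened support, of length at most 2 (x2 - x1). *)
pose Q := `|Cx| + 2 * (B ^+ 2 * r) + 1.
have Q0 : 0 < Q by rewrite ltr_wpDl// addr_ge0// mulr_ge0// mulr_ge0 ?sqr_ge0// ltW.
exists ((e / Q) ^+ 2); first by rewrite exprn_gt0// divr_gt0.
move=> u ux uy uxx uxy Hr uM Kxx Kxy x1 x2 x10 x12 x2p xd.
have Bux := HCx u ux uy uxx uxy Hr uM Kxx.
have [[l2u l2ux l2uy l2uxx l2uxy] [[wx wy wxx wxy] [cu bc]]] := Hr.
have iu := sql2_int1' mO fO l2u.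
have cw := (within_continuousP2 (clOmega l) u).1 cu.
have x1p : x1 < pi by exact: lt_trans x12 x2p.
have x20 : 0 < x2 by exact: lt_trans x12.
have O1 : Om (x1, 0) by split; apply/andP.
have O2 : Om (x2, 0) by split; apply/andP.
have [d1 d10 H1] := cw _ (Omega_sub O1) _ e8.
have [d2 d20 H2] := cw _ (Omega_sub O2) _ e8.
have dx0 : 0 < x2 - x1 by rewrite subr_gt0.
have [|h h0] := @lt_all R [:: d1; d2; x2 - x1; pi - x2].
  by rewrite /= d10 d20 dx0 subr_gt0 x2p.
rewrite /= andbT => /and4P[hd1 hd2 hx hp].
have [hx' hp'] : x1 + h < x2 /\ x2 + h < pi by clear -hx hp; split; lra.
have [a [r1 [r2 [ta da a01 as_ [[tr1 tr2] [r10 r1s] [r20 r2s] [mr1 mr2]]]]]] :=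
  @plateau_exists R 0 pi x1 x2 h x10 h0 hx' hp'.
have near (xi : R) (q : R -> R) (d : R) : 0 < xi -> xi < pi ->
    (forall w, clOmega l w -> `|(xi, 0 : R).1 - w.1| < d -> `|(xi, 0 : R).2 - w.2| < d ->
      `|u (xi, 0) - u w| < e / 8) -> h < d -> 0 < d ->
    test1 0 pi q -> (forall x, 0 <= q x) -> prim 0 q pi = 1 ->
    (forall x, ~ (xi < x < xi + h) -> q x = 0) ->
    `|I (fun z => u z * tens q b z) - u (xi, 0)| <= e / 4.
  move=> xi0 xip H hd d0 tq q0 mq qs.
  apply: (@tens_approx R l _ _ _ _ _ xi (xi + h) 0 r) => // z [/andP[z10 z1p] z2l] /andP[z1 z2] /andP[z3 z4].
  have h1 : `|u (xi, 0) - u (z.1, 0)| < e / 8.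
    apply: H => /=.
    - by apply: Omega_sub; split; apply/andP.
    - by clear -z1 z2 hd; rewrite ltr_norml; apply/andP; split; lra.
    - by rewrite subrr normr0.
  have h2 : `|u (z.1, z.2) - u (z.1, 0)| <= e / 8.
    have zz : 0 < z.1 < pi by rewrite z10.
    have ll : - l < 0 < l by rewrite l0'.
    have := y_modulus K0 Hr Kxy zz ll z2l.
    move=> /le_trans; apply; apply: le_trans HrS.
    rewrite /S mulrAC ler_wpM2l// ler_wsqrtr// subr0 gtr0_norm//.
    exact: ltW.
  move: h1 h2; rewrite -surjective_pairing; clear.
  rewrite ltr_norml !ler_norml => /andP[? ?] /andP[? ?]; apply/andP; split; lra.
have N1 := near x1 r1 d1 x10 x1p H1 hd1 d10 tr1 r10 mr1 r1s.
have N2 := near x2 r2 d2 x20 x2p H2 hd2 d20 tr2 r20 mr2 r2s.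
have i_ q : test1 0 pi q -> int (fun z => u z * tens q b z).
  by move=> tq; apply: int_mul_span => //; exact: test_span_tens.
have E : - I (fun z => ux z * tens a b z) =
    I (fun z => u z * tens r1 b z) - I (fun z => u z * tens r2 b z).
  rewrite -wx// -(intRB mO (i_ _ tr1) (i_ _ tr2)).
  by apply: eq_intR => z _; rewrite /tens da; ring.
have F : `|- I (fun z => ux z * tens a b z)| <= e / 2.
  rewrite normrN.
  pose t := Num.sqrt (x2 - x1).
  have t0 : 0 < t by rewrite sqrtr_gt0.
  have tE : t ^+ 2 = x2 - x1 by rewrite sqr_sqrtr// ltW.
  have x12h : x1 <= x2 + h by clear -x12 h0; lra.
  have := @tens_pairing_le R l ux a b x1 (x2 + h) 0 r B t l2ux ta tb x12h (ltW r0) t0 _ as_ bs_.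
  move=> /(_ _)/le_trans; apply.
    move=> z; have /andP[a0 a1] := a01 z.1.
    rewrite /tens normrM -[B]mul1r ler_pM// ger0_norm//.
  have tQ : t * Q < e.
    rewrite -ltr_pdivlMr// /t -[X in _ < X]ger0_norm ?divr_ge0 ?ltW// -sqrtr_sqr.
    by rewrite ltr_sqrt// exprn_gt0// divr_gt0.
  have c0 : 0 <= B ^+ 2 * r by rewrite mulr_ge0 ?sqr_ge0// ltW.
  have h1 : B ^+ 2 * ((x2 + h - x1) * (r - 0)) / t <= t * (2 * (B ^+ 2 * r)).
    rewrite ler_pdivrMr// subr0.
    rewrite (_ : t * (2 * (B ^+ 2 * r)) * t = t ^+ 2 * (2 * (B ^+ 2 * r))); last by ring.
    rewrite tE.
    have -> : B ^+ 2 * ((x2 + h - x1) * r) = (x2 + h - x1) * (B ^+ 2 * r) by ring.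
    rewrite [_ * (2 * _)]mulrA ler_wpM2r//; clear -hx; lra.
  have h2 : t * I (fun z => ux z ^+ 2) <= t * `|Cx|.
    by apply: (ler_wpM2l (ltW t0)); apply: le_trans Bux _; exact: ler_norm.
  have h3 : t * Q = t * `|Cx| + t * (2 * (B ^+ 2 * r)) + t.
    by rewrite /Q !mulrDr mulr1.
  rewrite ler_pdivrMr// divfK//; apply: ltW; apply: le_lt_trans tQ; rewrite h3.
  apply: le_trans (lerD h2 h1) _; rewrite lerDl; exact: ltW.
move: N1 N2 F; rewrite E; clear.
move: (I _) (I _) => a11 a12.
rewrite !ler_norml => /andP[? ?] /andP[? ?] /andP[? ?].
by apply/andP; split; lra.
Qed.

End Equicontinuity.

(** * Uniform estimates up to the boundary *)

Section Bounds.
Variables (R : realType) (l : R).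
Local Notation P2 := (measurableTypeR R * measurableTypeR R)%type.
Local Notation Om := (Omega l : set P2).
Local Notation pi := (@pi R).
Local Notation mu := (@mu2 R).
Local Notation int := (int1 mu Om).
Local Notation I := (intR mu Om).
Let mO := Omega_measurable l.
Let fO := mu2_Omega_fin l.
Hypothesis l0 : 0 < l.
Let p0 := @pi_gt0 R.

(** The line y = 0 serves as reference: u(x, y) - u(x', y') is the mixed difference over the
    rectangle between that line and height y, plus u(x, 0) - u(x', 0), plus u(x', y) - u(x', y'). *)
Lemma interior_modulus (M K e : R) : 0 <= K -> 0 < e -> exists2 d : R, 0 < d &
  forall u ux uy uxx uxy, regular l u ux uy uxx uxy ->
    (forall z, Om z -> `|u z| <= M) ->
    I (fun z => uxx z ^+ 2) <= K -> I (fun z => uxy z ^+ 2) <= K ->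
    forall z w, Om z -> Om w -> `|z.1 - w.1| < d -> `|z.2 - w.2| < d -> `|u z - u w| <= e.
Proof.
move=> K0 e0; have e3 : 0 < e / 3 by rewrite divr_gt0.
have [d1 d10 Hx] := x_modulus0 l0 M K0 e3.
pose S := (K + 1) / 2.
have S0 : 0 <= S by rewrite divr_ge0// addr_ge0.
pose Q := (Num.sqrt l + Num.sqrt pi) * S + 1.
have Q0 : 0 < Q by rewrite ltr_wpDl// mulr_ge0// addr_ge0 ?sqrtr_ge0.
have [|d d0] := @lt_all R [:: d1; (e / 3 / Q) ^+ 2].
  by rewrite /= d10 exprn_gt0// divr_gt0.
rewrite /= andbT => /andP[dd1 dQ].
have sd (h : R) : `|h| < d -> (Num.sqrt l + Num.sqrt pi) * (Num.sqrt `|h| * S) <= e / 3.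
  move=> hd.
  have : Num.sqrt `|h| <= e / 3 / Q.
    rewrite -[X in _ <= X]ger0_norm; last by apply: ltW; rewrite !divr_gt0.
    by rewrite -[`|e / 3 / Q|]sqrtr_sqr ler_wsqrtr// ltW// (lt_trans hd).
  rewrite ler_pdivlMr// => /(le_trans _); apply.
  by rewrite mulrCA; apply: ler_wpM2l; rewrite ?sqrtr_ge0// lerDl.
exists d => //.
move=> u ux uy uxx uxy Hr uM Kxx Kxy [x y] [x' y'] [/= z1 z2] [/= w1 w2] hx hy.
have ll : - l < 0 < l by rewrite oppr_lt0 l0.
have B1 := mixed_diff K0 Hr Kxy w1 z1 ll z2.
have B2 := y_modulus K0 Hr Kxy w1 w2 z2.
have B3 : `|u (x, 0) - u (x', 0)| <= e / 3.
  have H := Hx _ _ _ _ _ Hr uM Kxx Kxy.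
  move: z1 w1 => /andP[z1 z1p] /andP[w1 w1p].
  have [xx|xx|->] := ltgtP x x'; last by rewrite subrr normr0 ltW.
    rewrite distrC; apply: H => //.
    by move: hx; rewrite distrC gtr0_norm ?subr_gt0// => /lt_trans; apply.
  apply: H => //.
  by move: hx; rewrite gtr0_norm ?subr_gt0// => /lt_trans; apply.
have sx := sd _ hx; have sy := sd _ hy.
have h1 : Num.sqrt `|x - x'| * Num.sqrt `|y - 0| * S <= e / 3.
  apply: le_trans sx; rewrite mulrAC [X in _ <= X]mulrC; apply: ler_wpM2l.
    by rewrite mulr_ge0 ?sqrtr_ge0.
  apply: (@le_trans _ _ (Num.sqrt l)); last by rewrite lerDl sqrtr_ge0.
  rewrite ler_wsqrtr// subr0 ler_norml; move: z2 => /andP[? ?].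
  by apply/andP; split; lra.
have h2 : Num.sqrt pi * Num.sqrt `|y - y'| * S <= e / 3.
  apply: le_trans sy; rewrite -mulrA; apply: ler_wpM2r.
    by rewrite mulr_ge0 ?sqrtr_ge0.
  by rewrite lerDr sqrtr_ge0.
move: (le_trans B1 h1) (le_trans B2 h2) B3; clear.
rewrite !ler_norml => /andP[? ?] /andP[? ?] /andP[? ?].
by apply/andP; split; lra.
Qed.

(** The homothety [sh t] towards the centre (pi / 2, 0) maps the closure into [Omega] and does not
    increase coordinate distances, so the same [d] serves; continuity of [u] lets t tend to 0. *)
Lemma closure_modulus (u : R * R -> R) (d e : R) : {within clOmega l, continuous u} ->
  (forall z w, Om z -> Om w -> `|z.1 - w.1| < d -> `|z.2 - w.2| < d -> `|u z - u w| <= e) ->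
  forall z w, clOmega l z -> clOmega l w -> `|z.1 - w.1| < d -> `|z.2 - w.2| < d ->
  `|u z - u w| <= e.
Proof.
move=> /within_continuousP2 cu H z w Cz Cw hx hy.
pose sh (t : R) (z : R * R) : R * R := (z.1 + t * (pi / 2 - z.1), z.2 - t * z.2).
have shO t z' : 0 < t -> t < 1 -> clOmega l z' -> Om (sh t z').
  move=> t0 t1 [/andP[a1 a2] /andP[b1 b2]]; split => /=; apply/andP; split.
  - have -> : z'.1 + t * (pi / 2 - z'.1) = (1 - t) * z'.1 + t * (pi / 2) by ring.
    by rewrite ltr_wpDl ?mulr_ge0 ?mulr_gt0 ?divr_gt0// subr_ge0 ltW.
  - rewrite -subr_gt0.
    have -> : pi - (z'.1 + t * (pi / 2 - z'.1)) = (1 - t) * (pi - z'.1) + t * (pi / 2) by field.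
    by rewrite ltr_wpDl ?mulr_ge0 ?mulr_gt0 ?divr_gt0 ?subr_ge0// ltW.
  - rewrite -subr_gt0.
    have -> : z'.2 - t * z'.2 - - l = (1 - t) * (z'.2 + l) + t * l by ring.
    have h1 : 0 <= z'.2 + l by rewrite -lerBlDr sub0r.
    by rewrite ltr_wpDl ?mulr_ge0 ?mulr_gt0 ?subr_ge0// ltW.
  - rewrite -subr_gt0.
    have -> : l - (z'.2 - t * z'.2) = (1 - t) * (l - z'.2) + t * l by ring.
    by rewrite ltr_wpDl ?mulr_ge0 ?mulr_gt0 ?subr_ge0// ltW.
apply/ler_addgt0Pr => n n0; have n2 : 0 < n / 2 by rewrite divr_gt0.
have [d1 d10 H1] := cu _ Cz _ n2; have [d2 d20 H2] := cu _ Cw _ n2.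
have q0 : 0 < pi + l by rewrite addr_gt0.
have [|t t0] := @lt_all R [:: 1; d1 / (pi + l); d2 / (pi + l)].
  by rewrite /= ltr01 !divr_gt0.
rewrite /= andbT => /and3P[t1]; rewrite !ltr_pdivlMr// => td1 td2.
have shd z' d' : clOmega l z' -> t * (pi + l) < d' ->
    `|z'.1 - (sh t z').1| < d' /\ `|z'.2 - (sh t z').2| < d'.
  move=> [/andP[a1 a2] /andP[b1 b2]] td.
  split; rewrite /=; apply: le_lt_trans td.
    have -> : z'.1 - (z'.1 + t * (pi / 2 - z'.1)) = t * (z'.1 - pi / 2) by ring.
    rewrite normrM gtr0_norm//; apply: (ler_wpM2l (ltW t0)); rewrite ler_norml; 
      have ll := l0; clear -a1 a2 ll; have := @pi_gt0 R.
    by move: a1 a2; move: (z'.1) (pi) => x p ? ? ?; apply/andP; split; lra.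
  have -> : z'.2 - (z'.2 - t * z'.2) = t * z'.2 by ring.
  rewrite normrM gtr0_norm//; apply: (ler_wpM2l (ltW t0)); rewrite ler_norml; 
    have ll := l0; clear -b1 b2 ll; have := @pi_gt0 R.
  by move: b1 b2; move: (z'.2) (pi) => x p ? ? ?; apply/andP; split; lra.
have [a1 a2] := shd _ _ Cz td1; have [b1 b2] := shd _ _ Cw td2.
have Oz := shO t _ t0 t1 Cz; have Ow := shO t _ t0 t1 Cw.
have F1 := H1 _ (Omega_sub Oz) a1 a2.
have F2 := H2 _ (Omega_sub Ow) b1 b2.
have lt1 h : `|h - t * h| <= `|h|.
  have -> : h - t * h = (1 - t) * h by ring.
  by rewrite normrM ler_piMl// ger0_norm; rewrite ?gerBl ?subr_ge0 ltW.
have F3 : `|u (sh t z) - u (sh t w)| <= e.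
  apply: H => //=.
    have -> : z.1 + t * (pi / 2 - z.1) - (w.1 + t * (pi / 2 - w.1)) =
      (z.1 - w.1) - t * (z.1 - w.1) by ring.
    exact: le_lt_trans (lt1 _) hx.
  have -> : z.2 - t * z.2 - (w.2 - t * w.2) = (z.2 - w.2) - t * (z.2 - w.2) by ring.
  exact: le_lt_trans (lt1 _) hy.
move: F1 F2 F3; clear; rewrite !ltr_norml !ler_norml.
move=> /andP[? ?] /andP[? ?] /andP[? ?].
by apply/andP; split; lra.
Qed.

Lemma equicontinuity (M K e : R) : 0 <= K -> 0 < e -> exists2 d : R, 0 < d &
  forall u ux uy uxx uxy, regular l u ux uy uxx uxy ->
    (forall z, Om z -> `|u z| <= M) ->
    I (fun z => uxx z ^+ 2) <= K -> I (fun z => uxy z ^+ 2) <= K ->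
    forall z w, clOmega l z -> clOmega l w ->
    `|z.1 - w.1| < d -> `|z.2 - w.2| < d -> `|u z - u w| <= e.
Proof.
move=> K0 e0; have [d d0 H] := interior_modulus M K0 e0; exists d => //.
move=> u ux uy uxx uxy Hr uM Kxx Kxy; have [_ [_ [cu _]]] := Hr.
apply: closure_modulus => //; exact: H Hr uM Kxx Kxy.
Qed.

(** The derivative [uy] has weak x-derivative [uxy]. A bump in [x] close to 0 meets only small
    values of [u], by equicontinuity and the boundary condition, so [vC] holds with C = 0; the
    constant is that of [slice_bound_sq]. *)
Lemma uy_bound (M K : R) : 0 <= K -> exists B : R, forall u ux uy uxx uxy : R * R -> R,
  regular l u ux uy uxx uxy -> (forall z, Om z -> `|u z| <= M) ->
  I (fun z => uxx z ^+ 2) <= K -> I (fun z => uxy z ^+ 2) <= K ->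
  I (fun z => uy z ^+ 2) <= B.
Proof.
move=> K0; exists (pi ^+ 2 * (8 * K)) => u ux uy uxx uxy Hr uM Kxx Kxy.
have [[l2u l2ux l2uy l2uxx l2uxy] [[wx wy wxx wxy] [cu bc]]] := Hr.
have iu := sql2_int1' mO fO l2u; have iuy := sql2_int1' mO fO l2uy.
have iuxy := sql2_int1' mO fO l2uxy.
have vg a b : test1 0 pi a -> test1 (- l) l b ->
    I (fun z => uy z * tens (derive1 a) b z) = - I (fun z => uxy z * tens a b z).
  by move=> ta tb; rewrite -wxy// wy ?opprK//; exact: test1_derive.
have vC b e : test1 (- l) l b -> 0 < e ->
  exists eta, [/\ test1 0 pi eta, forall x, 0 <= eta x, prim 0 eta pi = 1 &
   `|I (fun z => uy z * tens eta b z)| <= 0 * I (fun z => `|b z.2|) + e].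
  move=> tb e0; have tb' := test1_derive tb.
  have [B HB] := test1_bounded tb'.
  have B0 : 0 <= B by apply: le_trans (HB 0).
  have Q0 : 0 < B * (2 * l) + 1 by rewrite ltr_wpDl// !mulr_ge0// ltW.
  (* [c] will bound |u| on the support of the bump; since [B] bounds b' and 2 l is the integral of
     [eta] over [Omega], the pairing is at most c B 2 l. *)
  have [c c0 cE] : exists2 c : R, 0 < c & e = c * B * (2 * l) + c.
    exists (e / (B * (2 * l) + 1)); first by rewrite divr_gt0.
    by field; rewrite gt_eqF.
  have [d d0 Hd] := equicontinuity M K0 c0.
  have [|h h0] := @lt_all R [:: d; pi]; first by rewrite /= d0 p0.
  rewrite /= andbT => /andP[hd hp].
  have h20 : 0 < h / 2 by rewrite divr_gt0.
  have h2h : h / 2 < h by rewrite ltr_pdivrMr// ltr_pMr// ltr1n.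
  have [eta [te eta0 es m1]] := @bump_exists R 0 pi (h / 2) h h20 h2h hp.
  exists eta; split => //.
  rewrite mul0r add0r -normrN -wy//.
  pose q := tens (fun x => eta x) (fun=> 1 : R).
  have iq : int q.
    apply: tens_int; first exact: smooth_continuous (test1_smooth te).
    - by move=> x; exact: cvg_cst.
    - exact: test1_bounded te.
    - by exists 1 => x; rewrite normr1.
  have Iq : I q = 2 * l.
    rewrite intR_tens//; last 2 first.
    - exact: smooth_continuous (test1_smooth te).
    - by move=> x; exact: cvg_cst.
    rewrite m1 mul1r /prim Rintegral_cst// mul1r.
    have ll : - l < l by apply: lt_trans l0; rewrite oppr_lt0.
    apply: (etrans (congr1 fine (lebesgue_measure_itv `[- l, l]))).
    by rewrite /= lte_fin ll /=; ring.
  apply: (@le_trans _ _ (c * B * (2 * l))); last by rewrite cE lerDl ltW.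
  rewrite -Iq -(intRZ mO _ iq); apply: norm_intR_le => //.
  - by apply: int_mul_span => //; exact: test_span_tens.
  - exact: int1Z.
  - move=> z Oz; rewrite /q /tens mulr1 normrM normrM (ger0_norm (eta0 _)).
    have [H|H] := pselect (h / 2 < z.1 < h); last by rewrite es// mul0r !mulr0.
    have u_le : `|u z| <= c.
      have [/andP[z1 z1p] z2] := Oz.
      rewrite -[u z]subr0 -(bc z.2 z2).
      apply: (Hd u ux uy uxx uxy) => //=; first exact: Omega_sub.
      - by move: z2 => /andP[? ?]; split => /=; rewrite ?lexx ?(ltW p0)// !ltW.
      - by rewrite subr0 gtr0_norm//; move: H => /andP[_ /lt_trans]; apply.
      - by rewrite subrr normr0.
    rewrite [eta _ * _]mulrC mulrA ler_wpM2r// ler_pM//.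
have := slice_bound_sq iuy iuxy vg (lexx 0) l2uxy vC l2uy.
move=> /le_trans; apply; rewrite ler_wpM2l ?sqr_ge0// expr0n/= intR0// mulr0 addr0.
by rewrite ler_wpM2l.
Qed.

End Bounds.

(** * Limits of bounded reals along an ultrafilter *)

Lemma fmap_ultra (J T : Type) (f : J -> T) (U : set_system J) :
  UltraFilter U -> UltraFilter (fmap f U).
Proof.
move=> UU; apply: Build_UltraFilter => // G PG sub.
apply/seteqP; split => // B GB.
have [//|UB] := in_ultra_setVsetC (f @^-1` B) UU.
have GC : G (~` B) by apply: sub.
have GBC : G (B `&` ~` B) by apply: filterI.
by have [x []] := filter_ex GBC.
Qed.

Lemma ultra_bounded_cvg (R : realType) (J : Type) (U : set_system J)
  (a : J -> R) (M : R) : UltraFilter U -> (forall i, `|a i| <= M) ->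
  exists2 x : R, a @ U --> x & `|x| <= M.
Proof.
move=> UU aM; have := @segment_compact R (- M) M.
rewrite compact_ultra => /(_ _ (fmap_ultra a UU)).
case.
  by apply: (@filterE _ U _ (a @^-1` `[- M, M])) => i; rewrite /= in_itv/= -ler_norml.
by move=> x [/=]; rewrite in_itv/= -ler_norml => xM ax; exists x.
Qed.

Lemma norm_sub_lt (R : realType) (a b c d p q e : R) : `|a - c| <= p -> `|b - d| <= q ->
  `|c - d| < e / 2 -> p + q < e / 2 -> `|a - b| < e.
Proof.
rewrite !ltr_norml !ler_norml => /andP[h1 h2] /andP[h3 h4] /andP[h6 h7] h5.
apply/andP; split; lra.
Qed.

(** * Weak compactness along an ultrafilter *)

Section UltraLimits.
Variables (R : realType) (J : Type) (U : set_system J).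
Hypothesis UU : UltraFilter U.

Lemma ultra_unique (a : J -> R) (x y : R) : a @ U --> x -> a @ U --> y -> x = y.
Proof.
have PF : ProperFilter (a @ U) by apply: fmap_proper_filter.
exact: (@cvg_unique _ (@norm_hausdorff R R) (a @ U) PF).
Qed.

Lemma ultraD (a b : J -> R) (x y : R) : a @ U --> x -> b @ U --> y ->
  (fun i => a i + b i) @ U --> x + y.
Proof. by move=> ha hb; exact: (cvgD ha hb). Qed.

Lemma ultraZ (k : R) (a : J -> R) (x : R) : a @ U --> x ->
  (fun i => k * a i) @ U --> k * x.
Proof. by move=> ha; exact: (cvgMr ha). Qed.

Lemma ultra_near (a : J -> R) (x e : R) : a @ U --> x -> 0 < e ->
  U [set i | `|x - a i| < e].
Proof. by move=> /cvgrPdist_lt H /H. Qed.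

Lemma ultra_ex (A : set J) : U A -> exists i, A i.
Proof. exact: filter_ex. Qed.

Lemma ultra_le (a b : J -> R) (x y : R) : a @ U --> x -> b @ U --> y ->
  (forall i, a i <= b i) -> x <= y.
Proof.
move=> ha hb ab; apply/ler_addgt0Pr => e e0; have e2 : 0 < e / 2 by rewrite divr_gt0.
have [i [/= h1 h2]] := ultra_ex (filterI (ultra_near ha e2) (ultra_near hb e2)).
have := ab i; move: h1 h2; rewrite !ltr_norml => /andP[_ h1] /andP[h2 _] h3.
move: (a i) (b i) h1 h2 h3 => p q h1 h2 h3; clear -h1 h2 h3; lra.
Qed.

End UltraLimits.

Section WeakCompactness.
Context d (T : measurableType d) (R : realType)
  (mu : {sigma_finite_measure set T -> \bar R}).
Variables (E : set T) (mE : measurable E).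
Hypothesis fE : (mu E < +oo)%E.
Local Notation int := (int1 mu E).
Local Notation I := (intR mu E).
Variables (J : Type) (U : set_system J).
Hypothesis UU : UltraFilter U.
Variable f_ : J -> T -> R.
Hypothesis if_ : forall i, int (f_ i).
(** Uniform integrability, stated as domination by a constant plus a remainder of small integral. A
    multiple of f^2 or of |f|^p is the remainder for finite exponents, the positive part of |f| - 1
    for the exponent +oo. *)
Hypothesis ui : forall e : R, 0 < e -> exists2 t : R, 0 <= t &
  forall i, exists r, [/\ int r, I r <= e, forall z, E z -> 0 <= r z &
    forall z, E z -> `|f_ i z| <= t + r z].

Let ind_int A : measurable A -> int (\1_A).
Proof.
move=> mA; apply: (int1_bounded mE (M := 1)) => //.
by move=> z _; rewrite indicE; case: (_ \in _); rewrite ?normr1 ?normr0.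
Qed.

Let ui_set (e : R) : 0 < e -> exists2 t : R, 0 <= t & forall i A, measurable A ->
  `|I (fun z => f_ i z * \1_A z)| <= t * I (\1_A) + e.
Proof.
move=> /ui[t t0 H]; exists t => // i A mA.
have [r [ir re r0 fr]] := H i.
apply: le_trans (_ : I (fun z => t * \1_A z + r z) <= _).
  apply: norm_intR_le => //; [exact: int1_indic|by apply: int1D => //; apply: int1Z => //; exact: ind_int|].
  move=> z Ez; have := fr _ Ez; have := r0 _ Ez; rewrite indicE.
  by case: (_ \in _); rewrite /= ?mulr1 ?mulr0 ?normr0 ?add0r.
by rewrite intRD ?(intRZ mE)//; [rewrite lerD2l|exact: ind_int|apply: int1Z => //; exact: ind_int].
Qed.

Let bnd : exists C, forall i, I (fun z => `|f_ i z|) <= C.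
Proof.
have [t t0 H] := ui ltr01; exists (t * I (fun=> 1) + 1) => i.
have [r [ir re r0 fr]] := H i.
have i1 : int (fun=> 1) by apply: (int1_bounded mE (M := 1)) => // z _; rewrite normr1.
apply: le_trans (_ : I (fun z => t * 1 + r z) <= _).
  apply: le_intR => //; [exact: int1_norm|by apply: int1D => //; apply: int1Z|].
  by move=> z Ez; rewrite mulr1; exact: fr.
by rewrite intRD ?(intRZ mE)//; [rewrite lerD2l|apply: int1Z].
Qed.

Let ex_lim A : exists x : R, measurable A -> (fun i => I (fun z => f_ i z * \1_A z)) @ U --> x.
Proof.
have [mA|] := pselect (measurable A); last by exists 0.
have [C HC] := bnd.
have [i|x Hx _] := @ultra_bounded_cvg R J U (fun i => I (fun z => f_ i z * \1_A z)) C UU.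
  apply: le_trans (HC i); apply: norm_intR_le => //.
  - exact: int1_indic.
  - exact: int1_norm.
  - move=> z _; rewrite indicE; case: (_ \in _); rewrite ?mulr1// mulr0 normr0//.
by exists x.
Qed.

(** Choice picks the limit of the integrals over [A]; on non-measurable sets the value is
    arbitrary. *)
Definition lim_charge (A : set T) : \bar R := (projT1 (cid (ex_lim A)))%:E.
Let nu A := projT1 (cid (ex_lim A)).

Let nuP A : measurable A -> (fun i => I (fun z => f_ i z * \1_A z)) @ U --> nu A.
Proof. exact: (projT2 (cid (ex_lim A))). Qed.

Let nuU A B : measurable A -> measurable B -> A `&` B = set0 -> nu (A `|` B) = nu A + nu B.
Proof.
move=> mA mB AB.
have H := nuP (measurableU _ _ mA mB).
have H' := ultraD UU (nuP mA) (nuP mB).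
have e : (fun i => I (fun z => f_ i z * \1_(A `|` B) z)) =
  (fun i => I (fun z => f_ i z * \1_A z) + I (fun z => f_ i z * \1_B z)).
  apply/funext => i /=; rewrite -intRD//; [|exact: int1_indic..].
  apply: eq_intR => z _; rewrite -mulrDr; congr (_ * _).
  rewrite !indicE in_setU; case: (boolP (z \in A)) => [/set_mem zA|_] /=.
    rewrite memNset ?addr0// => zB; have : (A `&` B) z by [].
    by rewrite AB.
  by rewrite add0r.
rewrite e in H; exact: (ultra_unique UU H H').
Qed.

Let nu0 : nu set0 = 0.
Proof.
have := nuU measurable0 measurable0 (setI0 _); rewrite setU0 => /eqP.
by rewrite -subr_eq0 opprD addrA subrr sub0r oppr_eq0 => /eqP.
Qed.

Let nu_le (e : R) : 0 < e -> exists2 t : R, 0 <= t & forall A, measurable A ->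
  `|nu A| <= t * I (\1_A) + e.
Proof.
move=> /ui_set[t t0 H]; exists t => // A mA.
apply/ler_addgt0Pr => h h0.
have [i /= Hi] := ultra_ex UU (ultra_near UU (nuP mA) h0).
have := H i A mA => Hi'.
rewrite -[nu A](subrK (I (fun z => f_ i z * \1_A z))) addrC.
apply: le_trans (ler_normD _ _) _; apply: lerD => //; exact: ltW.
Qed.

(** Finite additivity survives the limit. Countable additivity follows from the uniform absolute
    continuity [nu_le]: the remainders [D n] decrease and their measure in [E] tends to 0. *)
Let nu_sigma : semi_sigma_additive lim_charge.
Proof.
move=> F mF tF mUF.
pose G n := \bigcup_(i < n) F i.
have mG n : measurable (G n) by apply: bigcup_measurable.
have nuG n : (\sum_(0 <= i < n) lim_charge (F i))%E = (nu (G n))%:E.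
  elim: n => [|n IH].
    by rewrite big_nil /G bigcup_mkord big_ord0 nu0.
  rewrite big_nat_recr//= IH /lim_charge -/(nu (F n)) -EFinD; congr (_%:E).
  rewrite -nuU//.
    congr nu; apply/seteqP; split => z.
      by move=> [[i /= ni Fi]|Fn]; [exists i => //=; exact: ltnW|exists n => /=].
    move=> [i /=]; rewrite ltnS leq_eqVlt => /predU1P[->|ni] Fi; first by right.
    by left; exists i.
  apply/seteqP; split => // z [[i /= ni Fi] Fn].
  have e : i = n by apply: (tF i n) => //; exists z.
  by move: ni; rewrite e ltnn.
rewrite (_ : (fun n => _) = (fun n => (nu (G n))%:E)); last by apply/funext.
apply: cvg_EFin; first exact: nearW.
apply/cvgrPdist_le => e e0; have e2 : 0 < e / 2 by rewrite divr_gt0.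
have [t t0 Ht] := nu_le e2.
have i1 : int (fun=> 1) by apply: (int1_bounded mE (M := 1)) => // z _; rewrite normr1.
have t1 : 0 < t + 1 by rewrite ltr_wpDl.
have e3 : 0 < e / 2 / (t + 1) by rewrite divr_gt0.
pose D n := (\bigcup_k F k) `\` G n.
have mD n : measurable (D n) by exact: measurableD.
have [|||N HN] := @dominated_small _ _ _ mu E mE (fun n => \1_(D n)) (fun=> 1) _ i1 e3.
- by move=> n; apply: int1_meas; exact: ind_int.
- by move=> n z _; rewrite indicE; case: (_ \in _); rewrite ?normr1 ?normr0.
- move=> z _; apply/cvgrPdist_le => h h0.
  have [[i _ Fi]|Nz] := pselect ((\bigcup_k F k) z).
    exists i.+1 => // n /= ni; rewrite indicE memNset ?subrr ?normr0 ?ltW//.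
    by move=> [_]; apply; exists i.
  exists 0%N => // n _; rewrite indicE memNset ?subrr ?normr0 ?ltW//.
  by move=> [].
exists N => // n /= Nn.
rewrite -[sval _]/(nu (\bigcup_k F k)).
have -> : nu (\bigcup_k F k) = nu (G n) + nu (D n).
  rewrite -nuU//; last by rewrite setDIK.
  congr nu; rewrite setDUK// => z [i _ Fi]; by exists i.
rewrite addrAC subrr add0r; apply: le_trans (Ht _ (mD n)) _.
rewrite -lerBrDr; have -> : e - e / 2 = e / 2 by field.
apply: le_trans (_ : (t + 1) * I (\1_(D N)) <= _); last first.
  by rewrite mulrC -ler_pdivlMr.
apply: ler_pM => //.
- by apply: intR_ge0 => z _; rewrite indicE ler0n.
- by rewrite lerDl.
- apply: le_intR => //; [exact: ind_int..|move=> z _].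
  rewrite !indicE; case: (boolP (z \in D n)) => [/set_mem [Fz Gz]|_]; last by rewrite ler0n.
  rewrite mem_set//; split => // -[i /= iN Fi]; apply: Gz; exists i => //=.
  exact: leq_trans iN Nn.
Qed.

Let lim_charge0 : lim_charge set0 = 0%E. Proof. by rewrite -[LHS]/((nu set0)%:E) nu0. Qed.

Let lim_charge_fin A : measurable A -> lim_charge A \is a fin_num. Proof. by []. Qed.

HB.instance Definition _ :=
  isCharge.Build _ _ _ lim_charge lim_charge0 lim_charge_fin nu_sigma.

Let nu_dom : lim_charge `<< mu.
Proof.
apply/null_content_dominatesP => A mA A0; congr EFin.
apply: (ultra_unique UU (nuP mA)).
rewrite (_ : (fun i => _) = (fun=> 0)); first exact: cvg_cst.
apply/funext => i; rewrite -(@intR0 _ _ _ mu E)//.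
apply: ae_eq_intR => //; first by apply: int1_meas; exact: int1_indic.
exists A; split => // z; rewrite /= => H.
apply/not_notP => nA; apply: H => _; by rewrite indicE memNset// mulr0.
Qed.

Let lim_fun (z : T) : R := fine ((Radon_Nikodym lim_charge mu) z).

Let lim_funE z : (lim_fun z)%:E = (Radon_Nikodym lim_charge mu) z.
Proof. by rewrite /lim_fun fineK//; exact: Radon_Nikodym_fin_num. Qed.

Let int_lim_fun : int lim_fun.
Proof.
apply: (@eq_integrable _ _ _ mu E mE (Radon_Nikodym lim_charge mu)).
  by move=> z _ /=; rewrite lim_funE.
apply: (integrableS measurableT) => //; exact: Radon_Nikodym_integrable.
Qed.

Let lim_funP A : measurable A ->
  (fun i => I (fun z => f_ i z * \1_A z)) @ U --> I (fun z => lim_fun z * \1_A z).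
Proof.
move=> mA; have mAE := measurableI _ _ mE mA.
(* The Radon-Nikodym derivative is integrated over the set itself, so [A] is first cut down to
   [E]. *)
have -> : (fun i => I (fun z => f_ i z * \1_A z)) = (fun i => I (fun z => f_ i z * \1_(E `&` A) z)).
  apply/funext => i; apply: eq_intR => z Ez; congr (_ * _); rewrite !indicE in_setI.
  by rewrite (mem_set Ez).
have -> : I (fun z => lim_fun z * \1_A z) = nu (E `&` A); last exact: nuP.
apply: EFin_inj; rewrite EFin_intR//; last exact: int1_indic.
rewrite -[RHS]/(lim_charge (E `&` A)) (Radon_Nikodym_integral nu_dom mAE).
rewrite integral_mkcondr; apply: eq_integral => z _.
rewrite /patch indicE; case: ifP => _; last by rewrite mulr0.
by rewrite mulr1 lim_funE.
Qed.

(** Bounded test functions along which convergence is already known: a vector space that contains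
    the indicators, hence all step functions. *)
Let good (g : T -> R) := [/\ measurable_fun E g, exists M : R, forall z, E z -> `|g z| <= M &
  (fun i => I (fun z => f_ i z * g z)) @ U --> I (fun z => lim_fun z * g z)].

Let goodM g h : good g -> int h -> int (fun z => h z * g z).
Proof. by move=> [mg [M gM] _] ih; exact: int1Mb ih mg gM. Qed.

Let good_ind A : measurable A -> good (\1_A).
Proof.
move=> mA; split; [by apply: int1_meas; exact: ind_int| |exact: lim_funP].
by exists 1 => z _; rewrite indicE; case: (_ \in _); rewrite ?normr1 ?normr0.
Qed.

Let goodD g h : good g -> good h -> good (fun z => g z + h z).
Proof.
move=> Gg Gh; have [mg [M gM] cg] := Gg; have [mh [N hN] ch] := Gh.
split; first exact: measurable_funD.
  exists (M + N) => z Ez; apply: le_trans (ler_normD _ _) _.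
  by apply: lerD; [exact: gM|exact: hN].
have H F : int F -> I (fun z => F z * (g z + h z)) = I (fun z => F z * g z) + I (fun z => F z * h z).
  move=> iF; rewrite -intRD//; [|exact: goodM..].
  by apply: eq_intR => z _; rewrite mulrDr.
rewrite H// (_ : (fun i => _) = (fun i => I (fun z => f_ i z * g z) + I (fun z => f_ i z * h z))).
  exact: ultraD.
by apply/funext => i; exact: H.
Qed.

Let goodZ k g : good g -> good (fun z => k * g z).
Proof.
move=> Gg; have [mg [M gM] cg] := Gg.
split; first exact: measurable_funM.
  exists (`|k| * M) => z Ez; rewrite normrM; apply: ler_wpM2l => //; exact: gM.
have H F : int F -> I (fun z => F z * (k * g z)) = k * I (fun z => F z * g z).
  move=> iF; rewrite -intRZ//; last exact: goodM.
  by apply: eq_intR => z _; rewrite mulrCA.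
rewrite H// (_ : (fun i => _) = (fun i => k * I (fun z => f_ i z * g z))).
  exact: ultraZ.
by apply/funext => i; exact: H.
Qed.

(** A layer of height [dl] is removed where g >= dl, and the positive part of g - dl has one layer
    less. Non-negativity of [s] is part of the conclusion because it forces s = 0 where that
    positive part vanishes. *)
Let step_approx (dl : R) : 0 < dl -> forall (N : nat) (g : T -> R),
  measurable_fun E g -> (forall z, E z -> 0 <= g z <= N%:R * dl) ->
  exists s, [/\ good s, forall z, 0 <= s z & forall z, E z -> 0 <= g z - s z <= dl].
Proof.
move=> dl0; elim=> [|N IH] g mg gN.
  exists (fun=> 0); split => //.
    have := goodZ 0 (good_ind measurableT).
    by rewrite (_ : (fun z => _) = (fun=> 0))//; apply/funext => z; rewrite mul0r.
  move=> z Ez; have := gN z Ez; rewrite mul0r -eq_le => /eqP <-.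
  by rewrite subrr lexx ltW.
pose A := E `&` g @^-1` `[dl, +oo[%classic.
have mA : measurable A by exact: mg.
have [|z Ez|s [Gs s0 Hs]] := IH (fun z => Num.max (g z - dl) 0).
- by apply: measurable_maxr => //; exact: measurable_funB.
- have /andP[g0 g1] := gN z Ez; rewrite le_max lexx orbT /= ge_max lerBlDr.
  by rewrite mulr_ge0 ?(ltW dl0)// andbT -[X in _ + X]mul1r -mulrDl -natr1 in g1 *.
exists (fun z => s z + dl * \1_A z); split.
- by apply: goodD => //; apply: goodZ; exact: good_ind.
- by move=> z; rewrite addr_ge0// mulr_ge0 ?(ltW dl0)// indicE ler0n.
- move=> z Ez; have := Hs z Ez; have := s0 z; have /andP[g0 _] := gN z Ez.
  rewrite indicE; case: (boolP (z \in A)) => [/set_mem[_ /=]|/negP Az].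
    rewrite in_itv/= andbT -subr_ge0 => gd; rewrite (max_idPl gd) mulr1.
    by rewrite opprD addrAC addrA addrAC.
  have gd : g z < dl.
    rewrite ltNge; apply/negP => dg; apply: Az; apply/mem_set; split => //=.
    by rewrite in_itv/= dg.
  rewrite mulr0 addr0 max_r ?sub0r; last by rewrite subr_le0 ltW.
  move=> sz /andP[sz' _]; have -> : s z = 0 by apply: le_anti; rewrite sz andbT -oppr_ge0.
  by rewrite subr0 g0 ltW.
Qed.

Lemma weak_limit_bounded : exists f, int f /\
  forall g : T -> R, measurable_fun E g -> (exists M : R, forall z, E z -> `|g z| <= M) ->
  (fun i => I (fun z => f_ i z * g z)) @ U --> I (fun z => f z * g z).
Proof.
exists lim_fun; split=> // g mg [M gM].
have [C HC] := bnd.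
(* This exceeds the sum of the L^1 norms of [f_ i] and of the limit, so a uniform error e / 2 / C'
   in the test function costs less than e / 2. *)
pose C' := C + I (fun z => `|lim_fun z|) + 1.
have [i0 _] : exists i : J, True by have := ultra_ex UU (@filterT _ U _) => -[i _]; exists i.
have C0 : 0 <= C by apply: le_trans (HC i0); apply: intR_ge0.
have L0 : 0 <= I (fun z => `|lim_fun z|) by apply: intR_ge0.
have C'0 : 0 < C' by rewrite ltr_wpDl// addr_ge0.
apply/cvgrPdist_lt => e e0.
have dl0 : 0 < e / 2 / C' by rewrite !divr_gt0.
have [N HN] : exists N : nat, `|M| + `|M| <= N%:R * (e / 2 / C').
  exists (Num.truncn ((`|M| + `|M|) / (e / 2 / C'))).+1.
  by rewrite -ler_pdivrMr// ltW// truncnS_gt.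
(* The layers need a non-negative function; the shift by |M| is undone in [t]. *)
have [||s [Gs s0 Hs]] := step_approx dl0 (N := N) (g := fun z => g z + `|M|).
- exact: measurable_funD.
- move=> z Ez; have := gM z Ez; have := ler_norm M => h1 h2.
  have := le_trans h2 h1; rewrite ler_norml => /andP[h3 h4].
  apply/andP; split; first by rewrite -lerBlDr sub0r.
  by apply: le_trans HN; rewrite lerD2r.
have Gt : good (fun z => s z + - `|M| * \1_setT z).
  by apply: goodD => //; apply: goodZ; exact: good_ind.
pose t z := s z + - `|M| * \1_[set: T] z.
have gt z : E z -> `|g z - t z| <= e / 2 / C'.
  move=> Ez; have /andP[h1 h2] := Hs z Ez; rewrite /t indicT mulr1.
  rewrite (_ : g z - _ = g z + `|M| - s z); last by rewrite opprD opprK addrA addrAC.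
  by rewrite ger0_norm.
have [mt [Mt tM] ct] := Gt.
have HF F : int F -> `|I (fun z => F z * g z) - I (fun z => F z * t z)| <=
    I (fun z => `|F z|) * (e / 2 / C').
  move=> iF; have i1 : int (fun z => F z * g z) := int1Mb mE iF mg gM.
  have i2 : int (fun z => F z * t z) := goodM Gt iF.
  rewrite mulrC -intRZ//; last exact: int1_norm.
  rewrite -intRB//; apply: norm_intR_le => //; first exact: int1B.
    by apply: int1Z => //; exact: int1_norm.
  move=> z Ez; rewrite -mulrBr normrM mulrC; apply: ler_wpM2r => //; exact: gt.
have e2 : 0 < e / 2 by rewrite divr_gt0.
apply: filterS (ultra_near UU ct e2) => i /= Hi.
have h1 := HF _ int_lim_fun; have h2 := HF _ (if_ i).
have h3 : I (fun z => `|lim_fun z|) * (e / 2 / C') + I (fun z => `|f_ i z|) * (e / 2 / C') < e / 2.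
  rewrite -mulrDl mulrA ltr_pdivrMr// mulrC ltr_pM2l// /C'.
  by rewrite addrC -addrA ler_ltD// ltrDl.
exact: (norm_sub_lt h1 h2 Hi h3).
Qed.

End WeakCompactness.

(** * Truncation at level n *)

Section Truncation.
Context d (T : measurableType d) (R : realType) (mu : {measure set T -> \bar R}).
Variables (E : set T) (mE : measurable E).
Local Notation int := (int1 mu E).
Local Notation I := (intR mu E).
Implicit Types (f g h : T -> R).

Definition trunc (f : T -> R) (n : nat) : set T := E `&` f @^-1` `[- n%:R, n%:R].

Lemma trunc_measurable f n : measurable_fun E f -> measurable (trunc f n).
Proof. by move=> mf; exact: mf. Qed.

Lemma truncP f n z : E z -> reflect (`|f z| <= n%:R) (z \in trunc f n).
Proof.
move=> Ez; apply: (iffP idP) => [/set_mem[_ /=]|fn].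
  by rewrite in_itv/= -ler_norml.
by apply/mem_set; split => //=; rewrite in_itv/= -ler_norml.
Qed.

Lemma trunc_eventually f z : E z -> exists N : nat, forall n, (N <= n)%N -> z \in trunc f n.
Proof.
move=> Ez; exists (Num.truncn `|f z|).+1 => n Nn; apply/truncP => //.
apply: le_trans (ltW (truncnS_gt _)) _; by rewrite ler_nat.
Qed.

Lemma trunc_bound f n z : E z -> `|f z * \1_(trunc f n) z| <= n%:R.
Proof.
by move=> Ez; rewrite indicE; case: truncP => //= h; rewrite ?mulr1// mulr0 normr0.
Qed.

Lemma trunc_meas f n : measurable_fun E f -> measurable_fun E (fun z => f z * \1_(trunc f n) z).
Proof.
move=> mf; apply: measurable_funM => //.
by apply: measurable_funTS; apply: measurable_indic; exact: trunc_measurable.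
Qed.

(** Monotone convergence along the sets where |f| <= n. The limit found so far can be tested with
    bounded functions only; this turns the resulting bounds on truncations into a bound of the full
    integral. *)
Lemma trunc_integral_le (f h : T -> R) (K : R) : measurable_fun E f ->
  measurable_fun E h -> (forall z, E z -> 0 <= h z) ->
  (forall n, int (fun z => h z * \1_(trunc f n) z)) ->
  (forall n, I (fun z => h z * \1_(trunc f n) z) <= K) ->
  (\int[mu]_(z in E) (h z)%:E <= K%:E)%E.
Proof.
move=> mf mh h0 ih hK.
pose g n z := (h z * \1_(trunc f n) z)%:E.
have g0 n z : E z -> (0 <= g n z)%E.
  by move=> Ez; rewrite lee_fin mulr_ge0// ?h0// indicE.
have mg n : measurable_fun E (g n).
  by apply/measurable_EFinP; exact: int1_meas (ih n).
have ndg z : E z -> {homo (g ^~ z) : n m / (n <= m)%N >-> (n <= m)%E}.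
  move=> Ez n m nm; rewrite lee_fin; apply: ler_wpM2l; first exact: h0.
  rewrite !indicE; case: truncP => //= fn.
  case: truncP => //= fm; exfalso; apply: fm; apply: le_trans fn _; by rewrite ler_nat.
have <- : (\int[mu]_(z in E) limn (g ^~ z) = \int[mu]_(z in E) (h z)%:E)%E.
  apply: eq_integral => z /set_mem Ez; apply: cvg_lim => //.
  have [N HN] := trunc_eventually f Ez.
  apply: cvg_near_cst; exists N => // n /= Nn.
  by rewrite /g indicE HN// mulr1.
have cv := @cvg_monotone_convergence _ _ _ mu _ mE _ mg g0 ndg.
have <- := cvg_lim (@ereal_hausdorff R) cv; apply: lime_le; first by apply/cvg_ex; eexists; exact: cv.
apply: nearW => n; have := hK n; rewrite -lee_fin EFin_intR//.
Qed.

End Truncation.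

Lemma le_add_sq (R : realType) (a t : R) : 0 <= a -> 0 < t -> a <= t + t^-1 * a ^+ 2.
Proof.
move=> a0 t0; have [ta|ta] := leP a t.
  by apply: ler_wpDr => //; apply: mulr_ge0; [rewrite invr_ge0 ltW|exact: sqr_ge0].
apply: ler_wpDl; first exact: ltW.
by rewrite mulrC ler_pdivlMr// expr2 ler_wpM2l// ltW.
Qed.

(** * Weak compactness in L^2 *)

Section WeakCompactnessL2.
Context d (T : measurableType d) (R : realType)
  (mu : {sigma_finite_measure set T -> \bar R}).
Variables (E : set T) (mE : measurable E).
Hypothesis fE : (mu E < +oo)%E.
Local Notation int := (int1 mu E).
Local Notation I := (intR mu E).
Implicit Types (f g h : T -> R).
Local Notation L2 := (sql2 mu E).
Local Notation tr := (trunc E).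

Lemma pairing_le (f g : T -> R) (t : R) : L2 f -> L2 g -> 0 < t ->
  `|I (fun z => f z * g z)| <= (t * I (fun z => f z ^+ 2) + I (fun z => g z ^+ 2) / t) / 2.
Proof.
move=> lf lg t0; have i2f := sql2_int1 lf; have i2g := sql2_int1 lg.
have -> : (t * I (fun z => f z ^+ 2) + I (fun z => g z ^+ 2) / t) / 2 =
   I (fun z => t / 2 * f z ^+ 2 + t^-1 / 2 * g z ^+ 2).
  rewrite intRD ?(intRZ mE)//; [|exact: int1Z..].
  by field; rewrite gt_eqF.
apply: norm_intR_le => //; first exact: sql2M_int1.
  by apply: int1D => //; exact: int1Z.
move=> z _; rewrite normrM -(real_normK (num_real (f z))) -(real_normK (num_real (g z))).
move: `|f z| `|g z| => a b.
rewrite -subr_ge0.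
have -> : t / 2 * a ^+ 2 + t^-1 / 2 * b ^+ 2 - a * b = (t * a - b) ^+ 2 / (2 * t).
  by field; rewrite gt_eqF.
by rewrite divr_ge0 ?sqr_ge0// mulr_ge0// ltW.
Qed.

Lemma sql2_trunc f n : measurable_fun E f -> L2 (fun z => f z * \1_(tr f n) z).
Proof.
move=> mf; apply: (sql2_bounded mE (M := n%:R)) => //; first exact: trunc_meas.
by move=> z; exact: trunc_bound.
Qed.

Lemma trunc_sq_small (g : T -> R) (e : R) : L2 g -> 0 < e -> exists n,
  L2 (fun z => g z - g z * \1_(tr g n) z) /\
  I (fun z => (g z - g z * \1_(tr g n) z) ^+ 2) <= e.
Proof.
move=> lg e0; have [mg _] := lg.
have ld n : L2 (fun z => g z - g z * \1_(tr g n) z).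
  by apply: sql2D => //; apply: sql2N => //; exact: sql2_trunc.
have [|||n Hn] := @dominated_small _ _ _ mu E mE (fun n z => (g z - g z * \1_(tr g n) z) ^+ 2)
   (fun z => g z ^+ 2) e (sql2_int1 lg) e0.
- by move=> n; apply: int1_meas; exact: sql2_int1.
- move=> n z Ez; rewrite indicE; case: (_ \in _); rewrite /= ?mulr1 ?subrr ?expr0n/= ?normr0 ?sqr_ge0//.
  by rewrite mulr0 subr0 ger0_norm ?sqr_ge0.
- move=> z Ez; have [N HN] := trunc_eventually g Ez.
  by apply: cvg_near_cst; exists N => // n /= Nn; rewrite indicE HN// mulr1 subrr expr0n.
by exists n.
Qed.

Variables (J : Type) (U : set_system J).
Hypothesis UU : UltraFilter U.

(** With h the truncation of the limit f, integrating 2 f_i h <= f_i^2 + h^2 and passing to the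
    limit leaves the integral of h^2 at most K, because f h = h^2. Tests in L^2 are then reached by
    truncating them, with a uniformly small error. *)
Lemma weak_limit_L2 (f_ : J -> T -> R) (K : R) : (forall i, L2 (f_ i)) ->
  (forall i, I (fun z => f_ i z ^+ 2) <= K) ->
  exists f, [/\ L2 f, I (fun z => f z ^+ 2) <= K &
    forall g, L2 g -> (fun i => I (fun z => f_ i z * g z)) @ U --> I (fun z => f z * g z)].
Proof.
move=> lf fK.
have [i0 _] : exists i : J, True by have [i _] := ultra_ex UU (@filterT _ U _); exists i.
have K0 : 0 <= K by apply: le_trans (fK i0); apply: intR_ge0 => z _; exact: sqr_ge0.
have K1 : 0 < K + 1 by rewrite ltr_wpDl.
have if_ i : int (f_ i) by exact: sql2_int1'.
have [|f [i_f cf]] := @weak_limit_bounded _ _ _ mu E mE fE J U UU f_ if_.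
  (* [le_add_sq] with this threshold leaves the remainder e / (K + 1) times f_i^2, whose integral is
     at most e. *)
  move=> e e0; exists ((K + 1) / e); first by apply: divr_ge0; exact: ltW.
  move=> i; exists (fun z => e / (K + 1) * f_ i z ^+ 2); split.
  - by apply: int1Z => //; exact: sql2_int1.
  - rewrite (intRZ mE); last exact: sql2_int1.
    rewrite mulrAC ler_pdivrMr// ler_pM2l//; apply: le_trans (fK i) _; by rewrite lerDl.
  - by move=> z _; apply: mulr_ge0; [apply: divr_ge0; exact: ltW|exact: sqr_ge0].
  - move=> z _; rewrite -(real_normK (num_real (f_ i z))); have := normr_ge0 (f_ i z); move: `|f_ i z| => a a0.
    have t0 : 0 < (K + 1) / e by rewrite divr_gt0.
    rewrite -[e / (K + 1)]invf_div; move: ((K + 1) / e) t0 => t t0.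
    exact: le_add_sq.
have mf : measurable_fun E f := int1_meas i_f.
have lh n := sql2_trunc n mf.
have hE n z : f z * (f z * \1_(tr f n) z) = f z ^+ 2 * \1_(tr f n) z by rewrite mulrA.
have hE2 n z : (f z * \1_(tr f n) z) ^+ 2 = f z ^+ 2 * \1_(tr f n) z.
  by rewrite exprMn indicE; case: (_ \in _); rewrite /= ?expr1n// expr0n.
have ih n : int (fun z => f z ^+ 2 * \1_(tr f n) z).
  by apply: (eq_int1 mE _ (sql2_int1 (lh n))) => z _; rewrite hE2.
have hK n : I (fun z => f z ^+ 2 * \1_(tr f n) z) <= K.
  have c : (fun i => 2 * I (fun z => f_ i z * (f z * \1_(tr f n) z))) @ U -->
      2 * I (fun z => f z ^+ 2 * \1_(tr f n) z).
    apply: ultraZ => //; under eq_intR => z _ do rewrite -hE.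
    apply: cf; first exact: trunc_meas.
    by exists n%:R => z; exact: trunc_bound.
  have := ultra_le UU c (cvg_cst (K + I (fun z => f z ^+ 2 * \1_(tr f n) z))).
  rewrite mulrDl mul1r lerD2r; apply=> i.
  apply: le_trans (lerD (fK i) (lexx _)).
  under [X in _ <= _ + X]eq_intR => z _ do rewrite -hE2.
  have i1 := sql2_int1 (lf i); have i2 := sql2_int1 (lh n).
  rewrite -(intRZ mE) -?intRD//; last exact: sql2M_int1.
  apply: le_intR => //; [by apply: int1Z => //; exact: sql2M_int1|exact: int1D|].
  move=> z _; move: (f_ i z) (f z * _) => a b; rewrite -subr_ge0.
  have -> : a ^+ 2 + b ^+ 2 - 2 * (a * b) = (a - b) ^+ 2 by ring.
  exact: sqr_ge0.
have m2 : measurable_fun E (fun z => f z ^+ 2) by exact: measurable_funX.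
have f2K : (\int[mu]_(z in E) (f z ^+ 2)%:E <= K%:E)%E.
  by apply: (@trunc_integral_le _ _ _ mu E mE f) => // z _; exact: sqr_ge0.
have l2f : L2 f by split => //; apply: le_lt_trans f2K (ltry _).
exists f; split => //.
  by rewrite -lee_fin EFin_intR//; exact: sql2_int1.
move=> g lg; have [mg _] := lg.
apply/cvgrPdist_lt => e e0.
(* The parameter in Young's inequality: s (K + 1) = e / 8, and the truncation error of [g] is then
   taken at most s e / 8. *)
pose s := e / (8 * (K + 1)).
have s0 : 0 < s by rewrite divr_gt0// mulr_gt0.
have [n [ld dn]] := trunc_sq_small lg (mulr_gt0 s0 (divr_gt0 e0 (ltr0n R 8))).
have lgn := sql2_trunc n mg.
have HF F : L2 F -> I (fun z => F z ^+ 2) <= K ->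
  `|I (fun z => F z * g z) - I (fun z => F z * (g z * \1_(tr g n) z))| <= e / 8.
  move=> lF FK; rewrite -intRB//; [|exact: sql2M_int1..].
  under eq_intR => z _ do rewrite -mulrBr.
  apply: le_trans (pairing_le lF ld s0) _.
  have h1 : s * I (fun z => F z ^+ 2) <= e / 8.
    apply: le_trans (_ : s * (K + 1) <= _).
      by apply: ler_wpM2l; [exact: ltW|apply: le_trans FK _; rewrite lerDl].
    by rewrite /s le_eqVlt; apply/orP; left; apply/eqP; field; rewrite gt_eqF.
  have h2 : I (fun z => (g z - g z * \1_(tr g n) z) ^+ 2) / s <= e / 8.
    by rewrite ler_pdivrMr// mulrC.
  move: h1 h2; move: (s * _) (_ / s) (e / 8) => x y w h1 h2.
  by rewrite ler_pdivrMr// mulr_natr mulr2n lerD.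
have cv : (fun i => I (fun z => f_ i z * (g z * \1_(tr g n) z))) @ U -->
   I (fun z => f z * (g z * \1_(tr g n) z)).
  by apply: cf; [exact: trunc_meas|exists n%:R => z; exact: trunc_bound].
have e2 : 0 < e / 2 by rewrite divr_gt0.
apply: filterS (ultra_near UU cv e2) => i /= Hi.
have If : I (fun z => f z ^+ 2) <= K by rewrite -lee_fin EFin_intR//; exact: sql2_int1.
apply: norm_sub_lt (HF _ l2f If) (HF _ (lf i) (fK i)) Hi _.
by rewrite -mulrDr ltr_pM2l//; lra.
Qed.

End WeakCompactnessL2.

(** * Weak compactness in L^p *)

Section WeakCompactnessLp.
Context d (T : measurableType d) (R : realType)
  (mu : {sigma_finite_measure set T -> \bar R}).
Variables (E : set T) (mE : measurable E).
Hypothesis fE : (mu E < +oo)%E.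
Local Notation int := (int1 mu E).
Local Notation I := (intR mu E).
Local Notation tr := (trunc E).
Implicit Types (f g h : T -> R).

(** The unit ball of L^p without the p-th root and without extension by zero outside [E]; [Lp_ballE]
    makes the link with [Lp_ball]. *)
Definition unit_ball (p : \bar R) f := measurable_fun E f /\
  match p with
  | p%:E => (\int[mu]_(z in E) (`|f z| `^ p)%:E <= 1)%E
  | +oo%E => {ae mu, forall z, E z -> `|f z| <= 1}
  | -oo%E => False
  end.

(** When a > t, write a = a^(1 - p) a^p and use that 1 - p is negative. As t grows the coefficient
    tends to 0, which is uniform integrability; this is where p > 1 enters. *)
Lemma le_add_powR (a p t : R) : 0 <= a -> 0 < t -> 1 < p -> a <= t + t `^ (1 - p) * a `^ p.
Proof.
move=> a0 t0 p1; have [ta|ta] := leP a t.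
  by apply: ler_wpDr => //; apply: mulr_ge0; exact: powR_ge0.
apply: ler_wpDl; first exact: ltW.
have a_gt0 : 0 < a := lt_trans t0 ta.
apply: le_trans (_ : a `^ (1 - p) * a `^ p <= _).
  by rewrite -powRD ?subrK ?powRr1// (gt_eqF a_gt0) implybT.
apply: ler_wpM2r; first exact: powR_ge0.
have -> : 1 - p = - (p - 1) by ring.
rewrite !powRN lef_pV2 ?posrE ?powR_gt0//.
by apply: ge0_ler_powR; rewrite ?nnegrE ?subr_ge0 ?ltW.
Qed.

Lemma unit_ball_pow_int p f : unit_ball p%:E f -> int (fun z => `|f z| `^ p).
Proof.
move=> [mf f1]; have mp : measurable_fun E (fun z => `|f z| `^ p).
  by apply: (measurableT_comp (measurable_powR p)) => //; exact: measurableT_comp.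
apply/integrableP; split; first exact/measurable_EFinP.
apply: le_lt_trans (ltry 1); apply: le_trans f1.
rewrite le_eqVlt; apply/orP; left; apply/eqP; apply: eq_integral => z _.
by rewrite /= ger0_norm// powR_ge0.
Qed.

Lemma unit_ball_pow_le p f : unit_ball p%:E f -> I (fun z => `|f z| `^ p) <= 1.
Proof.
by move=> bf; rewrite -lee_fin EFin_intR//; [case: bf|exact: unit_ball_pow_int].
Qed.

Lemma unit_ball_int p f : (1 < p)%E -> unit_ball p f -> int f.
Proof.
case: p => [p| |]//; rewrite ?lte_fin => p1 bf; have [mf H] := bf.
  apply: (int1_le mE mf (g := fun z => 1 + 1 `^ (1 - p) * `|f z| `^ p)).
    apply: int1D => //; first by apply: (int1_bounded mE (M := 1)) => // z _; rewrite normr1.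
    by apply: int1Z => //; exact: unit_ball_pow_int.
  by move=> z _; apply: le_add_powR.
apply/integrableP; split; first exact/measurable_EFinP.
apply: le_lt_trans (_ : (\int[mu]_(z in E) (cst 1%E) z < +oo)%E).
  apply: ae_ge0_le_integral => //.
  by apply/measurable_EFinP; exact: measurableT_comp.
by rewrite integral_cst// mul1e.
Qed.

(** For finite [p] this is [le_add_powR] with t = 1, integrated. *)
Lemma unit_ball_intR_le p f : (1 < p)%E -> unit_ball p f -> I (fun z => `|f z|) <= I (fun=> 1) + 1.
Proof.
have i1 : int (fun=> 1) by apply: (int1_bounded mE (M := 1)) => // z _; rewrite normr1.
move=> p1 bf; have i_f := unit_ball_int p1 bf.
case: p p1 bf => [p| |]//; rewrite ?lte_fin => p1 bf.
  apply: le_trans (_ : I (fun z => 1 + 1 `^ (1 - p) * `|f z| `^ p) <= _).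
    apply: le_intR => //; first exact: int1_norm.
      by apply: int1D => //; apply: int1Z => //; exact: unit_ball_pow_int.
    by move=> z _; exact: le_add_powR.
  rewrite intRD//; last by apply: int1Z => //; exact: unit_ball_pow_int.
  rewrite (intRZ mE) ?powR1 ?mul1r ?lerD2l//; last exact: unit_ball_pow_int.
  exact: unit_ball_pow_le.
apply: le_trans (_ : I (fun=> 1) <= _); last by rewrite lerDl.
by apply: (ae_le_le_intR mE) => //; [exact: int1_norm|case: bf].
Qed.

Lemma unit_ballN p f : unit_ball p f -> unit_ball p (fun z => - f z).
Proof.
move=> [mf h]; split; first exact: measurable_funN.
case: p h => [q| |]// h; first by under eq_integral do rewrite normrN.
by apply: filterS h => z h Oz; rewrite normrN; exact: h.
Qed.

Variables (J : Type) (U : set_system J).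
Hypothesis UU : UltraFilter U.

(** The norm bound of the limit f comes from duality. For finite p the test is f |f|^(p - 2) on a
    truncation: Young's inequality gives X <= 1 / p + X / q for the truncated integral X of |f|^p,
    hence X <= 1. For p = +oo the tests are indicators, for f and for -f. *)
Lemma weak_limit_Lp (f_ : J -> T -> R) (p : \bar R) : (1 < p)%E ->
  (forall i, unit_ball p (f_ i)) ->
  exists f, unit_ball p f /\ forall g : T -> R, measurable_fun E g ->
    (exists M : R, forall z, E z -> `|g z| <= M) ->
    (fun i => I (fun z => f_ i z * g z)) @ U --> I (fun z => f z * g z).
Proof.
move=> p1 bf.
have if_ i : int (f_ i) := unit_ball_int p1 (bf i).
have i1 : int (fun=> 1) by apply: (int1_bounded mE (M := 1)) => // z _; rewrite normr1.
case: p p1 bf => [p| |]// p1 bf.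
- rewrite lte_fin in p1; have p0 : 0 < p by apply: lt_trans p1.
  have ip i := unit_ball_pow_int (bf i); have p1' i := unit_ball_pow_le (bf i).
  have [|f [i_f cf]] := @weak_limit_bounded _ _ _ mu E mE fE J U UU f_ if_.
    (* Chosen so that the coefficient t^(1 - p) of |f_i|^p in [le_add_powR] is exactly [e]. *)
    move=> e e0; pose t := e `^ (1 - p)^-1.
    have t0 : 0 < t by rewrite powR_gt0.
    have te : t `^ (1 - p) = e.
      by rewrite -powRrM mulVf ?powRr1 ?ltW// lt_eqF// subr_lt0.
    exists t; first exact: ltW.
    move=> i; exists (fun z => e * `|f_ i z| `^ p); split.
    - exact: int1Z.
    - by rewrite (intRZ mE)// -[X in _ <= X]mulr1 ler_pM2l.
    - by move=> z _; rewrite mulr_ge0 ?powR_ge0// ltW.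
    - by move=> z _; rewrite -te; apply: le_add_powR.
  have mf : measurable_fun E f := int1_meas i_f.
  exists f; split=> //; split=> //.
  pose q := p / (p - 1).
  have q0 : 0 < q by rewrite divr_gt0// subr_gt0.
  have pq : p^-1 + q^-1 = 1.
    by rewrite /q; field; rewrite !gt_eqF// subr_gt0.
  (* The dual function: on the truncation f h = |f|^p, and |h|^q = |f|^p where f does not vanish.
     Truncating keeps it bounded. *)
  pose h n z := f z * `|f z| `^ (p - 2) * \1_(tr f n) z.
  have mh n : measurable_fun E (h n).
    apply: measurable_funM; last first.
      by apply: measurable_funTS; apply: measurable_indic; exact: trunc_measurable.
    apply: measurable_funM => //.
    by apply: (measurableT_comp (measurable_powR _)) => //; exact: measurableT_comp.
  have hE (r : R) : r != 0 -> `|r * `|r| `^ (p - 2)| = `|r| `^ (p - 1).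
    move=> r0; rewrite normrM [X in _ * X]ger0_norm ?powR_ge0// -{1}[`|r|]powRr1//.
    rewrite -powRD ?normr_eq0 ?r0 ?implybT//; congr (_ `^ _); ring.
  have hM n : exists M : R, forall z, E z -> `|h n z| <= M.
    exists (n%:R `^ (p - 1)) => z Ez; rewrite /h indicE.
    case: (truncP f n Ez) => /= [fn|_]; last by rewrite mulr0 normr0 powR_ge0.
    have [->|f0] := eqVneq (f z) 0; first by rewrite !mul0r normr0 powR_ge0.
    rewrite mulr1 hE//.
    by apply: ge0_ler_powR; rewrite ?nnegrE ?subr_ge0 ?ler0n// ltW.
  have mp : measurable_fun E (fun z => `|f z| `^ p).
    by apply: (measurableT_comp (measurable_powR p)) => //; exact: measurableT_comp.
  have ik n : int (fun z => `|f z| `^ p * \1_(tr f n) z).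
    apply: (int1_bounded mE (M := n%:R `^ p)) => //.
      apply: measurable_funM => //.
      by apply: measurable_funTS; apply: measurable_indic; exact: trunc_measurable.
    move=> z Ez; rewrite indicE; case: (truncP f n Ez) => /= [fn|_]; last by rewrite mulr0 normr0 powR_ge0.
    rewrite mulr1 ger0_norm ?powR_ge0//.
    by apply: ge0_ler_powR; rewrite ?nnegrE ?ler0n// ltW.
  have fh n z : f z * h n z = `|f z| `^ p * \1_(tr f n) z.
    rewrite /h mulrA; congr (_ * _).
    have [->|f0] := eqVneq (f z) 0; first by rewrite normr0 mul0r powR0// gt_eqF.
    have a0 : `|f z| != 0 by rewrite normr_eq0.
    rewrite mulrA -expr2 -(real_normK (num_real (f z))) -powR_mulrn// -powRD ?a0 ?implybT//.
    congr (_ `^ _); ring.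
  have hq n z : `|h n z| `^ q = `|f z| `^ p * \1_(tr f n) z \/ f z = 0.
    have [->|f0] := eqVneq (f z) 0; [by right|left].
    rewrite /h indicE; case: (_ \in _); last by rewrite /= !mulr0 normr0 powR0// gt_eqF.
    rewrite !mulr1 hE//.
    by rewrite -powRrM /q mulrCA divff ?mulr1// subr_eq0 gt_eqF.
  apply: (@trunc_integral_le _ _ _ mu E mE f _ 1) => //.
  move=> n; have c := cf _ (mh n) (hM n).
  rewrite (@eq_intR _ _ _ mu E (fun z => f z * h n z) _ (fun z _ => fh n z)) in c.
  have {c} : I (fun z => `|f z| `^ p * \1_(tr f n) z) <=
      p^-1 + q^-1 * I (fun z => `|f z| `^ p * \1_(tr f n) z).
    apply: (ultra_le UU c (cvg_cst _)) => i.
    apply: le_trans (_ : p^-1 * I (fun z => `|f_ i z| `^ p) +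
        q^-1 * I (fun z => `|f z| `^ p * \1_(tr f n) z) <= _); last first.
      by rewrite lerD2r -[X in _ <= X]mulr1 ler_pM2l ?invr_gt0.
    rewrite -!(intRZ mE)// -intRD//; [|exact: int1Z..].
    apply: le_intR => //; [exact: (int1Mb mE (if_ i) (mh n) (projT2 (cid (hM n))))|by apply: int1D => //; exact: int1Z|].
    move=> z Ez; apply: le_trans (ler_norm _) _; rewrite normrM.
    have [<-|fz0] := hq n z.
      rewrite mulrC [X in _ + X]mulrC [X in X + _]mulrC mulrC.
      exact: conjugate_powR.
    rewrite /h fz0 !mul0r normr0 mulr0 addr_ge0// mulr_ge0 ?powR_ge0// ?invr_ge0 ?ltW//.
  move: (I _) => x Hx.
  have : p^-1 * x <= p^-1.
    have -> : p^-1 * x = x - q^-1 * x by rewrite -[X in X - _]mul1r -pq; ring.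
    by rewrite lerBlDr.
  by rewrite -[X in _ <= X]mulr1 ler_pM2l// invr_gt0.
- have fM i : {ae mu, forall z, E z -> `|f_ i z| <= 1} by case: (bf i).
  have [|f [i_f cf]] := @weak_limit_bounded _ _ _ mu E mE fE J U UU f_ if_.
    (* The domination in [ui] is pointwise while the bound by 1 holds almost everywhere; the
       remainder corrects this on a null set and has integral 0. *)
    move=> e e0; exists 1 => // i; exists (fun z => Num.max (`|f_ i z| - 1) 0).
    have ir : int (fun z => Num.max (`|f_ i z| - 1) 0).
      apply: (int1_le mE (g := fun z => `|f_ i z|)); last 2 first.
      - exact: int1_norm.
      - move=> z _; rewrite ger0_norm ?le_max ?lexx ?orbT// ge_max normr_ge0 andbT.
        by rewrite gerBl.
      apply: measurable_maxr => //; apply: measurable_funB => //.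
      by apply: int1_meas; exact: int1_norm.
    split => //.
    - apply: le_trans (ltW e0); rewrite -[X in _ <= X](@intR0 _ _ _ mu E mE) le_eqVlt; apply/orP; left; apply/eqP.
      apply: (ae_eq_intR mE) => //; first exact: int1_meas ir.
      apply: filterS (fM i) => z H Ez; apply/max_idPr.
      by rewrite subr_le0 H.
    - move=> z _; rewrite -lerBlDl le_max lexx//.
  have mf : measurable_fun E f := int1_meas i_f.
  exists f; split=> //; split=> //.
  have H (k : R) : `|k| = 1 -> {ae mu, forall z, E z -> k * f z <= 1}.
    move=> k1; apply: (ae_le_intR mE) => //; first exact: int1Z.
    move=> A mA.
    have mA1 : measurable_fun E (\1_A : T -> R) by apply: measurable_funTS; exact: measurable_indic.
    have A1 : forall z, E z -> `|\1_A z| <= 1 :> R.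
      by move=> z _; rewrite indicE; case: (_ \in _); rewrite ?normr1 ?normr0.
    have := cf _ mA1 (ex_intro _ 1 A1) => /(ultraZ UU (k := k)) c.
    under eq_intR => z _ do rewrite -mulrA.
    rewrite (intRZ mE); last exact: int1_indic.
    apply: (ultra_le UU c (cvg_cst _)) => i.
    rewrite -(intRZ mE); last exact: int1_indic.
    apply: ae_le_le_intR => //; [apply: int1Z => //; exact: int1_indic|exact: int1_indic|].
    apply: filterS (fM i) => z Hz Ez; rewrite mulrA; apply: ler_wpM2r; first by rewrite indicE.
    by apply: le_trans (ler_norm _) _; rewrite normrM k1 mul1r Hz.
  have := H 1 (normr1 _); have := H (-1) (normrN1 _).
  apply: filterS2 => z h1 h2 Ez; rewrite ler_norml -[X in X && _]lerN2 opprK.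
  by have := h1 Ez; have := h2 Ez; rewrite mul1r mulN1r => -> ->.
Qed.

End WeakCompactnessLp.

(** * The plate form *)

Section PlateForm.
Variables (R : realType) (l sigma : R).
Local Notation P := (R * R)%type.
Local Notation P2 := (measurableTypeR R * measurableTypeR R)%type.
Local Notation Om := (Omega l : set P2).
Local Notation mu := (@mu2 R).
Local Notation I := (intR mu Om).
Local Notation L2 := (sql2 mu Om).
Let mO := Omega_measurable l.
Hypothesis s01 : 0 < sigma < 1.

Lemma intR_sub (E : set P2) (f : P -> R) : measurable E -> E `<=` Om ->
  intR mu E f = I (fun z => f z * \1_E z).
Proof.
move=> mE EO; rewrite /intR -{1}(setIidr EO) Rintegral_mkcondr.
apply: eq_Rintegral => z _; rewrite /patch indicE; case: ifP => _; by rewrite ?mulr1 ?mulr0.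
Qed.

Definition plate (a b c p q r : P -> R) (z : P) : R :=
  (a z + c z) * (p z + r z) + (1 - sigma) * (2 * b z * q z - a z * r z - c z * p z).

Lemma bformE (E : set P2) a b c p q r : measurable E -> E `<=` Om ->
  bform sigma E a b c p q r = I (fun z => plate a b c p q r z * \1_E z).
Proof. exact: intR_sub. Qed.

Lemma indic_meas (E : set P2) : measurable E -> measurable_fun Om (\1_E : P -> R).
Proof. by move=> mE; apply: measurable_funTS; exact: measurable_indic. Qed.

Lemma sql2_indic (E : set P2) (f : P -> R) : measurable E -> L2 f -> L2 (fun z => f z * \1_E z).
Proof.
move=> mE lf; apply: (@sql2Mb _ _ _ mu Om mO f (\1_E : P -> R) 1) => // z _.
by  rewrite indicE; case: (_ \in _); rewrite ?normr1 ?normr0.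
Qed.

(** For fixed [p, q, r] in L^2 the integrand is linear in [a, b, c] with L^2 coefficients. Hence the
    form is weakly continuous in its first argument, which [bform_weak] states. *)
Lemma plate_expand a b c p q r z : plate a b c p q r z =
  a z * (p z + sigma * r z) + c z * (r z + sigma * p z) + b z * (2 * (1 - sigma) * q z).
Proof. by rewrite /plate; ring. Qed.

Section Expansion.
Variables (E : set P2) (mE : measurable E) (EO : E `<=` Om).
Variables (p q r : P -> R).
Hypotheses (lp : L2 p) (lq : L2 q) (lr : L2 r).

Let g1 z := (p z + sigma * r z) * \1_E z.
Let g2 z := (r z + sigma * p z) * \1_E z.
Let g3 z := (2 * (1 - sigma) * q z) * \1_E z.

Let L2g1 : L2 g1. Proof. by apply: sql2_indic => //; apply: sql2D => //; exact: sql2Z. Qed.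
Let L2g2 : L2 g2. Proof. by apply: sql2_indic => //; apply: sql2D => //; exact: sql2Z. Qed.
Let L2g3 : L2 g3. Proof. by apply: sql2_indic => //; exact: sql2Z. Qed.

Lemma plate_int a b c : L2 a -> L2 b -> L2 c ->
  int1 mu Om (fun z => plate a b c p q r z * \1_E z).
Proof.
move=> la lb lc.
apply: (eq_int1 mO (f := fun z => a z * g1 z + c z * g2 z + b z * g3 z)).
  by move=> z _; rewrite plate_expand /g1 /g2 /g3; ring.
by do 2?[apply: int1D => //]; exact: sql2M_int1.
Qed.

Lemma bform_expand a b c : L2 a -> L2 b -> L2 c ->
  bform sigma E a b c p q r = I (fun z => a z * g1 z) + I (fun z => c z * g2 z) + I (fun z => b z * g3 z).
Proof.
move=> la lb lc; rewrite bformE//.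
have i1 := sql2M_int1 mO la L2g1; have i2 := sql2M_int1 mO lc L2g2.
have i3 := sql2M_int1 mO lb L2g3.
rewrite -!intRD//; last exact: int1D.
by apply: eq_intR => z _; rewrite plate_expand /g1 /g2 /g3; ring.
Qed.

Lemma bform_weak (U : set_system nat) (a_ b_ c_ : nat -> P -> R) a b c :
  UltraFilter U -> (forall i, [/\ L2 (a_ i), L2 (b_ i) & L2 (c_ i)]) ->
  L2 a -> L2 b -> L2 c ->
  (forall g, L2 g -> (fun i => I (fun z => a_ i z * g z)) @ U --> I (fun z => a z * g z)) ->
  (forall g, L2 g -> (fun i => I (fun z => b_ i z * g z)) @ U --> I (fun z => b z * g z)) ->
  (forall g, L2 g -> (fun i => I (fun z => c_ i z * g z)) @ U --> I (fun z => c z * g z)) ->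
  (fun i => bform sigma E (a_ i) (b_ i) (c_ i) p q r) @ U --> bform sigma E a b c p q r.
Proof.
move=> UU labc la lb lc wa wb wc; rewrite bform_expand//.
rewrite (_ : (fun i => _) = fun i => I (fun z => a_ i z * g1 z) + I (fun z => c_ i z * g2 z)
   + I (fun z => b_ i z * g3 z)).
  by apply: ultraD => //; [apply: ultraD => //; [exact: wa|exact: wc]|exact: wb].
by apply/funext => i; have [? ? ?] := labc i; rewrite bform_expand.
Qed.

End Expansion.

(** The two sides differ by sigma (a + c)^2. Together with sigma < 1 this gives coercivity of the
    form. *)
Lemma plate_ge (a b c : R) :
  (1 - sigma) * (a ^+ 2 + c ^+ 2 + 2 * b ^+ 2) <= (a + c) * (a + c) + (1 - sigma) * (2 * b * b - a * c - c * a).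
Proof.
rewrite -subr_ge0.
have -> : (a + c) * (a + c) + (1 - sigma) * (2 * b * b - a * c - c * a) -
  (1 - sigma) * (a ^+ 2 + c ^+ 2 + 2 * b ^+ 2) = sigma * (a + c) ^+ 2 by ring.
by case/andP: s01 => s0 _; apply: mulr_ge0; [exact: ltW|exact: sqr_ge0].
Qed.

(** Positivity of the plate form at the difference of the two triples. It is pointwise, so it
    integrates over [Omega] and over [D] alike. *)
Lemma plate_diff_le (a b c p q r a' b' c' : P -> R) (z : P) :
  plate a b c (p \- a) (q \- b) (r \- c) z <=
  plate a b c (p \- (a' \+ a')) (q \- (b' \+ b')) (r \- (c' \+ c')) z + plate a' b' c' a' b' c' z.
Proof.
have := plate_ge (a z - a' z) (b z - b' z) (c z - c' z).
move=> H; rewrite -subr_ge0.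
have H0 : 0 <= (1 - sigma) * ((a z - a' z) ^+ 2 + (c z - c' z) ^+ 2 + 2 * (b z - b' z) ^+ 2).
  case/andP: s01 => _ s1; apply: mulr_ge0; first by rewrite subr_ge0 ltW.
  by rewrite !addr_ge0 ?sqr_ge0// mulr_ge0 ?sqr_ge0.
apply: le_trans H0 (le_trans H _); rewrite le_eqVlt; apply/orP; left; apply/eqP.
by rewrite /plate /=; ring.
Qed.

Lemma bform_diff_le (E : set P2) (a b c p q r a' b' c' : P -> R) :
  measurable E -> E `<=` Om -> L2 a -> L2 b -> L2 c -> L2 p -> L2 q -> L2 r ->
  L2 a' -> L2 b' -> L2 c' ->
  bform sigma E a b c (p \- a) (q \- b) (r \- c) <=
  bform sigma E a b c (p \- (a' \+ a')) (q \- (b' \+ b')) (r \- (c' \+ c')) + bform sigma E a' b' c' a' b' c'.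
Proof.
move=> mE EO la lb lc lp lq lr la' lb' lc'; rewrite !bformE//.
have B f g : L2 f -> L2 g -> L2 (f \- g) by move=> lf lg; apply: sql2D => //; exact: sql2N.
have A f g : L2 f -> L2 g -> L2 (f \+ g) by move=> lf lg; apply: sql2D.
rewrite -intRD//; try by apply: plate_int => //; do ?[apply: B => //; exact: A|exact: B|exact: A].
apply: le_intR => //; try by apply: plate_int => //; do ?[apply: B => //; exact: A|exact: B|exact: A].
  by apply: int1D => //; apply: plate_int => //; do ?[apply: B => //; exact: A|exact: B|exact: A].
move=> z _; rewrite -mulrDl; apply: ler_wpM2r; first by rewrite indicE.
exact: plate_diff_le.
Qed.

(** The equality case of [bform_diff_le] when both triples agree: it turns the limit of the
    linearised bound back into the right-hand side of the variational inequality. *)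
Lemma bform_diff (E : set P2) (p q r a b c : P -> R) :
  measurable E -> E `<=` Om -> L2 a -> L2 b -> L2 c -> L2 p -> L2 q -> L2 r ->
  bform sigma E a b c (p \- (a \+ a)) (q \- (b \+ b)) (r \- (c \+ c)) + bform sigma E a b c a b c =
  bform sigma E a b c (p \- a) (q \- b) (r \- c).
Proof.
move=> mE EO la lb lc lp lq lr; rewrite !bformE//.
have B f g : L2 f -> L2 g -> L2 (f \- g) by move=> lf lg; apply: sql2D => //; exact: sql2N.
have A f g : L2 f -> L2 g -> L2 (f \+ g) by move=> lf lg; apply: sql2D.
rewrite -intRD//; try by apply: plate_int => //; do ?[apply: B => //; exact: A|exact: B|exact: A].
by apply: eq_intR => z _; rewrite /plate /=; ring.
Qed.

Lemma bform_coercive (E : set P2) (a b c : P -> R) :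
  measurable E -> E `<=` Om -> L2 a -> L2 b -> L2 c ->
  (1 - sigma) * I (fun z => (a z ^+ 2 + c z ^+ 2 + 2 * b z ^+ 2) * \1_E z) <= bform sigma E a b c a b c.
Proof.
move=> mE EO la lb lc; rewrite bformE//.
have i1 : int1 mu Om (fun z => a z ^+ 2 + c z ^+ 2 + 2 * b z ^+ 2).
  apply: int1D => //; last by apply: int1Z => //; exact: sql2_int1.
  by apply: int1D => //; exact: sql2_int1.
have i2 := int1_indic mO mE i1.
rewrite -(intRZ mO)//; apply: le_intR => //; [exact: int1Z|exact: plate_int|].
by move=> z _; rewrite mulrA; apply: ler_wpM2r; [rewrite indicE|exact: plate_ge].
Qed.

End PlateForm.

(** * The space H^2_* and uniqueness of weak derivatives *)

Section H2starTheory.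
Variables (R : realType) (l : R).
Local Notation P := (R * R)%type.
Local Notation P2 := (measurableTypeR R * measurableTypeR R)%type.
Local Notation Om := (Omega l : set P2).
Local Notation mu := (@mu2 R).
Local Notation I := (intR mu Om).
Local Notation int := (int1 mu Om).
Local Notation L2 := (sql2 mu Om).
Local Notation CC w := {within clOmega l, continuous w}.
Let mO := Omega_measurable l.
Let fO := mu2_Omega_fin l.
Implicit Types (u w a b c : P -> R).

Lemma clOmega_compact : compact (clOmega l).
Proof.
have -> : clOmega l = `[0, pi]%classic `*` `[- l, l]%classic.
  by apply/seteqP; split => z; rewrite /clOmega /= !in_itv.
by apply: compact_setX; exact: segment_compact.
Qed.

Lemma within_bounded w : CC w -> exists M : R, forall z, clOmega l z -> `|w z| <= M.
Proof.
move=> cw; have /compact_bounded[M [_ HM]] := continuous_compact cw clOmega_compact.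
exists (M + 1) => z Cz; apply: (HM (M + 1)); first by rewrite ltrDl.
by exists z.
Qed.

Lemma continuous_CC w : continuous w -> CC w.
Proof. by move=> cw; exact: continuous_subspaceT. Qed.

Lemma CC_measurable w : CC w -> measurable_fun Om w.
Proof.
move=> cw; apply: within_continuous_measurable; first exact: Omega_open.
by apply: continuous_subspaceW cw => z; exact: Omega_sub.
Qed.

Lemma CC_bounded w : CC w -> exists M : R, forall z, Om z -> `|w z| <= M.
Proof. by move=> /within_bounded[M H]; exists M => z /Omega_sub; exact: H. Qed.

Lemma CC_int w : CC w -> int w.
Proof.
move=> cw; have [M HM] := CC_bounded cw.
by apply: (int1_bounded mO (M := M)) => //; exact: CC_measurable.
Qed.

Lemma test_fun_CC phi vs : test_fun Om phi -> CC (iter_derive vs phi).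
Proof.
by move=> [D _]; apply: continuous_CC => z; apply: differentiable_continuous; exact: D.
Qed.

Lemma CC_int_mul w g : CC w -> int g -> int (fun z => g z * w z).
Proof.
by move=> cw ig; have [M HM] := CC_bounded cw; exact: int1Mb ig (CC_measurable cw) HM.
Qed.

Lemma CC_sql2 w : CC w -> L2 w.
Proof.
move=> cw; have [M HM] := CC_bounded cw.
by apply: (sql2_bounded mO (M := M)) => //; exact: CC_measurable.
Qed.

(** The difference g - h is orthogonal to every tensor test function, so the fundamental lemma
    applies. *)
Lemma weak_deriv_unique vs u (g h : P -> R) : L2 g -> L2 h ->
  weak_deriv Om vs u g -> weak_deriv Om vs u h -> {ae mu, forall z, Om z -> g z = h z}.
Proof.
move=> lg lh wg wh; have ig := sql2_int1' mO fO lg; have ih := sql2_int1' mO fO lh.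
have := @ae_eq0_of_tens R l (fun z => g z - h z) (int1B mO ig ih).
case=> [a b ta tb|N [mN N0 HN]].
  have tab := test_fun_tens ta tb.
  have cab : CC (tens a b) := test_fun_CC (vs := [::]) tab.
  rewrite (@eq_intR _ _ _ mu Om _ (fun z => g z * tens a b z - h z * tens a b z)); last first.
    by move=> z _; rewrite mulrBl.
  rewrite intRB//; [|exact: CC_int_mul..].
  have := wg _ tab; rewrite wh// => /(can_inj (signrMK _)) E.
  by rewrite -[I _]/(Rintegral (@leb2 R) Om _) -E subrr.
exists N; split => // z Hz; apply: HN => H; apply: Hz => Oz.
by apply/eqP; rewrite -subr_eq0; apply/eqP; exact: H.
Qed.

Lemma H2star_sql2 u a b c : H2star l u a b c -> [/\ L2 a, L2 b & L2 c].
Proof. by move=> [[ux [uy [[_ _ _ ? ?] [? _]]]] _]. Qed.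

Lemma H2star_unique u a b c a' b' c' : H2star l u a b c -> H2star l u a' b' c' ->
  {ae mu, forall z, Om z -> [/\ a z = a' z, b z = b' z & c z = c' z]}.
Proof.
move=> H H'; have [la lb lc] := H2star_sql2 H; have [la' lb' lc'] := H2star_sql2 H'.
case: H => [[ux [uy [_ [_ [_ _ wa wb wc]]]]] _].
case: H' => [[ux' [uy' [_ [_ [_ _ wa' wb' wc']]]]] _].
have Ea := weak_deriv_unique la la' wa wa'.
have Eb := weak_deriv_unique lb lb' wb wb'.
have Ec := weak_deriv_unique lc lc' wc wc'.
by apply: filterS3 Ea Eb Ec => z h1 h2 h3 Oz; split; [exact: h1|exact: h2|exact: h3].
Qed.

(** The variational inequality quantifies over every choice of second weak derivatives of [u]. With
    uniqueness almost everywhere this reduces it to one convenient choice. *)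
Lemma bform_ae sigma (E : set P2) a b c a' b' c' p q r : measurable E -> E `<=` Om ->
  L2 a -> L2 b -> L2 c -> L2 a' -> L2 b' -> L2 c' -> L2 p -> L2 q -> L2 r ->
  {ae mu, forall z, Om z -> [/\ a z = a' z, b z = b' z & c z = c' z]} ->
  bform sigma E a b c (p \- a) (q \- b) (r \- c) =
  bform sigma E a' b' c' (p \- a') (q \- b') (r \- c').
Proof.
move=> mE EO la lb lc la' lb' lc' lp lq lr H; rewrite !(@bformE R l)//.
have B f g : L2 f -> L2 g -> L2 (f \- g) by move=> lf lg; apply: sql2D => //; exact: sql2N.
apply: (ae_eq_intR mO); try by apply: (@int1_meas _ _ _ mu); apply: plate_int => //; exact: B.
by apply: filterS H => z H Oz; have [h1 h2 h3] := H Oz; rewrite /plate /= h1 h2 h3.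
Qed.

Lemma sql20 : L2 (fun=> 0).
Proof. by apply: (sql2_bounded mO (M := 0)) => // z _; rewrite normr0. Qed.

Lemma H2star0 : H2star l (fun=> 0) (fun=> 0) (fun=> 0) (fun=> 0).
Proof.
have w0 vs : weak_deriv Om vs (fun=> 0) (fun=> 0).
  have z0 (f : P -> R) : I (fun z => 0 * f z) = 0.
    rewrite (@eq_intR _ _ _ mu Om _ (fun=> 0)); first exact: intR0.
    by move=> z _; rewrite mul0r.
  by move=> phi _; rewrite !intR_leb2 !z0 mulr0.
split.
  by exists (fun=> 0), (fun=> 0); split; [split; exact: sql20|split; [exact: sql20|split; exact: w0]].
by split => //; apply: continuous_CC => z; exact: cvg_cst.
Qed.

Lemma weak_derivN vs u g : int u -> int g -> weak_deriv Om vs u g ->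
  weak_deriv Om vs (fun z => - u z) (fun z => - g z).
Proof.
move=> iu ig w phi tp; have := w phi tp; rewrite !intR_leb2 => E.
rewrite (@eq_intR _ _ _ mu Om _ (fun z => - (u z * iter_derive vs phi z))); last by move=> z _; rewrite mulNr.
rewrite (@eq_intR _ _ _ mu Om (fun z => - g z * phi z) (fun z => - (g z * phi z))); last first.
  by move=> z _; rewrite mulNr.
rewrite !intRN//; last 2 first.
- by apply: CC_int_mul => //; exact: (test_fun_CC (vs := [::]) tp).
- by apply: CC_int_mul => //; exact: test_fun_CC.
by rewrite E mulrN.
Qed.

Lemma CCN w : CC w -> CC (fun z => - w z).
Proof. by move=> cw x; apply: cvgN; exact: cw. Qed.

Lemma CCB v w : CC v -> CC w -> CC (fun z => v z - w z).
Proof. by move=> cv cw x; apply: cvgB; [exact: cv|exact: cw]. Qed.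

Lemma H2starN u a b c : H2star l u a b c ->
  H2star l (fun z => - u z) (fun z => - a z) (fun z => - b z) (fun z => - c z).
Proof.
move=> [[ux [uy [[lu lux luy la lb] [lc [w1 w2 w3 w4 w5]]]]] [cu bc]].
split; last first.
  by split; [exact: CCN|move=> y /bc[-> ->]; rewrite oppr0].
have nn f : L2 f -> L2 (fun z => - f z) by exact: sql2N.
have wN vs g : L2 g -> weak_deriv Om vs u g -> weak_deriv Om vs (fun z => - u z) (fun z => - g z).
  by move=> lg; apply: weak_derivN; [exact: (sql2_int1' mO fO lu)|exact: (sql2_int1' mO fO lg)].
exists (fun z => - ux z), (fun z => - uy z).
exact (conj (And5 (nn _ lu) (nn _ lux) (nn _ luy) (nn _ la) (nn _ lb))
  (conj (nn _ lc) (And5 (wN _ _ lux w1) (wN _ _ luy w2) (wN _ _ la w3) (wN _ _ lb w4) (wN _ _ lc w5)))).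
Qed.

End H2starTheory.

(** * Sigma-finiteness of the plane measure *)

Section SigmaFinite.
Variable R : realType.
Local Notation P2 := (measurableTypeR R * measurableTypeR R)%type.
Local Notation leb := (@lebesgue_measure R).
Local Notation mu := (@mu2 R).

Lemma mu2_sigma_finite : sigma_finite setT mu.
Proof.
exists (fun n => box (- n%:R) n%:R (- n%:R) n%:R : set P2).
  apply/seteqP; split => // z _.
  exists (Num.truncn (`|z.1| + `|z.2|)).+1 => //.
  have H := truncnS_gt (`|z.1| + `|z.2|).
  have [h1 h2] := (normr_ge0 z.1, normr_ge0 z.2).
  by rewrite boxE/= -!ltr_norml; split; apply: le_lt_trans H; rewrite ?lerDl ?lerDr.
by move=> n; split; [exact: box_measurable|rewrite mu2_box ?ltry// ge0_cp].
Qed.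

(* The library does not register products of sigma-finite measures as sigma-finite. *)
Definition mu2s : set P2 -> \bar R := (leb \x leb)%E.
HB.instance Definition _ := Measure.copy mu2s (leb \x leb)%E.
HB.instance Definition _ := Measure_isSigmaFinite.Build _ _ _ mu2s mu2_sigma_finite.

End SigmaFinite.

(** * Limits of functions in H^2_* *)

Section UltraLimitsOfH2.
Variables (R : realType) (l : R).
Local Notation P := (R * R)%type.
Local Notation P2 := (measurableTypeR R * measurableTypeR R)%type.
Local Notation Om := (Omega l : set P2).
Local Notation mu := (@mu2 R).
Local Notation I := (intR mu Om).
Local Notation int := (int1 mu Om).
Local Notation L2 := (sql2 mu Om).
Local Notation CC w := {within clOmega l, continuous w}.
Let mO := Omega_measurable l.
Let fO := mu2_Omega_fin l.
Hypothesis l0 : 0 < l.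
Variable U : set_system nat.
Hypothesis UU : UltraFilter U.

Lemma L2_weak_limit (f_ : nat -> P -> R) (K : R) : (forall i, L2 (f_ i)) ->
  (forall i, I (fun z => f_ i z ^+ 2) <= K) ->
  exists f, [/\ L2 f, I (fun z => f z ^+ 2) <= K &
    forall g, L2 g -> (fun i => I (fun z => f_ i z * g z)) @ U --> I (fun z => f z * g z)].
Proof.
move=> h1 h2.
exact (@weak_limit_L2 _ _ R (@mu2s R) Om mO fO nat U UU f_ K h1 h2).
Qed.

Lemma clOmega00 : clOmega l (0, 0).
Proof.
split => /=; apply/andP; split; rewrite ?oppr_le0 ?lexx//; try exact: ltW.
exact: pi_ge0.
Qed.

Section UniformLimit.
Variables (u_ : nat -> P -> R) (u : P -> R) (M : R).
Hypothesis uM : forall i z, clOmega l z -> `|u_ i z| <= M.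
Hypothesis cu : forall z, clOmega l z -> (fun i => u_ i z) @ U --> u z.
Hypothesis equi : forall e : R, 0 < e -> exists2 d : R, 0 < d & forall i z w,
  clOmega l z -> clOmega l w -> `|z.1 - w.1| < d -> `|z.2 - w.2| < d -> `|u_ i z - u_ i w| <= e.

Lemma limit_modulus (e : R) : 0 < e -> exists2 d : R, 0 < d & forall z w,
  clOmega l z -> clOmega l w -> `|z.1 - w.1| < d -> `|z.2 - w.2| < d -> `|u z - u w| <= e.
Proof.
move=> /equi[d d0 H]; exists d => // z w Cz Cw h1 h2.
have c : (fun i => `|u_ i z - u_ i w|) @ U --> `|u z - u w|.
  by apply: cvg_norm; apply: cvgB; exact: cu.
by apply: (ultra_le UU c (cvg_cst e)) => i; exact: H.
Qed.

Lemma limit_CC : CC u.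
Proof.
apply/within_continuousP2 => z Cz e e0; have e2 : 0 < e / 2 by rewrite divr_gt0.
have [d d0 H] := limit_modulus e2; exists d => // w Cw h1 h2.
by apply: le_lt_trans (H z w Cz Cw h1 h2) _; rewrite ltr_pdivrMr// ltr_pMr// ltr1n.
Qed.

(* If the closeness fails, the ultrafilter contains the set of bad indices; the bad points then
   converge along it, which contradicts equicontinuity at their limit. *)
Lemma limit_uniform (e : R) : 0 < e -> U [set i | forall z, clOmega l z -> `|u_ i z - u z| <= e].
Proof.
move=> e0; have [//|] := in_ultra_setVsetC [set i | forall z, clOmega l z -> `|u_ i z - u z| <= e] UU.
move=> UB.
have o := clOmega00.
have /choice[z_ Hz] : forall i, exists z, clOmega l z /\
    (~ (forall z, clOmega l z -> `|u_ i z - u z| <= e) -> e < `|u_ i z - u z|).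
  move=> i; have [H|H] := pselect (forall z, clOmega l z -> `|u_ i z - u z| <= e); first by exists (0, 0).
  move: (H) => /existsNP[z /not_implyP[Cz /negP]]; rewrite -ltNge => h; by exists z.
have [i|x cx _] := @ultra_bounded_cvg R nat U (fun i => (z_ i).1) pi UU.
  have [[/andP[a1 a2] _] _] := Hz i; by rewrite ger0_norm.
have [i|y cy _] := @ultra_bounded_cvg R nat U (fun i => (z_ i).2) l UU.
  have [[_ /andP[a1 a2]] _] := Hz i; by rewrite ler_norml a1.
have Cxy : clOmega l (x, y).
  split => /=; apply/andP; split.
  - by apply: (ultra_le UU (cvg_cst 0) cx) => i; have [[/andP[]]] := Hz i.
  - by apply: (ultra_le UU cx (cvg_cst pi)) => i; have [[/andP[]]] := Hz i.
  - by apply: (ultra_le UU (cvg_cst (- l)) cy) => i; have [[_ /andP[]]] := Hz i.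
  - by apply: (ultra_le UU cy (cvg_cst l)) => i; have [[_ /andP[]]] := Hz i.
have e4 : 0 < e / 4 by rewrite divr_gt0.
have [d1 d10 H1] := equi e4.
have [d2 d20 H2] := limit_modulus e4.
have d0 : 0 < Num.min d1 d2 by rewrite lt_min d10.
have [i [/= Bi [[hx hy] hu]]] := ultra_ex UU (filterI UB (filterI (filterI (ultra_near UU cx d0) (ultra_near UU cy d0)) (ultra_near UU (cu Cxy) e4))).
have [Cz /(_ Bi)] := Hz i.
move: hx hy; rewrite !lt_min => /andP[hx1 hx2] /andP[hy1 hy2].
have h1 := H1 i (x, y) (z_ i) Cxy Cz hx1 hy1.
have h2 := H2 (x, y) (z_ i) Cxy Cz hx2 hy2.
move: h1 h2 hu; move: (u_ i (x, y)) (u_ i (z_ i)) (u (x, y)) (u (z_ i)) => p q r s.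
move: (e0); clear => e0.
rewrite ler_norml => /andP[a1 a2]; rewrite ler_norml => /andP[b1 b2]; rewrite ltr_norml => /andP[c1 c2].
rewrite ltNge => /negP; case; rewrite ler_norml; apply/andP; split; lra.
Qed.

End UniformLimit.

(** In the integration by parts formula the side with [u_] converges by uniform convergence, the
    derivative of the test function being bounded, and the side with [g_] by weak convergence. *)
Lemma weak_deriv_limit (u_ g_ : nat -> P -> R) (u g : P -> R) vs :
  (forall i, CC (u_ i)) -> CC u ->
  (forall e : R, 0 < e -> U [set i | forall z, clOmega l z -> `|u_ i z - u z| <= e]) ->
  (forall h, L2 h -> (fun i => I (fun z => g_ i z * h z)) @ U --> I (fun z => g z * h z)) ->
  (forall i, weak_deriv Om vs (u_ i) (g_ i)) -> weak_deriv Om vs u g.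
Proof.
move=> cu_ cu unif wg wd phi tp; rewrite !intR_leb2.
have cD := test_fun_CC (vs := vs) tp.
have cP : CC phi := test_fun_CC (vs := [::]) tp.
have c1 : (fun i => I (fun z => u_ i z * iter_derive vs phi z)) @ U -->
    (-1) ^+ size vs * I (fun z => g z * phi z).
  rewrite (_ : (fun i => _) = fun i => (-1) ^+ size vs * I (fun z => g_ i z * phi z)).
    by apply: ultraZ => //; apply: wg; exact: CC_sql2.
  by apply/funext => i; exact: wd.
apply: (ultra_unique UU _ c1).
have [C HC] := within_bounded cD.
have C0 : 0 < `|C| + 1 by rewrite ltr_wpDl.
have A0 : 0 < I (fun=> 1) + 1 by rewrite ltr_wpDl// intR_ge0.
apply/cvgrPdist_lt => e e0.
have e2 : 0 < e / 2 by rewrite divr_gt0.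
have e' : 0 < e / 2 / (`|C| + 1) / (I (fun=> 1) + 1) by rewrite !divr_gt0.
apply: filterS (unif _ e') => i /= Hi.
have i1 : int (u \* iter_derive vs phi) by apply: CC_int_mul => //; exact: CC_int.
have i2 : int (u_ i \* iter_derive vs phi) by apply: CC_int_mul => //; exact: CC_int.
have ic : int (fun=> 1) by apply: CC_int; apply: continuous_CC => z; exact: cvg_cst.
rewrite -intRB//.
have -> : e = e / 2 + e / 2 by field.
apply: le_lt_trans (_ : e / 2 < _); last by rewrite ltrDl.
apply: le_trans (_ : I (fun z => e / 2 / (I (fun=> 1) + 1) * 1) <= _); last first.
  rewrite (intRZ mO)// mulrAC ler_pdivrMr// ler_pM2l// lerDl//.
apply: norm_intR_le => //; [exact: int1B|exact: int1Z|].
move=> z Oz; have Cz := Omega_sub Oz; rewrite -mulrBl normrM mulr1 distrC.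
apply: le_trans (_ : e / 2 / (`|C| + 1) / (I (fun=> 1) + 1) * (`|C| + 1) <= _).
  apply: ler_pM => //; first exact: Hi.
  by apply: le_trans (HC z Cz) _; apply: le_trans (ler_norm _) _; rewrite lerDl.
by rewrite le_eqVlt; apply/orP; left; apply/eqP; field; rewrite !gt_eqF.
Qed.

(** The first derivatives have no bound among the hypotheses; [ux_bound] and [uy_bound] supply one,
    so that they too have weak limits in L^2. The boundary values pass to the limit pointwise. *)
Lemma family_limit (u_ a_ b_ c_ : nat -> P -> R) (M K : R) :
  (forall i, H2star l (u_ i) (a_ i) (b_ i) (c_ i)) ->
  (forall i z, clOmega l z -> `|u_ i z| <= M) ->
  (forall i, [/\ I (fun z => a_ i z ^+ 2) <= K, I (fun z => b_ i z ^+ 2) <= K &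
                 I (fun z => c_ i z ^+ 2) <= K]) ->
  exists u a b c, [/\ H2star l u a b c, forall z, clOmega l z -> (fun i => u_ i z) @ U --> u z,
    forall e : R, 0 < e -> U [set i | forall z, clOmega l z -> `|u_ i z - u z| <= e] &
    [/\ forall h, L2 h -> (fun i => I (fun z => a_ i z * h z)) @ U --> I (fun z => a z * h z),
        forall h, L2 h -> (fun i => I (fun z => b_ i z * h z)) @ U --> I (fun z => b z * h z) &
        forall h, L2 h -> (fun i => I (fun z => c_ i z * h z)) @ U --> I (fun z => c z * h z)]].
Proof.
move=> Hu uM uK.
have K0 : 0 <= K.
  by have [h _ _] := uK 0%N; apply: le_trans h; apply: intR_ge0 => z _; exact: sqr_ge0.
have /choice[ux_ /choice[uy_ HH]] : forall i, exists ux uy, H2 Om (u_ i) ux uy (a_ i) (b_ i) (c_ i).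
  by move=> i; case: (Hu i).
have cu_ i : CC (u_ i) by case: (Hu i) => _ [].
have bc_ i y : - l < y < l -> u_ i (0, y) = 0 /\ u_ i (pi, y) = 0.
  by case: (Hu i) => _ [_]; exact.
have reg i : regular l (u_ i) (ux_ i) (uy_ i) (a_ i) (b_ i).
  by apply: H2_regular (HH i) (cu_ i) (bc_ i).
have uMO i z : Om z -> `|u_ i z| <= M by move=> /Omega_sub; exact: uM.
have [Bx HBx] := ux_bound l M K.
have [By HBy] := uy_bound l0 M K0.
have ex_u z : exists x : R, clOmega l z -> (fun i => u_ i z) @ U --> x.
  have [Cz|] := pselect (clOmega l z); last by exists 0.
  have [x cx _] := ultra_bounded_cvg UU (fun i => uM i z Cz).
  by exists x.
have /choice[u cu] := ex_u.
have equi (e : R) : 0 < e -> exists2 d : R, 0 < d & forall i z w,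
  clOmega l z -> clOmega l w -> `|z.1 - w.1| < d -> `|z.2 - w.2| < d -> `|u_ i z - u_ i w| <= e.
  move=> e0; have [d d0 H] := equicontinuity l0 M K0 e0; exists d => // i.
  by have [h1 h2 _] := uK i; exact: H (reg i) (uMO i) h1 h2.
have CCu := limit_CC cu equi.
have unif (e : R) (e0 : 0 < e) := limit_uniform cu equi e0.
have l2a i : L2 (a_ i) by case: (H2star_sql2 (Hu i)).
have l2b i : L2 (b_ i) by case: (H2star_sql2 (Hu i)).
have l2c i : L2 (c_ i) by case: (H2star_sql2 (Hu i)).
have [a [la _ wa]] := L2_weak_limit l2a (fun i => let: And3 h _ _ := uK i in h).
have [b [lb _ wb]] := L2_weak_limit l2b (fun i => let: And3 _ h _ := uK i in h).
have [c [lc _ wc]] := L2_weak_limit l2c (fun i => let: And3 _ _ h := uK i in h).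
have l2x i : L2 (ux_ i) by case: (reg i) => -[].
have l2y i : L2 (uy_ i) by case: (reg i) => -[].
have [ux [lux _ wx]] : exists f, [/\ L2 f, I (fun z => f z ^+ 2) <= Bx &
    forall g, L2 g -> (fun i => I (fun z => ux_ i z * g z)) @ U --> I (fun z => f z * g z)].
  by apply: L2_weak_limit => // i; have [h1 h2 _] := uK i; exact: HBx (reg i) (uMO i) h1.
have [uy [luy _ wy]] : exists f, [/\ L2 f, I (fun z => f z ^+ 2) <= By &
    forall g, L2 g -> (fun i => I (fun z => uy_ i z * g z)) @ U --> I (fun z => f z * g z)].
  by apply: L2_weak_limit => // i; have [h1 h2 _] := uK i; exact: HBy (reg i) (uMO i) h1 h2.
exists u, a, b, c; split => //; split.
  exists ux, uy; split; first by split => //; exact: CC_sql2.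
  split=> //; have W := weak_deriv_limit cu_ CCu unif.
  split.
  - by apply: W wx _ => i; case: (HH i) => _ [_ []].
  - by apply: W wy _ => i; case: (HH i) => _ [_ []].
  - by apply: W wa _ => i; case: (HH i) => _ [_ []].
  - by apply: W wb _ => i; case: (HH i) => _ [_ []].
  - by apply: W wc _ => i; case: (HH i) => _ [_ []].
split => // y yl.
have C0 x : 0 <= x <= pi -> clOmega l (x, y).
  by move=> hx; split => //=; case/andP: yl => y1 y2; rewrite !ltW.
have p0 := pi_ge0 R.
split; apply: (ultra_unique UU (cu _ (C0 _ _))); rewrite ?lexx ?p0//.
- rewrite (_ : (fun i => _) = fun=> 0); first exact: cvg_cst.
  by apply/funext => i; have [] := bc_ i y yl.
- rewrite (_ : (fun i => _) = fun=> 0); first exact: cvg_cst.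
  by apply/funext => i; have [] := bc_ i y yl.
Qed.

End UltraLimitsOfH2.

Lemma summand_le (R : realType) (p q r : R) : 0 <= p -> 0 <= q -> 0 <= r ->
  [/\ p <= p + q + 2 * r, r <= p + q + 2 * r & q <= p + q + 2 * r].
Proof. by move=> p0 q0 r0; split; lra. Qed.

Lemma le_limit_arith (R : realType) (v1 v2 v3 v4 v5 e : R) : v3 <= v4 -> `|v2 - v3| <= e / 2 ->
  `|v1 - v2| < e / 4 -> `|v5 - v4| < e / 4 -> v1 <= v5 + e.
Proof.
move=> h1; rewrite ler_norml => /andP[h2 h3]; rewrite !ltr_norml => /andP[h4 h5] /andP[h6 h7].
lra.
Qed.

Lemma le_sup_arith (R : realType) (p q r t e : R) : t < e / 2 -> p - t < r -> r <= q + e / 2 ->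
  p <= q + e.
Proof. by move=> h1 h2 h3; lra. Qed.

(** * Existence of maximizers *)

Section ObstacleProblem.
Variables (R : realType) (l sigma A B : R).
Local Notation P := (R * R)%type.
Local Notation P2 := (measurableTypeR R * measurableTypeR R)%type.
Local Notation Om := (Omega l : set P2).
Local Notation mu := (@mu2 R).
Local Notation I := (intR mu Om).
Local Notation int := (int1 mu Om).
Local Notation L2 := (sql2 mu Om).
Local Notation CC w := {within clOmega l, continuous w}.
Variables (psim psip : P -> R) (D : set P).
Let mO := Omega_measurable l.
Hypothesis l0 : 0 < l.
Hypothesis s01 : 0 < sigma < 1.
Hypothesis A0 : 0 < A.
Hypothesis B0 : 0 <= B.
Hypothesis cm : CC psim.
Hypothesis cp : CC psip.
Hypothesis psi0 : forall z, clOmega l z -> psim z <= 0 <= psip z.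
Hypothesis mD : measurable (D : set P2).
Hypothesis DO : D `<=` Omega l.

(** The common form of both problems: E_1 has A = alpha and B = beta - alpha, E_2 has A = 1 and B =
    0 with the weight moved into the pairing. *)
Definition SolG (pair : (P -> R) -> R) (u : P -> R) :=
  inK l psim psip u /\
  forall uxx uxy uyy, H2star l u uxx uxy uyy ->
  forall phi pxx pxy pyy, inK l psim psip phi -> H2star l phi pxx pxy pyy ->
    pair (fun z => phi z - u z) <=
      A * bform sigma (Omega l) uxx uxy uyy (pxx \- uxx) (pxy \- uxy) (pyy \- uyy)
      + B * bform sigma D uxx uxy uyy (pxx \- uxx) (pxy \- uxy) (pyy \- uyy).

Lemma inK_bounded : exists M : R, forall v, inK l psim psip v ->
  forall z, clOmega l z -> `|v z| <= M.
Proof.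
have [M HM] := within_bounded cm; have [N HN] := within_bounded cp.
exists (M + N) => v [_ Hv] z Cz; have /andP[h1 h2] := Hv z Cz.
have := HM z Cz; have := HN z Cz; rewrite !ler_norml => /andP[n1 n2] /andP[m1 m2].
have := psi0 Cz => /andP[p1 p2]; apply/andP; split.
  apply: le_trans h1; apply: le_trans m1; rewrite lerN2 lerDl.
  exact: le_trans p2 n2.
by apply: le_trans h2 (le_trans n2 _); rewrite lerDr; apply: le_trans (HM z Cz).
Qed.

Lemma inK0 : inK l psim psip (fun=> 0).
Proof.
by split; [exists (fun=> 0), (fun=> 0), (fun=> 0); exact: H2star0|move=> z Cz; exact: psi0].
Qed.

Lemma inK_CC v : inK l psim psip v -> CC v.
Proof. by move=> [[vxx [vxy [vyy [_ [cv _]]]]] _]; exact: cv. Qed.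

Lemma bform_ge0 (E : set P2) a b c : measurable E -> E `<=` Om -> L2 a -> L2 b -> L2 c ->
  0 <= bform sigma E a b c a b c.
Proof.
move=> mE EO la lb lc; apply: le_trans (bform_coercive s01 mE EO la lb lc).
case/andP: s01 => _ s1; apply: mulr_ge0; first by rewrite subr_ge0 ltW.
apply: intR_ge0 => z _; rewrite mulr_ge0// ?indicE// !addr_ge0 ?sqr_ge0//.
by rewrite mulr_ge0 ?sqr_ge0.
Qed.

Lemma bform_opp (E : set P2) a b c : measurable E -> E `<=` Om -> L2 a -> L2 b -> L2 c ->
  bform sigma E a b c ((fun=> 0) \- a) ((fun=> 0) \- b) ((fun=> 0) \- c) =
  - bform sigma E a b c a b c.
Proof.
move=> mE EO la lb lc; rewrite !(@bformE R l)// -intRN//; last exact: plate_int.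
by apply: eq_intR => z _; rewrite /plate /=; ring.
Qed.

Lemma bform0l (E : set P2) p q r : measurable E -> E `<=` Om ->
  bform sigma E (fun=> 0) (fun=> 0) (fun=> 0) p q r = 0.
Proof.
move=> mE EO; rewrite (@bformE R l)// (@eq_intR _ _ _ mu Om _ (fun=> 0)) ?intR0//.
by move=> z _; rewrite /plate; ring.
Qed.

(** With the test function 0 the right-hand side is minus the energy. Its part over [D] is
    non-negative and is dropped; A (1 - sigma) is the coercivity constant of the rest. *)
Lemma energy_bound pair u a b c (m : R) : SolG pair u -> H2star l u a b c ->
  `|pair (fun z => 0 - u z)| <= m ->
  [/\ I (fun z => a z ^+ 2) <= m / (A * (1 - sigma)),
      I (fun z => b z ^+ 2) <= m / (A * (1 - sigma)) &
      I (fun z => c z ^+ 2) <= m / (A * (1 - sigma))].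
Proof.
move=> [_ H] Hu pm; have [la lb lc] := H2star_sql2 Hu.
have := H _ _ _ Hu _ _ _ _ inK0 (H2star0 l).
rewrite !bform_opp// => {}H.
have QD := bform_ge0 mD DO la lb lc.
have QO := bform_coercive s01 mO (@subset_refl _ Om) la lb lc.
case/andP: (s01) => _ s1; have s2 : 0 < 1 - sigma by rewrite subr_gt0.
have key : I (fun z => (a z ^+ 2 + c z ^+ 2 + 2 * b z ^+ 2) * \1_Om z) <= m / (A * (1 - sigma)).
  rewrite ler_pdivlMr ?mulr_gt0// mulrC -mulrA.
  apply: le_trans (_ : A * bform sigma (Omega l) a b c a b c <= _).
    by rewrite ler_pM2l.
  apply: le_trans pm; rewrite -normrN; apply: le_trans (ler_norm _).
  rewrite lerNr; apply: le_trans H _; rewrite !mulrN gerDl oppr_le0.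
  exact: mulr_ge0.
have i1 : int (fun z => (a z ^+ 2 + c z ^+ 2 + 2 * b z ^+ 2) * \1_Om z).
  apply: (int1_indic mO mO); apply: int1D => //; last by apply: int1Z => //; exact: sql2_int1.
  by apply: int1D => //; exact: sql2_int1.
have H3 z := summand_le (sqr_ge0 (a z)) (sqr_ge0 (c z)) (sqr_ge0 (b z)).
by split; apply: le_trans key; apply: le_intR => // [|z Oz]; try exact: sql2_int1;
  rewrite indicE mem_set// mulr1; case: (H3 z).
Qed.

(** This makes the set of values whose supremum is studied nonempty. *)
Lemma sol0 pair : (forall w, CC w -> pair w = 0) -> SolG pair (fun=> 0).
Proof.
move=> p0; split; first exact: inK0.
move=> a b c Ha phi p q r Kphi Hphi.
have [la lb lc] := H2star_sql2 Ha; have [lp lq lr] := H2star_sql2 Hphi.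
have l00 := sql20 l.
have E := H2star_unique Ha (H2star0 l).
rewrite (bform_ae sigma mO (@subset_refl _ Om) la lb lc l00 l00 l00 lp lq lr E).
rewrite (bform_ae sigma mD DO la lb lc l00 l00 l00 lp lq lr E).
rewrite !bform0l// !mulr0 addr0 p0//.
by apply: CCB; [exact: inK_CC|exact: inK_CC inK0].
Qed.

Lemma Ainf_has_ub (u : P -> R) : CC u -> has_ubound [set `|u z| | z in clOmega l].
Proof. by move=> /within_bounded[M HM]; exists M => _ [z Cz <-]; exact: HM. Qed.

Lemma Ainf_le (u v : P -> R) (e : R) : CC u ->
  (forall z, clOmega l z -> `|v z| <= `|u z| + e) -> Ainf l v <= Ainf l u + e.
Proof.
move=> cu H; apply: ge_sup; first by exists `|v (0, 0)|, (0, 0) => //; exact: clOmega00.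
move=> _ [z Cz <-]; apply: le_trans (H z Cz) _; rewrite lerD2r.
by apply: (ub_le_sup (Ainf_has_ub cu)); exists z.
Qed.

(* [pr] abstracts the pairing; the three cases of the theorem are instances. *)
Section Maximizer.
Variables (X : Type) (F : set X) (pr : X -> (P -> R) -> R) (C : R).
Hypothesis C0 : 0 <= C.
Hypothesis pr0 : exists2 x, F x & forall w, CC w -> pr x w = 0.
Hypothesis pr_bound : forall x w (m : R), F x -> CC w ->
  (forall z, clOmega l z -> `|w z| <= m) -> `|pr x w| <= C * m.
Hypothesis prB : forall x v w, F x -> CC v -> CC w ->
  pr x (fun z => v z - w z) = pr x v - pr x w.
(** Weak-* compactness of the set of data, tested against continuous functions only: solutions are
    continuous up to the boundary. *)
Hypothesis pr_closed : forall (U : set_system nat) (x_ : nat -> X), UltraFilter U ->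
  (forall i, F (x_ i)) ->
  exists2 x, F x & forall w, CC w -> (fun i => pr (x_ i) w) @ U --> pr x w.

Lemma sol_limit (U : set_system nat) (x_ : nat -> X) (u_ a_ b_ c_ : nat -> P -> R) (x : X)
    (u a b c : P -> R) : UltraFilter U -> (forall i, F (x_ i)) ->
  F x -> (forall w, CC w -> (fun i => pr (x_ i) w) @ U --> pr x w) ->
  (forall i, SolG (pr (x_ i)) (u_ i)) ->
  (forall i, H2star l (u_ i) (a_ i) (b_ i) (c_ i)) -> H2star l u a b c ->
  (forall z, clOmega l z -> (fun i => u_ i z) @ U --> u z) ->
  (forall e : R, 0 < e -> U [set i | forall z, clOmega l z -> `|u_ i z - u z| <= e]) ->
  (forall h, L2 h -> (fun i => I (fun z => a_ i z * h z)) @ U --> I (fun z => a z * h z)) ->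
  (forall h, L2 h -> (fun i => I (fun z => b_ i z * h z)) @ U --> I (fun z => b z * h z)) ->
  (forall h, L2 h -> (fun i => I (fun z => c_ i z * h z)) @ U --> I (fun z => c z * h z)) ->
  SolG (pr x) u.
Proof.
move=> UU Fx_ Fx cx sol Hu_ Hu cu unif wa wb wc.
split.
  split; first by exists a, b, c.
  move=> z Cz; apply/andP; split.
    by apply: (ultra_le UU (cvg_cst (psim z)) (cu z Cz)) => i; have [[_ /(_ z Cz)/andP[]]] := sol i.
  by apply: (ultra_le UU (cu z Cz) (cvg_cst (psip z))) => i; have [[_ /(_ z Cz)/andP[]]] := sol i.
move=> a' b' c' Hu' phi p q r Kphi Hphi.
have [la lb lc] := H2star_sql2 Hu; have [la' lb' lc'] := H2star_sql2 Hu'.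
have [lp lq lr] := H2star_sql2 Hphi.
have E := H2star_unique Hu' Hu.
rewrite (bform_ae sigma mO (@subset_refl _ Om) la' lb' lc' la lb lc lp lq lr E).
rewrite (bform_ae sigma mD DO la' lb' lc' la lb lc lp lq lr E) => {E Hu' la' lb' lc' a' b' c'}.
have l_ i := H2star_sql2 (Hu_ i).
have BA f g : L2 f -> L2 g -> L2 (f \- (g \+ g)).
  by move=> lf lg; apply: sql2D => //; apply: sql2N => //; exact: sql2D.
(* The second arguments no longer depend on [i], so [r_] is affine in [a_ i, b_ i, c_ i] and
   converges under weak convergence. *)
pose r_ i := A * (bform sigma (Omega l) (a_ i) (b_ i) (c_ i) (p \- (a \+ a)) (q \- (b \+ b)) (r \- (c \+ c)) +
    bform sigma (Omega l) a b c a b c) +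
  B * (bform sigma D (a_ i) (b_ i) (c_ i) (p \- (a \+ a)) (q \- (b \+ b)) (r \- (c \+ c)) +
    bform sigma D a b c a b c).
have cr : r_ @ U --> A * bform sigma (Omega l) a b c (p \- a) (q \- b) (r \- c) +
    B * bform sigma D a b c (p \- a) (q \- b) (r \- c).
  rewrite -(@bform_diff R l sigma Om)// -(@bform_diff R l sigma D)//.
  apply: ultraD => //; apply: ultraZ => //; apply: ultraD => //; try exact: cvg_cst.
  - by apply: (@bform_weak R l) => //; exact: BA.
  - by apply: (@bform_weak R l) => //; exact: BA.
have CCu : CC u by case: Hu => _ [].
have CCphi : CC phi := inK_CC Kphi.
have CCu_ i : CC (u_ i) by case: (sol i) => /inK_CC.
have Cup := CCB CCphi CCu.
apply/ler_addgt0Pr => e e0.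
have e2 : 0 < e / 2 by rewrite divr_gt0.
have C1 : 0 < C + 1 by rewrite ltr_wpDl.
have e3 : 0 < e / 2 / (C + 1) by rewrite divr_gt0.
have e4 : 0 < e / 4 by rewrite divr_gt0.
(* One index suffices: the errors are e / 2 for replacing [u_ i] by [u] in the pairing, e / 4 for
   the datum and e / 4 for [r_]. *)
have [i [/= hu [hp hr]]] := ultra_ex UU (filterI (unif _ e3)
   (filterI (ultra_near UU (cx _ Cup) e4) (ultra_near UU cr e4))).
have H1 : pr (x_ i) (fun z => phi z - u_ i z) <= r_ i.
  have [_ /(_ _ _ _ (Hu_ i) _ _ _ _ Kphi Hphi) H] := sol i.
  apply: le_trans H _; have [la_ lb_ lc_] := l_ i.
  apply: lerD; [apply: ler_wpM2l; first exact: ltW|apply: ler_wpM2l => //].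
    by apply: (@bform_diff_le R l sigma s01).
  by apply: (@bform_diff_le R l sigma s01).
(* Datum and argument of the pairing vary together; the bound [C], uniform over [F], and uniform
   convergence of [u_] separate the two. *)
have H2 : `|pr (x_ i) (fun z => phi z - u z) - pr (x_ i) (fun z => phi z - u_ i z)| <= e / 2.
  rewrite -prB//; last exact: CCB.
  apply: le_trans (_ : C * (e / 2 / (C + 1)) <= _).
    apply: pr_bound => //; first by apply: CCB => //; exact: CCB.
    move=> z Cz; rewrite (_ : _ - _ = u_ i z - u z); [exact: hu|ring].
  rewrite mulrA ler_pdivrMr// mulrC ler_pM2l// lerDl//.
exact: le_limit_arith H1 H2 hp hr.
Qed.

Theorem maximizer_exists : exists x, is_maximizer F (fun x => SolG (pr x)) l x.
Proof.
have [M HM] := inK_bounded.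
(* The values over all pairs of a datum and a solution for it, so that no solution has to be
   selected for a given datum. *)
pose S := [set Ainf l u | u in [set u | exists2 x, F x & SolG (pr x) u]].
have hS : has_sup S.
  have [x Fx px] := pr0.
  split; first by exists (Ainf l (fun=> 0)), (fun=> 0) => //; exists x => //; exact: sol0.
  exists M => _ [u [y Fy [Ku _]] <-]; apply: ge_sup.
    by exists `|u (0, 0)|, (0, 0) => //; exact: clOmega00.
  by move=> _ [z Cz <-]; exact: HM.
have ex n : exists xu : X * (P -> R) * ((P -> R) * (P -> R) * (P -> R)),
    [/\ F xu.1.1, SolG (pr xu.1.1) xu.1.2, H2star l xu.1.2 xu.2.1.1 xu.2.1.2 xu.2.2 &
    sup S - n.+1%:R^-1 < Ainf l xu.1.2].
  have n0 : 0 < n.+1%:R^-1 :> R by rewrite invr_gt0.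
  have [_ [u [x Fx Sx] <-] Hu] := sup_adherent n0 hS.
  have [[[a [b [c Hc]]] _] _] := Sx.
  by exists ((x, u), ((a, b), c)).
have [s Hs] := choice ex.
(* The ultrafilter refines the filter of eventual properties, so the maximizing property of the
   sequence holds along it. *)
have [U [UU subU]] := @ultraFilterLemma nat \oo _.
have Hu i : H2star l (s i).1.2 (s i).2.1.1 (s i).2.1.2 (s i).2.2 by case: (Hs i).
have Fs i : F (s i).1.1 by case: (Hs i).
have Ss i : SolG (pr (s i).1.1) (s i).1.2 by case: (Hs i).
have uM i z : clOmega l z -> `|(s i).1.2 z| <= M.
  by apply: HM; case: (Ss i).
have uK i := energy_bound (m := C * M) (Ss i) (Hu i) _.
have [|u [a [b [c [Huabc cu unif [wa wb wc]]]]]] :=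
    @family_limit R l l0 U UU (fun i => (s i).1.2) _ _ _ M (C * M / (A * (1 - sigma))) Hu uM.
  apply: uK => i; apply: pr_bound => //.
    by apply: CCB; [exact: inK_CC inK0|apply: inK_CC; case: (Ss i)].
  by move=> z Cz; rewrite sub0r normrN; exact: uM.
have [x Fx cx] := pr_closed UU Fs.
have Sx : SolG (pr x) u := sol_limit UU Fs Fx cx Ss Hu Huabc cu unif wa wb wc.
exists x; split => //; exists u; split => // y v Fy Sv.
apply: le_trans (_ : sup S <= _).
  by apply: (ub_le_sup hS.2); exists v => //; exists y.
have CCu : CC u by case: Huabc => _ [].
apply/ler_addgt0Pr => e e0; have e2 : 0 < e / 2 by rewrite divr_gt0.
have near_inv : U [set i | i.+1%:R^-1 < e / 2].
  apply: subU; have := @near_infty_natSinv_lt R (PosNum e2); exact.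
have [i [/= h1 h2]] := ultra_ex UU (filterI (unif _ e2) near_inv).
have [_ _ _ h3] := Hs i.
have h4 : Ainf l (s i).1.2 <= Ainf l u + e / 2.
  apply: Ainf_le => // z Cz; rewrite -lerBlDl.
  by apply: le_trans (lerB_dist _ _) _; exact: h1.
exact: le_sup_arith h2 h3 h4.
Qed.

End Maximizer.

End ObstacleProblem.

(** * The dual ball and the L^p balls as sets of data *)

Section Instances.
Variables (R : realType) (l : R).
Local Notation P := (R * R)%type.
Local Notation P2 := (measurableTypeR R * measurableTypeR R)%type.
Local Notation Om := (Omega l : set P2).
Local Notation mu := (@mu2 R).
Local Notation I := (intR mu Om).
Local Notation int := (int1 mu Om).
Local Notation CC w := {within clOmega l, continuous w}.
Let mO := Omega_measurable l.
Let fO := mu2_Omega_fin l.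
Hypothesis l0 : 0 < l.

Lemma supnorm_le (w : P -> R) (m : R) : (forall z, clOmega l z -> `|w z| <= m) ->
  supnorm l w <= m.
Proof.
move=> H; apply: ge_sup; first by exists `|w (0, 0)|, (0, 0) => //; exact: clOmega00.
by move=> _ [z Cz <-]; exact: H.
Qed.

Lemma supnorm_ub (w : P -> R) z : CC w -> clOmega l z -> `|w z| <= supnorm l w.
Proof. by move=> cw Cz; apply: (ub_le_sup (Ainf_has_ub cw)); exists z. Qed.

Lemma CCL (k : R) (v w : P -> R) : CC v -> CC w -> CC (fun z => k * v z + w z).
Proof.
move=> cv cw x; apply: cvgD; last exact: cw.
by apply: cvgMr; exact: cv.
Qed.

Lemma dual0 : dualC0_ball l (fun=> 0).
Proof.
split=> // [a g h _ _|w cw]; first by rewrite mulr0 addr0.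
rewrite normr0; apply: le_trans (supnorm_ub cw (clOmega00 l0)); exact: normr_ge0.
Qed.

Lemma dual_bound f w (m : R) : dualC0_ball l f -> CC w ->
  (forall z, clOmega l z -> `|w z| <= m) -> `|f w| <= 1 * m.
Proof.
by move=> [_ _ H] cw wm; rewrite mul1r; apply: le_trans (H _ cw) _; exact: supnorm_le.
Qed.

Lemma dualB f v w : dualC0_ball l f -> CC v -> CC w ->
  f (fun z => v z - w z) = f v - f w.
Proof.
move=> [H _ _] cv cw; have := H (-1) w v cw cv; rewrite mulN1r addrC => <-.
by congr f; apply/funext => z; rewrite mulN1r addrC.
Qed.

Lemma dualN f w : dualC0_ball l f -> CC w -> f (fun z => - w z) = - f w.
Proof.
move=> bf cw; have cc : CC (fun=> 0 : R) by apply: continuous_CC => z; exact: cvg_cst.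
have f0 : f (fun=> 0) = 0.
  by have := dualB bf cc cc; rewrite !subrr.
have := dualB bf cc cw; rewrite f0 sub0r => <-.
by congr f; apply/funext => z; rewrite sub0r.
Qed.

Lemma dual_opp f : dualC0_ball l f -> dualC0_ball l (fun w => - f w).
Proof.
move=> [H1 H2 H3]; split.
- by move=> a g h cg ch; rewrite H1// opprD mulrN.
- by move=> g h cg ch gh; rewrite (H2 _ _ cg ch gh).
- by move=> g cg; rewrite normrN; exact: H3.
Qed.

(** Banach-Alaoglu with a pointwise limit. On arguments not continuous on the closure the limit
    functional is arbitrary, since [dualC0_ball] constrains continuous arguments only. *)
Lemma dual_closed (U : set_system nat) (x_ : nat -> (P -> R) -> R) : UltraFilter U ->
  (forall i, dualC0_ball l (x_ i)) ->
  exists2 f, dualC0_ball l f & forall w, CC w -> (fun i => x_ i w) @ U --> f w.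
Proof.
move=> UU bx.
have ex (w : P -> R) : exists y : R, CC w -> (fun i => x_ i w) @ U --> y /\ `|y| <= supnorm l w.
  have [cw|nc] := pselect (CC w); last by exists 0.
  have [i|y cy yw] := @ultra_bounded_cvg R nat U (fun i => x_ i w) (supnorm l w) UU.
    by have [_ _ H] := bx i; exact: H.
  by exists y.
have [f Hf] := choice ex.
exists f; last by move=> w /Hf[].
split.
- move=> a g h cg ch; have [c1 _] := Hf _ (CCL (k := a) cg ch).
  have [c2 _] := Hf _ cg; have [c3 _] := Hf _ ch.
  apply: (ultra_unique UU c1).
  rewrite (_ : (fun i => _) = fun i => a * x_ i g + x_ i h); first exact: (ultraD UU (ultraZ UU (k := a) c2) c3).
  by apply/funext => i; have [H _ _] := bx i; rewrite H.
- move=> g h cg ch gh; have [c1 _] := Hf _ cg; have [c2 _] := Hf _ ch.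
  apply: (ultra_unique UU c1).
  rewrite (_ : (fun i => _) = fun i => x_ i h) //.
  by apply/funext => i; have [_ H _] := bx i; exact: H.
- by move=> g /Hf[].
Qed.

(** Extension by zero contributes nothing to the integral, and raising to a positive power preserves
    comparison with 1. *)
Lemma Lp_ballE (p : \bar R) (f : P -> R) : (1 < p)%E ->
  Lp_ball l p f <-> unit_ball (@mu2s R) Om p f.
Proof.
move=> p1; rewrite /Lp_ball /unit_ball.
suff H : measurable_fun Om f -> (('N[@leb2 R]_p[EFin \o (f \_ (Omega l))] <= 1)%E <->
   match p with
  | p%:E => (\int[mu]_(z in Om) (`|f z| `^ p)%:E <= 1)%E
  | +oo%E => {ae mu, forall z, Om z -> `|f z| <= 1}
  | -oo%E => False
  end).
  by split=> -[mf h]; split => //; apply/H.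
move=> mf; rewrite unlock; case: p p1 => [p| |]//.
  rewrite lte_fin => p1; have p0 : 0 < p by apply: lt_trans p1.
  have -> : (\int[@leb2 R]_x `|(EFin \o (f \_ (Omega l))) x| `^ p =
      \int[mu]_(z in Om) (`|f z| `^ p)%:E)%E.
    rewrite [RHS]integral_mkcond; apply: eq_integral => z _.
    rewrite /patch /=; case: ifP => _ //.
    by rewrite normr0 powR0// gt_eqF.
  have : (0 <= \int[mu]_(z in Om) (`|f z| `^ p)%:E)%E.
    by apply: integral_ge0 => z _; rewrite lee_fin powR_ge0.
  move: (integral _ _ _) => -[r r0| _|//]; last first.
    by rewrite poweRyr ?invr_eq0 ?gt_eqF//; split; rewrite leNgt ltry.
  rewrite poweR_EFin !lee_fin.
  have pr : (r `^ p^-1) `^ p = r by rewrite -powRrM mulVf ?gt_eqF// powRr1.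
  have one (q : R) : 1 `^ q = 1 :> R by rewrite powR1.
  split=> h.
    rewrite -pr -[X in _ <= X](one p); apply: ge0_ler_powR; rewrite ?nnegrE ?powR_ge0//; exact: ltW.
  rewrite -[X in _ <= X](one p^-1); apply: ge0_ler_powR; rewrite ?nnegrE ?invr_ge0//; exact: ltW.
move=> _.
(* For p = +oo the norm is the essential supremum on condition that the whole space has positive
   measure. *)
have mu0 : (0 < @leb2 R setT)%E.
  apply: lt_le_trans (_ : (mu Om <= _)%E).
    by rewrite (mu2_Omega (ltW l0)) lte_fin !mulr_gt0 ?pi_gt0.
  by apply: (@le_measure _ _ _ mu); rewrite ?inE//.
rewrite mu0; split.
  move=> /ess_supP; apply: filterS => z + Oz.
  by rewrite /= /patch mem_set// lee_fin.
move=> H; apply/ess_supP; apply: filterS H => z H.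
rewrite /= /patch; case: ifPn => [/set_mem/H|_]; first by rewrite lee_fin.
by rewrite normr0 lee_fin.
Qed.

(** * Weighted pairings with L^p data *)

Section WeightedLp.
Variables (p : \bar R) (k : P -> R) (N : R).
Hypothesis p1 : (1 < p)%E.
Hypothesis mk : measurable_fun Om k.
Hypothesis kN : forall z, Om z -> `|k z| <= N.
Local Notation pr f w := (I (fun z => f z * (k z * w z))).

Let N0 : 0 <= N.
Proof.
apply: le_trans (kN (z := (pi / 2, 0)) _) => //; split => /=; rewrite ?oppr_lt0 ?l0//.
by rewrite divr_gt0 ?pi_gt0//= ltr_pdivrMr// ltr_pMr ?pi_gt0// ltr1n.
Qed.

Let kw_meas (w : P -> R) : CC w -> measurable_fun Om (fun z => k z * w z).
Proof. by move=> cw; apply: measurable_funM => //; exact: CC_measurable. Qed.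

Let kw_bound (w : P -> R) (m : R) z : Om z -> `|w z| <= m -> `|k z * w z| <= N * m.
Proof. by move=> Oz wm; rewrite normrM ler_pM// kN. Qed.

Let ball_i f : Lp_ball l p f -> int f.
Proof.
move=> /(Lp_ballE _ p1) bf; exact (@unit_ball_int _ _ R (@mu2s R) Om mO fO p f p1 bf).
Qed.

Let fkw_int f (w : P -> R) : Lp_ball l p f -> CC w -> int (fun z => f z * (k z * w z)).
Proof.
move=> /ball_i i_f cw; have [M HM] := CC_bounded cw.
by apply: (int1Mb mO i_f (kw_meas cw) (M := N * M)) => z Oz; exact: kw_bound (HM z Oz).
Qed.

Lemma Lp0 : Lp_ball l p (fun=> 0).
Proof.
apply/(Lp_ballE _ p1); split=> //; case: p p1 => [q| |]// q1.
  rewrite lte_fin in q1; rewrite integral0_eq// => z _.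
  by rewrite normr0 powR0// gt_eqF// (lt_trans ltr01).
by apply: aeW => z _; rewrite normr0.
Qed.

Lemma Lp_opp f : Lp_ball l p f -> Lp_ball l p (fun z => - f z).
Proof.
move=> /(Lp_ballE _ p1) bf; apply/(Lp_ballE _ p1).
exact (@unit_ballN _ _ R (@mu2s R) Om p f bf).
Qed.

(** The factor [I (fun=> 1) + 1] bounds the L^1 norm on the ball, and [N] bounds the weight. *)
Lemma Lp_bound f (w : P -> R) (m : R) : Lp_ball l p f -> CC w ->
  (forall z, clOmega l z -> `|w z| <= m) ->
  `|pr f w| <= (I (fun=> 1) + 1) * N * m.
Proof.
move=> bf cw wm; have i_f := ball_i bf.
apply: le_trans (_ : I (fun z => N * m * `|f z|) <= _).
  apply: norm_intR_le => //; [exact: fkw_int|by apply: int1Z => //; exact: int1_norm|].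
  move=> z Oz; rewrite normrM mulrC; apply: ler_wpM2r => //.
  by apply: kw_bound => //; apply: wm; exact: Omega_sub.
have m0 : 0 <= m by apply: le_trans (wm _ (clOmega00 l0)).
rewrite (intRZ mO); last exact: int1_norm.
rewrite mulrC -mulrA; apply: ler_wpM2r; first exact: mulr_ge0.
by have /(Lp_ballE _ p1) bf' := bf; exact (@unit_ball_intR_le _ _ R (@mu2s R) Om mO fO p f p1 bf').
Qed.

Lemma LpB f (v w : P -> R) : Lp_ball l p f -> CC v -> CC w ->
  pr f (fun z => v z - w z) = pr f v - pr f w.
Proof.
move=> bf cv cw; rewrite -intRB//; [|exact: fkw_int..].
by apply: eq_intR => z _; rewrite !mulrBr.
Qed.

Lemma Lp_closed (U : set_system nat) (f_ : nat -> P -> R) : UltraFilter U ->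
  (forall i, Lp_ball l p (f_ i)) ->
  exists2 f, Lp_ball l p f & forall w, CC w -> (fun i => pr (f_ i) w) @ U --> pr f w.
Proof.
move=> UU bf.
have bf' i : unit_ball (@mu2s R) Om p (f_ i) by apply/(Lp_ballE _ p1).
have [f [Bf cf]] := @weak_limit_Lp _ _ R (@mu2s R) Om mO fO nat U UU f_ p p1 bf'.
exists f; first by apply/(Lp_ballE _ p1).
move=> w cw; apply: cf; first exact: kw_meas.
have [M HM] := CC_bounded cw; exists (N * M) => z Oz.
by apply: kw_bound => //; exact: HM.
Qed.

Lemma Lp_maximizer (sigma A B : R) (psim psip : P -> R) (D : set P) : 0 < sigma < 1 -> 0 < A -> 0 <= B ->
  CC psim -> CC psip -> (forall z, clOmega l z -> psim z <= 0 <= psip z) ->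
  measurable (D : set P2) -> D `<=` Omega l ->
  exists f, is_maximizer (Lp_ball l p)
    (fun f => SolG l sigma A B psim psip D (fun w => pr f w)) l f.
Proof.
move=> s01 A0 B0 cm cp psi0 mD DO.
have C0 : 0 <= (I (fun=> 1) + 1) * N by rewrite mulr_ge0// addr_ge0// intR_ge0.
apply: (@maximizer_exists R l sigma A B psim psip D l0 s01 A0 B0 cm cp psi0 mD DO
  (P -> R) (Lp_ball l p) (fun f w => pr f w) _ C0).
- exists (fun=> 0); first exact: Lp0.
  move=> w _; rewrite (@eq_intR _ _ _ mu Om _ (fun=> 0)) ?intR0// => z _.
  by rewrite mul0r.
- by move=> f w m bf cw wm; exact: Lp_bound.
- by move=> f v w bf cv cw; exact: LpB.
- exact: Lp_closed.
Qed.

End WeightedLp.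

Lemma dual_maximizer (sigma A B : R) (psim psip : P -> R) (D : set P) : 0 < sigma < 1 -> 0 < A -> 0 <= B ->
  CC psim -> CC psip -> (forall z, clOmega l z -> psim z <= 0 <= psip z) ->
  measurable (D : set P2) -> D `<=` Omega l ->
  exists f, is_maximizer (dualC0_ball l) (SolG l sigma A B psim psip D) l f.
Proof.
move=> s01 A0 B0 cm cp psi0 mD DO.
apply: (@maximizer_exists R l sigma A B psim psip D l0 s01 A0 B0 cm cp psi0 mD DO
  _ (dualC0_ball l) (fun f w => f w) 1 ler01).
- by exists (fun=> 0); first exact: dual0.
- by move=> f w m bf cw wm; exact: dual_bound.
- by move=> f v w bf cv cw; exact: dualB.
- exact: dual_closed.
Qed.

End Instances.

(** * Symmetry *)

Section Symmetry.
Variables (R : realType) (l : R).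
Local Notation P := (R * R)%type.
Local Notation CC w := {within clOmega l, continuous w}.

Lemma bformN sigma (E : set P) (a b c p q r : P -> R) :
  bform sigma E (fun z => - a z) (fun z => - b z) (fun z => - c z)
    ((fun z => - p z) \- (fun z => - a z)) ((fun z => - q z) \- (fun z => - b z))
    ((fun z => - r z) \- (fun z => - c z)) =
  bform sigma E a b c (p \- a) (q \- b) (r \- c).
Proof. by congr Rintegral; apply/funext => z /=; ring. Qed.

Lemma inKN (psim psip v : P -> R) : (forall z, clOmega l z -> - psim z = psip z) ->
  inK l psim psip v -> inK l psim psip (fun z => - v z).
Proof.
move=> psi [[a [b [c Hv]]] vK]; split.
  by exists (fun z => - a z), (fun z => - b z), (fun z => - c z); exact: H2starN.
move=> z Cz; have /andP[h1 h2] := vK z Cz; have e := psi z Cz.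
by rewrite -e lerN2 h1 andbT lerNr e.
Qed.

(** The inequality for -u at phi is the one for u at -phi, admissible because the obstacles are
    opposite. Stating the reflection through a second pairing covers the negative of a functional
    and of an L^p datum at once. *)
Lemma SolGN sigma A B (psim psip : P -> R) D (pair pair' : (P -> R) -> R) u :
  (forall z, clOmega l z -> - psim z = psip z) ->
  (forall w, CC w -> pair' w = pair (fun z => - w z)) ->
  SolG l sigma A B psim psip D pair u ->
  SolG l sigma A B psim psip D pair' (fun z => - u z).
Proof.
move=> psi pp [Ku Hu]; split; first exact: inKN.
move=> a b c HNu phi p q r Kphi Hphi.
have Hu' := H2starN HNu.
rewrite (_ : (fun z => - - u z) = u) in Hu'; last by apply/funext => z; rewrite opprK.
have := Hu _ _ _ Hu' _ _ _ _ (inKN psi Kphi) (H2starN Hphi).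
rewrite !bformN pp; last by apply: CCB; [exact: inK_CC Kphi|apply: CCN; exact: inK_CC Ku].
apply: le_trans; rewrite le_eqVlt; apply/orP; left; apply/eqP.
by congr pair; apply/funext => z; rewrite opprD opprK.
Qed.

Lemma AinfN (u : P -> R) : Ainf l (fun z => - u z) = Ainf l u.
Proof. by rewrite /Ainf; congr (sup [set _ | z in _]); apply/funext => z; rewrite normrN. Qed.

Lemma maximizerN (X : Type) (F : set X) (Sol : X -> (P -> R) -> Prop) x x' :
  F x' -> (forall u, Sol x u -> Sol x' (fun z => - u z)) ->
  is_maximizer F Sol l x -> is_maximizer F Sol l x'.
Proof.
move=> Fx' S [_ [u [Su H]]]; split=> //; exists (fun z => - u z); split; first exact: S.
by move=> y v Fy Sy; rewrite AinfN; exact: H Fy Sy.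
Qed.

End Symmetry.

Theorem theorem3p1 (R : realType) (l sigma alpha beta : R)
    (psim psip : R * R -> R) (D : set (R * R)) (p : \bar R) :
  0 < l -> 0 < sigma < 1 -> 0 < alpha -> alpha < 1 -> 1 < beta ->
  {within clOmega l, continuous psim} -> {within clOmega l, continuous psip} ->
  (forall z, clOmega l z -> psim z <= 0 <= psip z) ->
  (exists z, clOmega l z /\ psim z <> 0) ->
  (exists z, clOmega l z /\ psip z <> 0) ->
  open D -> D `<=` Omega l -> (1 < p)%E ->
  let MaxA := is_maximizer (dualC0_ball l)
                (fun f => Sol1 l sigma alpha beta psim psip D f) l in
  let MaxB1 := is_maximizer (Lp_ball l p)
                (fun f => Sol1 l sigma alpha beta psim psip D
                            (fun w => Rintegral (@leb2 R) (Omega l)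
                                        (fun z => f z * w z))) l in
  let MaxB2 := is_maximizer (Lp_ball l p)
                (Sol2 l sigma alpha beta psim psip D) l in
  ((exists f0, MaxA f0) /\ (exists f0, MaxB1 f0) /\ (exists f0, MaxB2 f0)) /\
  ((forall z, clOmega l z -> - psim z = psip z) ->
     (forall f, MaxA f -> MaxA (fun g => - f g)) /\
     (forall f, MaxB1 f -> MaxB1 (fun z => - f z)) /\
     (forall f, MaxB2 f -> MaxB2 (fun z => - f z))).
Proof.
move=> l0 s01 a0 a1 b1 cm cp psi0 _ _ oD DO p1 MaxA MaxB1 MaxB2.
have mD := open_measurable2 oD.
have ba : 0 <= beta - alpha by rewrite subr_ge0 ltW// (lt_trans a1).
have bf0 : 0 < beta by rewrite (lt_trans ltr01).
pose k (z : R * R) : R := beta * \1_D z + alpha * \1_(~` D) z.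
have mk : measurable_fun (Omega l : set (measurableTypeR R * measurableTypeR R)) k.
  apply: measurable_funD; apply: measurable_funM => //; apply: indic_meas => //.
  exact: measurableC.
have kN z : Omega l z -> `|k z| <= beta + alpha.
  move=> _; rewrite /k !indicE in_setC; case: (_ \in _) => /=; rewrite ?mulr1 ?mulr0 ?addr0 ?add0r.
    by rewrite gtr0_norm// lerDl ltW.
  by rewrite gtr0_norm// lerDr ltW.
(* For E_1 the constituents are already those of [SolG]; only the constant weight 1 is inserted in
   the pairing. *)
have eB1 : (fun f : R * R -> R => Sol1 l sigma alpha beta psim psip D
     (fun w => Rintegral (@leb2 R) (Omega l) (fun z => f z * w z))) =
   (fun f => SolG l sigma alpha (beta - alpha) psim psip D
     (fun w => intR (@mu2 R) (Omega l) (fun z => f z * ((fun=> 1) z * w z)))).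
  apply/funext => f; congr (SolG _ _ _ _ _ _ _ _); apply/funext => w.
  by rewrite intR_leb2; apply: eq_intR => z _; rewrite mul1r.
(* For E_2 the form over [D] enters with coefficient 0 and the two coefficients move into the weight
   [k]. *)
have eB2 : Sol2 l sigma alpha beta psim psip D =
   (fun f => SolG l sigma 1 0 psim psip D
     (fun w => intR (@mu2 R) (Omega l) (fun z => f z * (k z * w z)))).
  apply/funext => f; apply/funext => u; rewrite /Sol2 /SolG.
  have e (w : R * R -> R) : Rintegral (@leb2 R) (Omega l)
      (fun z => (beta * \1_D z + alpha * \1_(~` D) z) * f z * w z) =
      intR (@mu2 R) (Omega l) (fun z => f z * (k z * w z)).
    by rewrite intR_leb2; apply: eq_intR => z _; rewrite mulrAC mulrC.
  apply/propext; split=> -[Ku H]; split=> // a b c Hu phi q r s Kphi Hphi.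
    by rewrite mul1r mul0r addr0 -e; exact: H Hu _ _ _ _ Kphi Hphi.
  by rewrite e; have := H _ _ _ Hu _ _ _ _ Kphi Hphi; rewrite mul1r mul0r addr0.
split.
  split; first exact: (dual_maximizer l0 s01 a0 ba cm cp psi0 mD DO).
  rewrite /MaxB1 eB1 /MaxB2 eB2; split.
    apply: (@Lp_maximizer R l l0 p (fun=> 1) 1) => //.
    by move=> z _; rewrite normr1.
  exact: (@Lp_maximizer R l l0 p k (beta + alpha)).
move=> psi; split; [|split].
- move=> f Mf; have [bf _] := Mf; apply: maximizerN Mf; first exact: dual_opp.
  move=> u; apply: (SolGN psi) => w cw; by rewrite (dualN bf cw).
- rewrite /MaxB1 eB1 => f Mf; have [bf _] := Mf; apply: maximizerN Mf; first exact: Lp_opp.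
  move=> u; apply: (SolGN psi) => w cw; apply: eq_intR => z _; ring.
- rewrite /MaxB2 eB2 => f Mf; have [bf _] := Mf; apply: maximizerN Mf; first exact: Lp_opp.
  move=> u; apply: (SolGN psi) => w cw; apply: eq_intR => z _; ring.
Qed.
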